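(* Let $\gamma:[0,1]\to\Omega$ be a regular, non self-intersecting $C^1$-curve with image $\Gamma$, and let $(\rho_0,\mu_0),(\rho_1,\mu_1)\in\mathcal{P}_{\rm adm}(\Gamma)$ be the initial and final data. Suppose that the infimum $$\inf_{(J_t,V_t,\rho_t,\mu_t,f_t,G_t^0,G_t^1)\in{\rm CE}(\Gamma)}\int_0^1\mathcal{A}_\Gamma(J_t,\mathcal{V}_t,\rho_t,\mu_t,f_t,\mathcal{G}_t^0,\mathcal{G}_t^1)\,dt$$ is finite. Then there exists a minimizer $(J_t,V_t,\rho_t,\mu_t,f_t,G_t^0,G_t^1)\in{\rm CE}(\Gamma)$, i.e. the infimum is attained.
   Context: Setting and notation. $\Omega\subset\mathbb{R}^d$ is compact and connected. A $C^1$-curve $\gamma:[0,1]\to\Omega$ is regular if $|\gamma'|\neq0$ everywhere, and non self-intersecting if it is injective; $\Gamma=\gamma([0,1])$. Put $X_\Omega=[0,1]\times\Omega$, $X_\Gamma=[0,1]\times\Gamma$. For a set $A$ (subset of Euclidean space), $M(A)$, $M_+(A)$, $P(A)$ denote the finite Borel measures (signed), the non-negative ones, and the probability measures on $A$; $M(A,\mathbb{R}^N)$ the vector-valued ones. $M_{[0,1]}(A)$ (resp. $M_{[0,1]}(A,\mathbb{R}^N)$) denotes Borel families $t\mapsto\nu_t$, $t\in[0,1]$, of measures in $M(A)$ (resp. $M(A,\mathbb{R}^N)$). For $p\in\Gamma$, $\tau_\Gamma(p)=\gamma'(s)/|\gamma'(s)|$ with $p=\gamma(s)$ is the unit tangent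 and $T_p\Gamma$ the tangent space; a tangential measure $V\in M(\Gamma,T_p\Gamma)$ is written $V=\tau_\Gamma\mathcal{V}$ with $\mathcal{V}\in M(\Gamma,\mathbb{R})$, and $G^i\in M(\{\gamma(i)\},T_{\gamma(i)}\Gamma)$ is written $G^i=\tau_\Gamma(\gamma(i))\mathcal{G}^i$ with $\mathcal{G}^i\in M(\{\gamma(i)\},\mathbb{R})$, $i=0,1$. For $\mu\in M(\Gamma)$, $\bar\mu\in M(\Omega)$ is its extension by zero. For $\nu\in M(\Gamma,\mathbb{R}^N)$, $\nu^\gamma=(\gamma^{-1})_\#\nu\in M([0,1],\mathbb{R}^N)$. $\mathcal{D}_{\rm adm}(\Gamma)=M_{[0,1]}(\Omega,\mathbb{R}^d)\times M_{[0,1]}(\Gamma,T_p\Gamma)\times M_{[0,1]}(\Omega)\times M_{[0,1]}(\Gamma)\times M_{[0,1]}(\Gamma)\times M_{[0,1]}(\{\gamma(0)\},T_{\gamma(0)}\Gamma)\times M_{[0,1]}(\{\gamma(1)\},T_{\gamma(1)}\Gamma)$ is the set of tuples $(J_t,V_t,\rho_t,\mu_t,f_t,G^0_t,G^1_t)$, and $\mathcal{P}_{\rm adm}(\Gamma)=\{(\rho,\mu)\in M_+(\Omega)\times M_+(\Gamma):\rho+\bar\mu\in P(\Omega)\}$. Coupled continuity equations. Given data $(\rho_0,\mu_0),(\rho_1,\mu_1)\in\mathcal{P}_{\rm adm}(\Gamma)$, a tuple in $\mathcal{D}_{\rm adm}(\Gamma)$ belongs to ${\rm CE}(\Gamma)$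 if $$\int_0^1\!\!\int_\Omega\partial_t\varphi\,d\rho_tdt+\int_0^1\!\!\int_\Omega\nabla\varphi\cdot dJ_tdt-\int_0^1\!\!\int_\Gamma\varphi\,df_tdt-\int_0^1\!\!\int_{\{\gamma(0)\}}\varphi\,d\mathcal{G}^0_tdt+\int_0^1\!\!\int_{\{\gamma(1)\}}\varphi\,d\mathcal{G}^1_tdt=\int_\Omega\varphi(1,x)\,d\rho_1-\int_\Omega\varphi(0,x)\,d\rho_0$$ for every $\varphi\in C^1(X_\Omega)$, and $$\int_0^1\!\!\int_0^1\partial_t\psi\,d\mu_t^\gamma dt+\int_0^1\!\!\int_0^1\partial_s\psi\,|\gamma'(s)|^{-1}d\mathcal{V}_t^\gamma dt+\int_0^1\!\!\int_0^1\psi\,df_t^\gamma dt+\int_0^1\!\!\int_{\{0\}}\psi\,d(\mathcal{G}^0_t)^\gamma dt-\int_0^1\!\!\int_{\{1\}}\psi\,d(\mathcal{G}^1_t)^\gamma dt=\int_0^1\psi(1,s)\,d\mu_1^\gamma-\int_0^1\psi(0,s)\,d\mu_0^\gamma$$ for every $\psi=\psi(t,s)\in C^1([0,1]^2)$. Mobilities and action. An admissible mobility is an upper semicontinuous concave $m:[0,\infty)\to[0,\infty)\cup\{-\infty\}$ with ${\rm dom}(m)=\{m>-\infty\}=[a,b]$, $0\le a<b$ finite, and $m>0$ on $(a,b)$. Fix admissible mobilities $m_\Omega$ (domain $[a^\Omega,b^\Omega]$) and $m_\Gamma$ (domain $[a^\Gamma,b^\Gamma]$). For $\bullet\in\{\Omega,\Gamma\}$: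 $\Psi_\bullet(z,w)=|w|^2/m_\bullet(z)$ if $z\in{\rm dom}(m_\bullet)$, $m_\bullet(z)\ne0$; $\Psi_\bullet(z,w)=0$ if $w=0$ and $m_\bullet(z)=0$; $\Psi_\bullet(z,w)=+\infty$ if ($m_\bullet(z)=0$ and $w\neq0$) or $z\notin{\rm dom}(m_\bullet)$. Fix $\alpha_1,\alpha_2,\alpha_3>0$ and reference measures $\lambda_\Omega\in M_+(\Omega)$, $\lambda_\Gamma\in M_+(\Gamma)$, $\lambda_E\in M_+(\{\gamma(0)\}\cup\{\gamma(1)\})$. Then $$\mathcal{A}_\Gamma=\int_\Omega\Psi_\Omega\Big(\tfrac{d\rho_t}{d\lambda_\Omega},\tfrac{dJ_t}{d\lambda_\Omega}\Big)d\lambda_\Omega+\int_\Gamma\Big[\alpha_1\Psi_\Gamma\Big(\tfrac{d\mu_t}{d\lambda_\Gamma},\tfrac{d\mathcal{V}_t}{d\lambda_\Gamma}\Big)+\alpha_2\Psi_\Gamma\Big(\tfrac{d\mu_t}{d\lambda_\Gamma},\tfrac{df_t}{d\lambda_\Gamma}\Big)\Big]d\lambda_\Gamma+\alpha_3\int_{\{\gamma(0)\}\cup\{\gamma(1)\}}\sum_{i=0}^1\Psi_\Gamma\Big(\tfrac{d(\mu_t\llcorner\gamma(i))}{d\lambda_E},\tfrac{d\mathcal{G}^i_t}{d\lambda_E}\Big)d\lambda_E,$$ where $\mu_t\llcorner\gamma(i)$ is the restriction of $\mu_t$ to $\{\gamma(i)\}$; $\mathcal{A}_\Gamma=+\infty$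 if one of the measures is not absolutely continuous with respect to the corresponding reference measure. *)

(* Defs.v *)
From HB Require Import structures.
From mathcomp Require Import all_boot all_order all_algebra.
From mathcomp Require Import all_classical all_reals all_analysis measurable_realfun.

Set Implicit Arguments.
Unset Strict Implicit.
Unset Printing Implicit Defensive.

Import Order.TTheory GRing.Theory Num.Theory.
Import numFieldNormedType.Exports.

Local Open Scope classical_set_scope.
Local Open Scope ring_scope.

(* The norm of ['rV[R]_d] in the library is the sup norm (same topology); the
   modulus appearing in the model is the Euclidean one. *)
Definition enorm (R : realType) (d : nat) (v : 'rV[R]_d) : R :=
  Num.sqrt (\sum_(i < d) v ord0 i ^+ 2).

Definition Rd (R : realType) (d : nat) :=
  g_sigma_algebraType (@open 'rV[R]_d).

Lemma measurable_point (R : realType) (d : nat) (p : 'rV[R]_d) :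
  measurable ([set p] : set (Rd R d)).
Proof.
rewrite -[X in measurable X]setCK; apply: measurableC.
apply: sub_sigma_algebra; apply: closed_openC.
exact: (@accessible_closed_set1 _ (hausdorff_accessible (@norm_hausdorff _ _))).
Qed.

Definition Icc01 (R : realType) : set R := `[0, 1].
Arguments Icc01 {R}.

Section charges.
Context (R : realType) (dT : measure_display) (T : measurableType dT).

Lemma hahn_exists (nu : {charge set T -> \bar R}) :
  exists PN : set T * set T, hahn_decomposition nu PN.1 PN.2.
Proof. by have [P [N h]] := Hahn_decomposition nu; exists (P, N). Qed.

Definition hahn_cid (nu : {charge set T -> \bar R}) := svalP (cid (hahn_exists nu)).

(* The value does not depend on the chosen Hahn decomposition. *)
Definition cint (nu : {charge set T -> \bar R}) (D : set T) (g : T -> R) : R :=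
  \int[jordan_pos (hahn_cid nu)]_(x in D) g x
  - \int[jordan_neg (hahn_cid nu)]_(x in D) g x.

(* Measures on a (Borel) subset [A] are represented by measures on the ambient
   space that vanish outside [A]; extension by zero is then the identity. *)
Definition concentrated (A : set T) (nu : set T -> \bar R) : Prop :=
  forall B, measurable B -> B `<=` ~` A -> nu B = 0%E.

Definition Mplus (A : set T) (nu : {charge set T -> \bar R}) : Prop :=
  concentrated A nu /\ (forall B, measurable B -> (0 <= nu B)%E).

Definition Prob (A : set T) (nu : {charge set T -> \bar R}) : Prop :=
  Mplus A nu /\ nu A = 1%E.

Definition Mfamily (A : set T) (nu : R -> {charge set T -> \bar R}) : Prop :=
  (forall t, Icc01 t -> concentrated A (nu t)) /\
  (forall B, measurable B -> measurable_fun Icc01 (fun t => nu t B)).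

Definition density (nu : {charge set T -> \bar R})
    (lam : {finite_measure set T -> \bar R}) (x : T) : R :=
  fine (Radon_Nikodym nu lam x).

End charges.

(* [f_# nu]; the zero charge is only used when [f] is not measurable. *)
Definition pushcharge (R : realType) (d1 d2 : measure_display)
    (T1 : measurableType d1) (T2 : measurableType d2)
    (nu : {charge set T1 -> \bar R}) (f : T1 -> T2) : {charge set T2 -> \bar R} :=
  match pselect (measurable_fun setT f) with
  | left mf => measure_function_pushforward__canonical__charge_Charge nu mf
  | right _ => czero
  end.

Section curves.
Context (R : realType) (d : nat).
Implicit Type gamma : R -> 'rV[R]_d.

(* Only the values of [gamma] on [0,1] are relevant: derivatives are taken
   within [0,1] (one-sided at the end points). *)
Definition diff_quotient gamma (s h : R) : 'rV[R]_d :=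
  h^-1 *: (gamma (s + h) - gamma s).

Definition increments (s : R) : set_system R :=
  within [set h | Icc01 (s + h)] 0^'.

Definition speed gamma (s : R) : 'rV[R]_d :=
  lim (diff_quotient gamma s @ increments s).

Definition C1_curve gamma : Prop :=
  (forall s, Icc01 s -> cvg (diff_quotient gamma s @ increments s)) /\
  {within Icc01, continuous (speed gamma)}.

Definition regular gamma : Prop := forall s, Icc01 s -> enorm (speed gamma s) != 0.

Definition non_self_intersecting gamma : Prop := {in `[0, 1] &, injective gamma}.

Definition trace gamma : set 'rV[R]_d := gamma @` Icc01.

Definition param_inv gamma : Rd R d -> R := 'pinv_(fun=> 0) Icc01 gamma.

Lemma measurable_param_inv gamma :
  {within Icc01, continuous gamma} -> non_self_intersecting gamma ->
  measurable_fun setT (param_inv gamma).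
Proof.
move=> gamma_cont gamma_inj.
have inv_out p : ~ trace gamma p -> param_inv gamma p = 0.
  by move=> np; rewrite /param_inv /pinv_ splitV oinv_surj; case: pselect.
have invK s : Icc01 s -> param_inv gamma (gamma s) = s.
  move=> s01; rewrite /param_inv pinvKV ?inE//.
  by move=> x y; rewrite !inE; exact: gamma_inj.
apply: (measurability (@RGenCInfty.G R)); first exact: RGenCInfty.measurableE.
move=> _ [_ [r ->] <-]; rewrite setTI.
have [r0|r0] := leP r 0.
  rewrite [X in measurable X](_ : _ = setT); first exact: measurableT.
  apply/seteqP; split=> // p _; rewrite /= in_itv/= andbT (le_trans r0)//.
  have [[s s01 <-]|/inv_out ->//] := pselect (trace gamma p).
  by rewrite invK//; move: s01; rewrite /Icc01/= in_itv/= => /andP[].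
rewrite [X in measurable X](_ : _ = gamma @` (Icc01 `&` `[r, +oo[)); last first.
  apply/seteqP; split=> [p /=|_ [s [s01 sr] <-]]; last by rewrite /= invK.
  have [[s s01 <-]|/inv_out ->] := pselect (trace gamma p).
    by rewrite invK// => sr; exists s.
  by rewrite in_itv/= andbT leNgt r0.
rewrite -[X in measurable X]setCK; apply: measurableC.
apply: sub_sigma_algebra; apply: closed_openC.
apply: compact_closed; first exact: norm_hausdorff.
apply: continuous_compact.
  by apply: continuous_subspaceW gamma_cont; exact: subIsetl.
apply: (@subclosed_compact _ _ Icc01); last exact: subIsetl.
- by apply: closedI; [exact: interval_closed|exact: interval_closed].
- exact: segment_compact.
Qed.

Definition unit_tangent gamma (p : 'rV[R]_d) : 'rV[R]_d :=
  (enorm (speed gamma (param_inv gamma p)))^-1 *: speed gamma (param_inv gamma p).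

(* [nu^gamma] *)
Definition pullback gamma (nu : {charge set (Rd R d) -> \bar R}) :
    {charge set R -> \bar R} :=
  pushcharge nu (param_inv gamma).

(* [V = tau_Gamma nu] *)
Definition is_tangential gamma (V : 'I_d -> {charge set (Rd R d) -> \bar R})
    (nu : {charge set (Rd R d) -> \bar R}) : Prop :=
  forall i (B : set (Rd R d)), measurable B ->
    V i B = (cint nu B (fun p => unit_tangent gamma p ord0 i))%:E.

End curves.

(* Admissible test functions on a compact set K are the restrictions to K of
   C^1 functions on the whole (finite-dimensional) space. *)
Definition is_C1 (R : realType) (V : normedModType R) (f : V -> R) : Prop :=
  (forall x, differentiable f x) /\ (forall v, continuous ('D_v f)).

Record flow (R : realType) (d : nat) := Flow {
  fJ : R -> 'I_d -> {charge set (Rd R d) -> \bar R};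
  fV : R -> 'I_d -> {charge set (Rd R d) -> \bar R};
  frho : R -> {charge set (Rd R d) -> \bar R};
  fmu : R -> {charge set (Rd R d) -> \bar R};
  ff : R -> {charge set (Rd R d) -> \bar R};
  fG0 : R -> 'I_d -> {charge set (Rd R d) -> \bar R};
  fG1 : R -> 'I_d -> {charge set (Rd R d) -> \bar R};
  (* the scalar densities of the tangential measures fV, fG0, fG1, which they
     determine uniquely: see tangential_family *)
  fcV : R -> {charge set (Rd R d) -> \bar R};
  fcG0 : R -> {charge set (Rd R d) -> \bar R};
  fcG1 : R -> {charge set (Rd R d) -> \bar R}
}.

Section coupled_continuity_equations.
Context (R : realType) (d : nat).
Variables (Omega : set 'rV[R]_d) (gamma : R -> 'rV[R]_d).
Let Gamma : set (Rd R d) := trace gamma.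

Definition tangential_family (A : set (Rd R d))
    (V : R -> 'I_d -> {charge set (Rd R d) -> \bar R})
    (nu : R -> {charge set (Rd R d) -> \bar R}) : Prop :=
  [/\ forall i, Mfamily A (fun t => V t i), Mfamily A nu &
      forall t, Icc01 t -> is_tangential gamma (V t) (nu t)].

Definition Dadm (x : flow R d) : Prop :=
  [/\ forall i, Mfamily (Omega : set (Rd R d)) (fun t => fJ x t i),
      tangential_family Gamma (fV x) (fcV x),
      Mfamily (Omega : set (Rd R d)) (frho x),
      Mfamily Gamma (fmu x) /\ Mfamily Gamma (ff x) &
      tangential_family [set gamma 0] (fG0 x) (fcG0 x) /\
      tangential_family [set gamma 1] (fG1 x) (fcG1 x)].

Definition Padm (rho mu : {charge set (Rd R d) -> \bar R}) : Prop :=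
  [/\ Mplus (Omega : set (Rd R d)) rho, Mplus Gamma mu &
      Prob (Omega : set (Rd R d)) (cadd rho mu)].

Definition tint (g : R -> R) : R := \int[lebesgue_measure]_(t in Icc01) g t.

Definition tintegrable (g : R -> R) : Prop :=
  lebesgue_measure.-integrable Icc01 (EFin \o g).

(* All the time integrals are required to make sense: Rintegral is a total
   operator with an arbitrary value on non-integrable functions. *)
Definition CE_bulk (rho0 rho1 : {charge set (Rd R d) -> \bar R})
    (x : flow R d) (phi : R * 'rV[R]_d -> R) : Prop :=
  let dt_rho t := cint (frho x t) Omega (fun p => 'D_(1, 0) phi (t, p)) in
  let grad_J t := \sum_(i < d)
    cint (fJ x t i) Omega (fun p => 'D_(0, delta_mx ord0 i) phi (t, p)) in
  let exch t := cint (ff x t) Gamma (fun p => phi (t, p)) in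
  let end0 t := cint (fcG0 x t) [set gamma 0] (fun p => phi (t, p)) in
  let end1 t := cint (fcG1 x t) [set gamma 1] (fun p => phi (t, p)) in
  [/\ tintegrable dt_rho, tintegrable grad_J, tintegrable exch,
      tintegrable end0 /\ tintegrable end1 &
      tint dt_rho + tint grad_J - tint exch - tint end0 + tint end1 =
      cint rho1 Omega (fun p => phi (1, p)) - cint rho0 Omega (fun p => phi (0, p))].

Definition CE_curve (mu0 mu1 : {charge set (Rd R d) -> \bar R})
    (x : flow R d) (psi : R * R -> R) : Prop :=
  let dt_mu t := cint (pullback gamma (fmu x t)) Icc01
    (fun s => 'D_(1, 0) psi (t, s)) in
  let ds_V t := cint (pullback gamma (fcV x t)) Icc01
    (fun s => 'D_(0, 1) psi (t, s) * (enorm (speed gamma s))^-1) in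
  let exch t := cint (pullback gamma (ff x t)) Icc01 (fun s => psi (t, s)) in
  let end0 t := cint (pullback gamma (fcG0 x t)) [set 0] (fun s => psi (t, s)) in
  let end1 t := cint (pullback gamma (fcG1 x t)) [set 1] (fun s => psi (t, s)) in
  [/\ tintegrable dt_mu, tintegrable ds_V, tintegrable exch,
      tintegrable end0 /\ tintegrable end1 &
      tint dt_mu + tint ds_V + tint exch + tint end0 - tint end1 =
      cint (pullback gamma mu1) Icc01 (fun s => psi (1, s))
      - cint (pullback gamma mu0) Icc01 (fun s => psi (0, s))].

Definition CE (rho0 mu0 rho1 mu1 : {charge set (Rd R d) -> \bar R}) :
    set (flow R d) :=
  [set x | [/\ Dadm x,
     forall phi : R * 'rV[R]_d -> R, is_C1 phi -> CE_bulk rho0 rho1 x phi &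
     forall psi : R * R -> R, is_C1 psi -> CE_curve mu0 mu1 x psi]].

End coupled_continuity_equations.

Section action.
Context (R : realType).
Local Open Scope ereal_scope.

(* A mobility on [0,oo[ is extended by -oo to the negative half-line; this
   changes neither its domain nor its semicontinuity and concavity. *)
Record admissible_mobility (m : R -> \bar R) (a b : R) : Prop := {
  mob_range : forall z, m z = -oo \/ 0 <= m z < +oo;
  mob_usc : lower_semicontinuous (fun z => - m z);
  mob_concave : forall x y t : R, (0 <= t <= 1)%R ->
    t%:E * m x + (1 - t)%:E * m y <= m (t * x + (1 - t) * y)%R;
  mob_dom : forall z, -oo < m z <-> (a <= z <= b)%R;
  mob_a_ge0 : (0 <= a)%R;
  mob_a_lt_b : (a < b)%R;
  mob_gt0 : forall z, (a < z < b)%R -> 0 < m z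
}.

Definition Psi (m : R -> \bar R) (N : nat) (z : R) (w : 'rV[R]_N) : \bar R :=
  if m z == -oo then +oo
  else if m z == 0 then (if w == 0%R then 0 else +oo)
  else (enorm w ^+ 2 / fine (m z))%:E.

Definition Psi1 (m : R -> \bar R) (z w : R) : \bar R :=
  Psi m z (const_mx w : 'rV[R]_1).

Context (d : nat) (Omega : set 'rV[R]_d) (gamma : R -> 'rV[R]_d).
Variables (mO mG : R -> \bar R) (alpha1 alpha2 alpha3 : R).
Variables lamO lamG lamE : {finite_measure set (Rd R d) -> \bar R}.

Definition restr_point (nu : {charge set (Rd R d) -> \bar R}) (p : 'rV[R]_d) :
  {charge set (Rd R d) -> \bar R} := crestr0 nu (measurable_point p).

Definition all_abs_cont (x : flow R d) (t : R) : Prop :=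
  [/\ frho x t `<< lamO /\ (forall i, fJ x t i `<< lamO),
      [/\ fmu x t `<< lamG, fcV x t `<< lamG & ff x t `<< lamG],
      restr_point (fmu x t) (gamma 0%R) `<< lamE /\ fcG0 x t `<< lamE &
      restr_point (fmu x t) (gamma 1%R) `<< lamE /\ fcG1 x t `<< lamE].

Definition action (x : flow R d) (t : R) : \bar R :=
  if `[< all_abs_cont x t >] then
    \int[lamO]_(p in (Omega : set (Rd R d)))
      Psi mO (density (frho x t) lamO p) (\row_i density (fJ x t i) lamO p)
    + \int[lamG]_(p in (trace gamma : set (Rd R d)))
      (alpha1%:E * Psi1 mG (density (fmu x t) lamG p) (density (fcV x t) lamG p)
       + alpha2%:E * Psi1 mG (density (fmu x t) lamG p) (density (ff x t) lamG p))
    + alpha3%:E * \int[lamE]_(p in ([set gamma 0%R; gamma 1%R] : set (Rd R d)))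
      (Psi1 mG (density (restr_point (fmu x t) (gamma 0%R)) lamE p)
               (density (fcG0 x t) lamE p)
       + Psi1 mG (density (restr_point (fmu x t) (gamma 1%R)) lamE p)
                 (density (fcG1 x t) lamE p))
  else +oo.

Definition total_action (x : flow R d) : \bar R :=
  \int[lebesgue_measure]_(t in Icc01) action x t.

End action.

(* Main.v *)
(* A flow of finite action is encoded by the densities u of its measures with
   respect to the reference measures, on [0,1] x R^d. The continuity equations
   are linear in u; the action is convex in u, lower semicontinuous under a.e.
   convergence, and bounds the L^2 norm of u because the mobilities are concave
   with bounded domain. No weak compactness is needed: near-minimisers of the
   L^2 norm in decreasing sublevel sets of the action form a Cauchy sequence by
   the parallelogram identity, and a fast subsequence converges a.e. to a
   minimiser.
   Jointly measurable densities are limits of averages over the cells generated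
   by finitely many sets of a generating sequence of the Borel sets. Conversely,
   minimising densities are set to 0 at a null set of times so that the pointwise
   relations between the measures of the flow hold at every time. *)

Require Import Defs.
From HB Require Import structures.
From mathcomp Require Import all_boot all_order all_algebra.
From mathcomp Require Import all_classical all_reals all_analysis measurable_realfun.
From mathcomp Require Import ring lra.

Set Implicit Arguments.
Unset Strict Implicit.
Unset Printing Implicit Defensive.

Import Order.TTheory GRing.Theory Num.Theory.
Import numFieldNormedType.Exports.

Local Open Scope classical_set_scope.
Local Open Scope ring_scope.

(** * Series and the parallelogram identity *)

(** Each density lives in [L^2] of its own reference measure, and these measures are unrelated: the
    action reads [mu_t] through [lambda_Gamma] along the curve and through [lambda_E] at the end
    points. The two restrictions of [mu_t] are therefore unknowns of their own, tied to the density
    of [mu_t] by linear constraints, so that the feasible set stays affine. Convexity and lower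
    semicontinuity of [Psi] both come from one formula: [|w|^2 / m(z)] is the supremum over [p] of
    [2 p.w - |p|^2 m(z)], which also produces the infinite values. Two obstacles concern time. A
    Radon-Nikodym derivative is chosen separately at each time, with no measurability in time; and a
    linear constraint tested against a Borel set of points holds off a null set of times that
    depends on this set. A countable family of cells removes both: averages over cells are
    measurable in time, and charges that agree on all cells are equal, so one null set of times is
    enough. *)

Lemma cvg_sumr (R : realType) (I : Type) (s : seq I) (f : I -> nat -> R) (l : I -> R) :
  (forall i, f i @ \oo --> l i) ->
  (fun n => \sum_(i <- s) f i n) @ \oo --> \sum_(i <- s) l i.
Proof.
by move=> fl; apply: (cvg_big (@add_continuous R^o)) => i _; exact: fl.
Qed.

(** Think of [q] as a squared norm and of [D] as a squared distance. The infima [e n] of [q] on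
    [K n] increase and are bounded by [B], so they are almost constant from some level on. Two
    near-minimisers beyond that level have a midpoint at which [q] is at least [e], which makes [D]
    small. *)
Lemma parallelogram_cauchy (R : realType) (V : Type) (mid : V -> V -> V)
    (q : V -> R) (D : V -> V -> R) (K : nat -> set V) (B : R) :
  (forall n, K n !=set0) -> (forall n, K n.+1 `<=` K n) ->
  (forall n x y, K n x -> K n y -> K n (mid x y)) ->
  (forall x y, K 0%N x -> K 0%N y -> D x y = 2 * q x + 2 * q y - 4 * q (mid x y)) ->
  (forall x, K 0%N x -> 0 <= q x <= B) ->
  exists x : nat -> V, forall n, K n (x n) /\ D (x n) (x n.+1) <= 4^-1 ^+ n.
Proof.
move=> K0 Kdec Kmid Dq qB.
have Kle n m : (n <= m)%N -> K m `<=` K n.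
  elim: m => [|m IH]; first by rewrite leqn0 => /eqP ->.
  rewrite leq_eqVlt => /orP[/eqP -> //|]; rewrite ltnS => /IH nm x /Kdec; exact: nm.
pose e n := inf [set q x | x in K n].
have qlb n : has_lbound [set q x | x in K n].
  by exists 0 => _ [x Kx <-]; have /andP[] := qB _ (Kle 0%N n (leq0n _) _ Kx).
have hinf n : has_inf [set q x | x in K n].
  by split; [have [x Kx] := K0 n; exists (q x); exists x|exact: qlb].
have e_le n x : K n x -> e n <= q x by move=> Kx; apply: ge_inf => //; exists x.
have e_nd n m : (n <= m)%N -> e n <= e m.
  move=> nm; apply: lb_le_inf; first by case: (hinf m).
  by move=> _ [x Kx <-]; apply: e_le; exact: Kle Kx.
have eB n : e n <= B.
  have [x Kx] := K0 n; apply: (le_trans (e_le _ _ Kx)).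
  by have /andP[] := qB _ (Kle 0%N n (leq0n _) _ Kx).
pose s := sup (range e).
have hsup : has_sup (range e).
  by split; [exists (e 0%N); exists 0%N|exists B => _ [n _ <-]].
have e_s n : e n <= s by apply: ub_le_sup; [case: hsup|exists n].
(* Three errors enter [D (x k) (x k.+1)], each with factor 2: the excess of [q] at either point and
   the distance from [e (g k)] to [s]. With 1/6 each, they add up to at most [4^-k]. *)
have d_gt0 k : 0 < 4^-1 ^+ k / 6 :> R by rewrite divr_gt0// exprn_gt0.
have nex k : exists n, (k <= n)%N /\ s - 4^-1 ^+ k / 6 < e n.
  have [_ [n _ <-] hn] := sup_adherent (d_gt0 k) hsup.
  exists (maxn k n); split; first exact: leq_maxl.
  by apply: (lt_le_trans hn); apply: e_nd; exact: leq_maxr.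
have [f hf] := boolp.choice nex.
(* A running maximum of [f]: the levels [g k] increase, so that [x k.+1] also belongs to
   [K (g k)]. *)
pose g := fix g k := if k is k'.+1 then maxn (g k') (f k) else f 0%N.
have gf k : (f k <= g k)%N by case: k => //= k; exact: leq_maxr.
have gle k : (g k <= g k.+1)%N by rewrite /= leq_maxl.
have xex k : exists x, K (g k) x /\ q x < e (g k) + 4^-1 ^+ k / 6.
  have [_ [x Kx <-] hx] := inf_adherent (d_gt0 k) (hinf (g k)).
  by exists x.
have [x hx] := boolp.choice xex.
exists x => k; have [Kx qx] := hx k; have [Ky qy] := hx k.+1.
have Ky' : K (g k) (x k.+1) by exact: Kle Ky.
split; first by apply: (Kle _ _ _ _ Kx); exact: leq_trans (hf k).1 (gf k).
rewrite Dq; [|exact: Kle Kx|exact: Kle Ky].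
have h1 : e (g k) <= q (mid (x k) (x k.+1)) by apply: e_le; exact: Kmid.
have h2 : s - 4^-1 ^+ k / 6 < e (g k).
  by apply: (lt_le_trans (hf k).2); exact: e_nd.
have h3 := e_s (g k.+1).
have h4 : 4^-1 ^+ k.+1 <= 4^-1 ^+ k :> R by rewrite exprS ler_piMl ?exprn_ge0//; lra.
move: qx qy h1 h2 h3 h4; set a := 4^-1 ^+ k; set b := 4^-1 ^+ k.+1; lra.
Qed.

(** An upper limit is measurable with no convergence hypothesis and is the limit wherever there is
    one; [fine] replaces infinite values by 0. *)
Definition lim_fun (R : realType) (T : Type) (f : nat -> T -> R) (z : T) : R :=
  fine (limn_esup (fun n => (f n z)%:E)).

Lemma measurable_lim_fun d (T : measurableType d) (R : realType)
    (f : nat -> T -> R) :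
  (forall n, measurable_fun setT (f n)) -> measurable_fun setT (lim_fun f).
Proof.
move=> mf; apply: (measurableT_comp (@fine_measurable _ _ measurableT)).
by apply: measurable_fun_limn_esup => n; exact/measurable_EFinP.
Qed.

Lemma lim_funE (R : realType) (T : Type) (f : nat -> T -> R) (z : T) l :
  f ^~ z @ \oo --> l -> lim_fun f z = l.
Proof.
move=> fl; rewrite /lim_fun.
have h : (f n z)%:E @[n --> \oo] --> l%:E by apply: cvg_EFin => //; exact: nearW.
by have [_ ->] := cvg_limn_einf_sup h.
Qed.

Lemma cvg_series_bounded_variation (R : realType) (u : nat -> R) :
  (\sum_(n <oo) `|u n.+1 - u n|%:E < +oo)%E -> cvgn u.
Proof.
move=> fin; pose v n := u n.+1 - u n.
have : cvgn [normed series v].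
  apply: nondecreasing_is_cvgn.
    by apply: nondecreasing_series => n _ _; exact: normr_ge0.
  exists (fine (\sum_(n <oo) `|v n|%:E)) => _ [n _ <-].
  rewrite -lee_fin fineK; last by rewrite ge0_fin_numE ?fin ?nneseries_ge0.
  by rewrite /series/= -sumEFin; exact: nneseries_lim_ge.
move=> /normed_cvg cv.
have -> : u = (fun n => u 0%N + series v n).
  by apply/funext => n; rewrite /series/= telescope_sumr// addrC subrK.
by apply: is_cvgD => //; exact: is_cvg_cst.
Qed.

(** The sum [S] of the absolute increments is integrable, hence finite almost everywhere, and the
    sequence converges where [S] is finite. The function [|f 0| + S] dominates all terms, ready for
    dominated convergence. *)
Lemma L1_fast_cvg d (T : measurableType d) (R : realType)
    (M : {measure set T -> \bar R}) (f : nat -> T -> R) :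
  (forall n, measurable_fun setT (f n)) -> M.-integrable setT (EFin \o f 0%N) ->
  (\sum_(n <oo) \int[M]_z `|f n.+1 z - f n z|%:E < +oo)%E ->
  {ae M, forall z, f ^~ z @ \oo --> lim_fun f z} /\
  exists2 G : T -> \bar R, M.-integrable setT G &
    forall z n, (`|f n z|%:E <= G z)%E.
Proof.
move=> mf if0 sfin.
have md n : measurable_fun setT (fun z => `|f n.+1 z - f n z|%:E).
  apply/measurable_EFinP; apply: (measurableT_comp (@normr_measurable R setT)).
  exact: measurable_funB.
pose S z := (\sum_(n <oo) `|f n.+1 z - f n z|%:E)%E.
have S0 z : (0 <= S z)%E by apply: nneseries_ge0.
have iS : (\int[M]_z S z)%E = (\sum_(n <oo) \int[M]_z `|f n.+1 z - f n z|%:E)%E.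
  by rewrite integral_nneseries.
have mS : measurable_fun setT S by apply: ge0_emeasurable_sum.
have intS : M.-integrable setT S.
  by apply/integrableP; split => //; under eq_integral do rewrite gee0_abs//; rewrite iS.
split.
  have := integrable_ae measurableT intS; apply: filterS => z /(_ I).
  rewrite ge0_fin_numE// => Sz.
  have /cvg_ex[l fl] := cvg_series_bounded_variation Sz.
  by rewrite (lim_funE fl).
exists (fun z => `|f 0%N z|%:E + S z)%E.
  apply: integrableD => //.
  by have := integrable_abse if0.
move=> z n.
have h : (`|f n z|%:E <= `|f 0%N z|%:E + \sum_(0 <= k < n) `|f k.+1 z - f k z|%:E)%E.
  rewrite sumEFin -EFinD lee_fin.
  have -> : f n z = f 0%N z + \sum_(0 <= k < n) (f k.+1 z - f k z).
    by rewrite telescope_sumr// addrC subrK.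
  by rewrite (le_trans (ler_normD _ _))// lerD2l ler_norm_sum.
by apply: (le_trans h); rewrite leeD2l//; exact: nneseries_lim_ge.
Qed.

(* AM-GM: [2 |h| <= 2^n h^2 + 2^-n]. *)
Lemma L2_fast_L1_fast d (T : measurableType d) (R : realType)
    (M : {measure set T -> \bar R}) (h : nat -> T -> R) :
  (M setT < +oo)%E -> (forall n, measurable_fun setT (h n)) ->
  (forall n, \int[M]_z ((h n z) ^+ 2)%:E <= (4^-1 ^+ n)%:E)%E ->
  (\sum_(n <oo) \int[M]_z `|h n z|%:E < +oo)%E.
Proof.
move=> Mfin mh hq.
have Mf : M setT \is a fin_num by rewrite ge0_fin_numE.
(* The AM-GM bound integrates to [2^n/2 * 4^-n + 2^-n/2 * M(T) = (1 + M(T)) / 2^(n+1)], the general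
   term of a series with sum [c]. *)
pose c := fine (M setT) + 1.
apply: (@le_lt_trans _ _ c%:E); last exact: ltry.
have c0 : 0 <= c by rewrite addr_ge0// fine_ge0.
apply: le_trans (epsilon_trick0 predT c0).
apply: lee_nneseries => [n _ _|n _]; first exact: integral_ge0.
have -> : (c / (2 ^ n.+1)%:R)%:E = ((2 ^+ n / 2)%:E * (4^-1 ^+ n)%:E
    + ((2 ^+ n)^-1/2)%:E * M setT)%E :> \bar R.
  rewrite -(fineK Mf) -!EFinM -EFinD /c; congr EFin.
  have -> : 4^-1 ^+ n = (2 ^+ n)^-1 ^+ 2 :> R.
    by rewrite -exprVn -exprM mulnC exprM; congr (_ ^+ _); field.
  rewrite natrX exprS; field. by rewrite expf_neq0.
apply: (@le_trans _ _ (\int[M]_z ((2 ^+ n / 2)%:E * (h n z ^+ 2)%:E + ((2 ^+ n)^-1/2)%:E)))%E.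
  apply: ge0_le_integral => //.
  - by apply/measurable_EFinP; apply: (measurableT_comp (@normr_measurable R setT)).
  - apply/measurable_EFinP/measurable_funD => //.
    by apply: measurable_funM => //; exact: measurable_funX.
  - move=> z _; rewrite -EFinM -EFinD lee_fin.
    have : 0 < 2 ^+ n :> R by rewrite exprn_gt0.
    move: (2 ^+ n) => a a0.
    rewrite -(real_normK (num_real (h n z))); move: (`|h n z| : R) => y.
    have : 0 <= (a * y - 1) ^+ 2 / a by rewrite divr_ge0 ?sqr_ge0// ltW.
    have -> : (a * y - 1) ^+ 2 / a = a * y ^+ 2 - 2 * y + a^-1 by field; rewrite gt_eqF.
    lra.
have c1 : (0 <= (2 ^+ n / 2)%:E :> \bar R)%E by rewrite lee_fin divr_ge0// exprn_ge0.
have mh2 : measurable_fun setT (fun z => (h n z ^+ 2)%:E).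
  by apply/measurable_EFinP; exact: measurable_funX.
have h20 z : setT z -> (0 <= (h n z ^+ 2)%:E)%E by rewrite lee_fin sqr_ge0.
have h3 z : setT z -> (0 <= (2 ^+ n / 2)%:E * (h n z ^+ 2)%:E)%E by move=> zT; rewrite mule_ge0// h20.
rewrite ge0_integralD//; last exact: measurable_funeM.
rewrite integral_cst// leeD2r// ge0_integralZl//.
by rewrite lee_wpmul2l.
Qed.

(** * Minimisation of convex functionals under linear constraints *)

Lemma integrable_bounded_mul d (T : measurableType d) (R : realType)
    (M : {measure set T -> \bar R}) (D : set T) (phi f : T -> R) (C : R) :
  measurable D -> measurable_fun D phi -> (forall z, D z -> `|phi z| <= C) ->
  M.-integrable D (EFin \o f) ->
  M.-integrable D (EFin \o (fun z => phi z * f z)).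
Proof.
move=> mD mphi phiC fi.
have -> : EFin \o (fun z => phi z * f z) = ((EFin \o phi) \* (EFin \o f))%E.
  by apply/funext => z /=; rewrite EFinM.
apply: integrableMr => //; exists `|C|; split; first exact: num_real.
move=> x Cx z Dz; rewrite /= (le_trans (phiC _ Dz))// ltW// (le_lt_trans _ Cx)//.
exact: ler_norm.
Qed.

Lemma integrable_le d (T : measurableType d) (R : realType)
    (M : {measure set T -> \bar R}) (f g : T -> R) :
  measurable_fun setT f -> M.-integrable setT (EFin \o g) ->
  (forall z, `|f z| <= g z) -> M.-integrable setT (EFin \o f).
Proof.
move=> mf gi fg; apply: le_integrable gi => //; first exact/measurable_EFinP.
by move=> z _ /=; rewrite lee_fin (le_trans (fg z))// ler_norm.
Qed.

Lemma integrable_sqr d (T : measurableType d) (R : realType)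
    (M : {measure set T -> \bar R}) (f : T -> R) :
  measurable_fun setT f -> (\int[M]_z (f z ^+ 2)%:E < +oo)%E ->
  M.-integrable setT (EFin \o (fun z => f z ^+ 2)).
Proof.
move=> mf fi; apply/integrableP; split.
  by apply/measurable_EFinP; exact: measurable_funX.
by under eq_integral do rewrite gee0_abs ?lee_fin ?sqr_ge0//.
Qed.

Lemma L2_integrable d (T : measurableType d) (R : realType)
    (M : {measure set T -> \bar R}) (f : T -> R) :
  (M setT < +oo)%E -> measurable_fun setT f ->
  M.-integrable setT (EFin \o (fun z => f z ^+ 2)) -> M.-integrable setT (EFin \o f).
Proof.
move=> Mfin mf sf; apply: (@integrable_le _ _ _ _ _ (fun z => 1 + f z ^+ 2)) => //.
  have i1 : M.-integrable setT (EFin \o cst (1 : R)).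
    apply: measurable_bounded_integrable => //.
    by exists 1; split => // y y1 z _ /=; rewrite normr1 ltW.
  exact: (integrableD measurableT i1 sf).
move=> z; rewrite -(real_normK (num_real (f z))).
have : 0 <= (`|f z| - 1) ^+ 2 by rewrite sqr_ge0.
have := normr_ge0 (f z); nra.
Qed.

Definition mid (R : realType) (I Z : Type) (u v : I -> Z -> R) : I -> Z -> R :=
  fun i z => 2^-1 * (u i z + v i z).

Section direct_method.
Context d (Z : measurableType d) (R : realType) (I : finType).
Variable M : I -> {measure set Z -> \bar R}.
Hypothesis Mfin : forall i, (M i setT < +oo)%E.
Implicit Types u v : I -> Z -> R.

(** A constraint pairs a family of test functions, one per component, with a prescribed value.
    Integrability is part of the definition because the real-valued integral is a total operator. *)
Definition feasible (Phi : set ((I -> Z -> R) * R)) : set (I -> Z -> R) :=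
  [set u | [/\ forall i, measurable_fun setT (u i),
     forall i, (M i).-integrable setT (EFin \o u i) &
     forall p, Phi p -> \sum_i \int[M i]_z (p.1 i z * u i z) = p.2]].

Variables (Phi : set ((I -> Z -> R) * R)) (F : (I -> Z -> R) -> \bar R).
Hypothesis Phi_bounded : forall p, Phi p -> forall i,
  measurable_fun setT (p.1 i) /\ exists C, forall z, `|p.1 i z| <= C.
Hypothesis F_ge0 : forall u, (0 <= F u)%E.
Hypothesis F_mid : forall u v,
  (forall i, measurable_fun setT (u i)) -> (forall i, measurable_fun setT (v i)) ->
  forall c : R, (F u <= c%:E)%E -> (F v <= c%:E)%E -> (F (mid u v) <= c%:E)%E.
Hypothesis F_lsc : forall (u_ : nat -> I -> Z -> R) u,
  (forall n i, measurable_fun setT (u_ n i)) -> (forall i, measurable_fun setT (u i)) ->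
  (forall i, {ae M i, forall z, u_ ^~ i ^~ z @ \oo --> u i z}) ->
  (F u <= limn_einf (F \o u_))%E.
Hypothesis F_coercive : exists C : R, forall u,
  (forall i, measurable_fun setT (u i)) -> forall i,
  (\int[M i]_z (u i z ^+ 2)%:E <= C%:E * (1 + F u))%E.

Let sqint i (f : Z -> R) := (M i).-integrable setT (EFin \o (fun z => f z ^+ 2)).

Let sqint_int i (f : Z -> R) : measurable_fun setT f -> sqint i f ->
  (M i).-integrable setT (EFin \o f).
Proof. exact: L2_integrable. Qed.

Let mid_measurable u v : (forall i, measurable_fun setT (u i)) ->
  (forall i, measurable_fun setT (v i)) ->
  forall i, measurable_fun setT (mid u v i).
Proof.
by move=> mu mv i; apply: measurable_funM => //; exact: measurable_funD.
Qed.

Let mid_sqint u v : (forall i, measurable_fun setT (u i)) ->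
  (forall i, measurable_fun setT (v i)) ->
  (forall i, sqint i (u i)) -> (forall i, sqint i (v i)) ->
  forall i, sqint i (mid u v i).
Proof.
move=> mu mv su sv i.
apply: (@integrable_le _ _ _ _ _ (fun z => u i z ^+ 2 + v i z ^+ 2)).
- by apply: measurable_funX; exact: mid_measurable.
- exact: (integrableD measurableT (su i) (sv i)).
- move=> z; rewrite ger0_norm ?sqr_ge0// /mid.
  have : 0 <= (u i z - v i z) ^+ 2 by rewrite sqr_ge0.
  have := sqr_ge0 (u i z); have := sqr_ge0 (v i z).
  nra.
Qed.

Let mid_test p u v : Phi p -> feasible Phi u -> feasible Phi v ->
  \sum_i \int[M i]_z (p.1 i z * mid u v i z) = p.2.
Proof.
move=> Phip [mu iu tu] [mv iv tv].
have ip w : (forall i, (M i).-integrable setT (EFin \o w i)) ->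
    forall i, (M i).-integrable setT (EFin \o (fun z => p.1 i z * w i z)).
  move=> iw i; have [mp [C pC]] := Phi_bounded Phip i.
  exact: (integrable_bounded_mul _ mp (fun z _ => pC z)).
rewrite (eq_bigr (fun i => 2^-1 * (\int[M i]_z (p.1 i z * u i z) +
    \int[M i]_z (p.1 i z * v i z)))).
  by rewrite -mulr_sumr big_split/= tu// tv//; field.
move=> i _; rewrite -RintegralD//; [|exact: ip|exact: ip].
rewrite -RintegralZl//; last first.
  exact: (integrableD measurableT (ip _ iu i) (ip _ iv i)).
by apply: eq_Rintegral => z _; rewrite /mid; ring.
Qed.

(** Along the sequence given by [parallelogram_cauchy] the convergence is almost everywhere and
    dominated, so the constraints, whose test functions are bounded, pass to the limit. The values
    of [F] are squeezed between [c] and [c + 2^-n], and lower semicontinuity gives [F u <= c]. *)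
Lemma direct_method : (exists2 u, feasible Phi u & (F u < +oo)%E) ->
  exists2 u, feasible Phi u & forall v, feasible Phi v -> (F u <= F v)%E.
Proof.
move=> [u0 Ku0 Fu0].
pose A := [set F u | u in feasible Phi].
have A0 : (0 <= ereal_inf A)%E by apply: le_ereal_inf_tmp => _ [u _ <-].
have Afin : ereal_inf A \is a fin_num.
  rewrite ge0_fin_numE//; apply: le_lt_trans Fu0.
  by apply: ereal_inf_lbound; exists u0.
pose c := fine (ereal_inf A).
have cE : ereal_inf A = c%:E by rewrite fineK.
have c0 : 0 <= c by rewrite fine_ge0.
have Fge u : feasible Phi u -> (c%:E <= F u)%E.
  by move=> Ku; rewrite -cE; apply: ereal_inf_lbound; exists u.
have [C HC] := F_coercive.
(* A single sublevel set would not lead to the infimum [c], and the level [c] itself might be empty;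
   the levels therefore shrink to [c]. Coercivity bounds [q] on all of them. *)
pose K n := [set u | feasible Phi u /\ (F u <= (c + 2^-1 ^+ n)%:E)%E].
have p1 n : 2^-1 ^+ n <= 1 :> R by rewrite exprn_ile1//; lra.
have Ksq n u : K n u -> forall i, (\int[M i]_z (u i z ^+ 2)%:E <= (`|C| * (c + 2))%:E)%E.
  move=> [[mu _ _] Fu] i; apply: (le_trans (HC u mu i)).
  apply: (@le_trans _ _ (`|C|%:E * (1 + F u)))%E.
    by rewrite lee_wpmul2r ?adde_ge0// lee_fin ler_norm.
  rewrite EFinM lee_wpmul2l ?lee_fin//.
  apply: (@le_trans _ _ (1 + (c + 2^-1 ^+ n)%:E)%E); first by rewrite leeD2l.
  by rewrite -EFinD lee_fin; have := p1 n; lra.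
have Ksqint n u : K n u -> forall i, sqint i (u i).
  move=> Ku i; have [[mu _ _] _] := Ku; apply: integrable_sqr => //.
  by apply: (le_lt_trans (Ksq n u Ku i)); exact: ltry.
pose q u := \sum_i \int[M i]_z (u i z ^+ 2).
pose D u v := \sum_i \int[M i]_z ((v i z - u i z) ^+ 2).
have [|||||x hx] := @parallelogram_cauchy R _ (@mid R I Z) q D K (\sum_(i : I) `|C| * (c + 2)).
- move=> n; have p0 : 0 < 2^-1 ^+ n :> R by rewrite exprn_gt0// invr_gt0.
  have [_ [u Ku <-] Fu] := @lb_ereal_inf_adherent _ A (2^-1 ^+ n) p0 Afin.
  by exists u; split => //; rewrite EFinD -cE ltW.
- move=> n u [Ku Fu]; split => //; apply: (le_trans Fu).
  by rewrite lee_fin lerD2l exprS ler_piMl ?exprn_ge0//; lra.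
- move=> n u v Knu Knv; have [Ku Fu] := Knu; have [Kv Fv] := Knv.
  have [[mu iu tu] [mv iv tv]] := (Ku, Kv).
  split; last exact: F_mid.
  split; first exact: mid_measurable.
    move=> i; apply: sqint_int; first exact: mid_measurable.
    by apply: mid_sqint => //; [exact: (Ksqint n)|exact: (Ksqint n)].
  by move=> p Pp; exact: mid_test.
- move=> u v Kou Kov; have su := Ksqint _ _ Kou; have sv := Ksqint _ _ Kov.
  have [[[mu _ _] _] [[mv _ _] _]] := (Kou, Kov).
  have sm := mid_sqint mu mv su sv.
  rewrite /D /q !mulr_sumr -big_split/= -sumrB; apply: eq_bigr => i _.
  rewrite -!RintegralZl//; [|exact: sm|exact: sv|exact: su].
  have i2 w : sqint i (w i) -> forall k : R, (M i).-integrable setT (EFin \o (fun z => k * w i z ^+ 2)).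
    by move=> sw k; exact: (integrableZl measurableT k sw).
  rewrite -RintegralD//; [|exact: i2|exact: i2].
  rewrite -RintegralB//; [|exact: (integrableD measurableT (i2 _ (su i) _) (i2 _ (sv i) _))|exact: (i2 (mid u v))].
  by apply: eq_Rintegral => z _; rewrite /mid; field.
- move=> u Ku; apply/andP; split.
    by apply: sumr_ge0 => i _; apply: Rintegral_ge0 => z _; exact: sqr_ge0.
  apply: ler_sum => i _; rewrite -lee_fin /Rintegral fineK ?(Ksq 0%N)//.
  by rewrite ge0_fin_numE ?(le_lt_trans (Ksq _ _ Ku i)) ?ltry// integral_ge0// => z _; rewrite lee_fin sqr_ge0.
have mx n i : measurable_fun setT (x n i) by have [[[]]] := hx n.
have ix n i : (M i).-integrable setT (EFin \o x n i) by have [[[]]] := hx n.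
pose u i := lim_fun (x ^~ i).
have mu i : measurable_fun setT (u i) by apply: measurable_lim_fun => n; exact: mx.
have L1 i : {ae M i, forall z, x ^~ i ^~ z @ \oo --> u i z} /\
   exists2 G : Z -> \bar R, (M i).-integrable setT G &
    forall z n, (`|x n i z|%:E <= G z)%E.
  apply: L1_fast_cvg => //; apply: L2_fast_L1_fast => //.
    by move=> n; exact: measurable_funB.
  move=> n; have [[Kx Fx] Dx] := hx n.
  have sx m : sqint i (x m i) by apply: (Ksqint m); have [] := hx m.
  have sd j m : sqint j (fun z => x m.+1 j z - x m j z).
    apply: (@integrable_le _ _ _ _ _ (fun z => 2 * x m.+1 j z ^+ 2 + 2 * x m j z ^+ 2)).
    - by apply: measurable_funX; exact: measurable_funB.
    - have s2 k : (M j).-integrable setT (EFin \o (fun z => 2 * x k j z ^+ 2)).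
        apply: (integrableZl measurableT 2 (_ : sqint j (x k j))).
        by apply: (Ksqint k); have [] := hx k.
      exact: (integrableD measurableT (s2 _) (s2 _)).
    - move=> z; rewrite ger0_norm ?sqr_ge0//.
      have : 0 <= (x m.+1 j z + x m j z) ^+ 2 by rewrite sqr_ge0.
      nra.
  rewrite -(@fineK _ (\int[M i]_z _)%E); last exact: integrable_fin_num (sd i n).
  rewrite lee_fin; apply: le_trans Dx.
  rewrite /D (bigD1 i)//= lerDl sumr_ge0// => j _.
  by apply: Rintegral_ge0 => z _; exact: sqr_ge0.
have Ku : feasible Phi u.
  split => // [i|p Pp].
    have [cvx [G iG xG]] := L1 i.
    have [] // := @dominated_convergence _ _ _ (M i) _ measurableT
      (fun n => EFin \o x n i) (EFin \o u i) G.
    - by move=> n; exact/measurable_EFinP.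
    - exact/measurable_EFinP.
    - move: cvx; apply: filterS => z xz _.
      by apply: cvg_EFin => //; exact: nearW.
    - by apply: aeW => z n _; exact: xG.
  have cvp i : \int[M i]_z (p.1 i z * x n i z) @[n --> \oo] --> \int[M i]_z (p.1 i z * u i z).
    have [cvx [G iG xG]] := L1 i.
    have [mp [k pk]] := Phi_bounded Pp i.
    have [] := @dominated_convergence _ _ _ (M i) _ measurableT
      (fun n => EFin \o (fun z => p.1 i z * x n i z)) (EFin \o (fun z => p.1 i z * u i z))
      (fun z => k%:E * G z)%E.
    - by move=> n; apply/measurable_EFinP; exact: measurable_funM.
    - by apply/measurable_EFinP; exact: measurable_funM.
    - move: cvx; apply: filterS => z xz _.
      by apply: cvg_EFin => //=; [exact: nearW|exact: cvgMr].
    - exact: integrableZl.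
    - apply: aeW => z n _ /=; rewrite normrM EFinM.
      by apply: lee_pmul => //; rewrite lee_fin.
    move=> ip _ cv; apply: fine_cvg; rewrite fineK; first exact: cv.
    exact: integrable_fin_num.
  have : (fun n => \sum_i \int[M i]_z (p.1 i z * x n i z)) @ \oo --> \sum_i \int[M i]_z (p.1 i z * u i z).
    by apply: cvg_sumr => i; exact: cvp.
  rewrite (_ : (fun n => _) = cst p.2); last first.
    by apply/funext => n; have [[[_ _ /(_ _ Pp)]]] := hx n.
  by move=> /cvg_unique/(_ (cvg_cst _)) <-//.
exists u => // v Kv; apply: (@le_trans _ _ c%:E); last exact: Fge.
apply: (le_trans (F_lsc mx mu (fun i => (L1 i).1))).
have cv : F \o x @ \oo --> c%:E.
  apply: (@squeeze_cvge _ _ _ _ (cst c%:E) _ (fun n => (c + 2^-1 ^+ n)%:E)).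
  - by apply: nearW => n; have [[Kx Fx] _] := hx n; rewrite Fge.
  - exact: cvg_cst.
  - apply: cvg_EFin; first exact: nearW.
    rewrite -[X in _ --> X]addr0; apply: cvgD; first exact: cvg_cst.
    by apply: cvg_expr; rewrite ger0_norm; lra.
by have [-> _] := cvg_limn_einf_sup cv.
Qed.

End direct_method.

(** * Densities of measurable families of charges *)

Section cells.
Context d (T : measurableType d) (R : realType) (U : nat -> set T).
Hypothesis mU : forall n, measurable (U n).

(** The code records which of the first [n] sets contain [x]. The cells with [n] fixed are the atoms
    of the finite algebra generated by these sets, and a function of the code is a function constant
    on each cell. *)
Definition code n (x : T) : {ffun 'I_n -> bool} := [ffun k : 'I_n => x \in U k].
Definition cell n (c : {ffun 'I_n -> bool}) : set T := [set x | code n x = c].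

Lemma measurable_cell n c : measurable (@cell n c).
Proof.
rewrite (_ : cell c = \bigcap_(k in [set: 'I_n]) (if c k then U k else ~` U k)).
  apply: fin_bigcap_measurable => [|k _]; first exact: finite_finset.
  by case: ifP => _ //; exact: measurableC.
apply/seteqP; split => [x <- k _|x h].
  rewrite /code ffunE; case: ifPn; first by rewrite inE.
  by rewrite notin_setE.
apply/ffunP => k; rewrite /code ffunE; have := h k I.
by case: (c k); rewrite ?inE// => /= h'; [rewrite mem_set|apply/negbTE; rewrite notin_setE].
Qed.

Lemma measurable_code d' (T' : measurableType d') n (f : {ffun 'I_n -> bool} -> T') :
  measurable_fun setT (f \o code n).
Proof.
move=> _ B mB; rewrite setTI.
rewrite (_ : _ @^-1` _ = \bigcup_(c in [set c | B (f c)]) cell c).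
  by apply: fin_bigcup_measurable => [|c _]; [exact: finite_finset|exact: measurable_cell].
apply/seteqP; split => [x Bx|x [c Bc xc]]; first by exists (code n x).
by rewrite /= xc.
Qed.

Lemma code_le n m (nm : (n <= m)%N) x :
  code n x = [ffun k => code m x (widen_ord nm k)].
Proof. by apply/ffunP => k; rewrite !ffunE. Qed.

Lemma cells_partition n : [set: T] = \big[setU/set0]_(c <- enum {: {ffun 'I_n -> bool}}) cell c.
Proof.
rewrite -bigcup_seq; apply/seteqP; split => // x _.
by exists (code n x) => //=; rewrite mem_enum.
Qed.

Lemma trivIset_cell n (D : set _) : trivIset D (@cell n).
Proof.
apply/trivIsetP => c c' _ _ cc'; apply/seteqP; split => // x [/= xc xc'];
  by move: cc'; rewrite -xc -xc' eqxx.
Qed.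

Lemma integral_cells (mu : {measure set T -> \bar R}) n (f : T -> \bar R) :
  measurable_fun setT f -> (forall x, (0 <= f x)%E) ->
  (\int[mu]_x f x = \sum_c \int[mu]_(x in @cell n c) f x)%E.
Proof.
move=> mf f0; rewrite [in LHS](cells_partition n) ge0_integral_bigsetU//.
- by rewrite big_enum.
- exact: measurable_cell.
- exact: enum_uniq.
- exact: trivIset_cell.
- exact: measurable_funTS.
Qed.

(** The preimages of the clopen sets of the Cantor space under the map sending [x] to its infinite
    code, that is, the algebra generated by all the [U n]. *)
Definition clopen_code (A : set T) := exists n (P : pred {ffun 'I_n -> bool}),
  A = [set x | P (code n x)].

Lemma clopen_codeW n (P : pred {ffun 'I_n -> bool}) m : (n <= m)%N ->
  exists Q : pred {ffun 'I_m -> bool}, [set x | P (code n x)] = [set x | Q (code m x)].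
Proof.
move=> nm; exists (fun c => P [ffun k => c (widen_ord nm k)]).
by apply/seteqP; split => x /=; rewrite (code_le nm).
Qed.

Lemma clopen_codeU A B : clopen_code A -> clopen_code B -> clopen_code (A `|` B).
Proof.
move=> [n [P ->]] [m [Q ->]].
have [P' ->] := clopen_codeW P (leq_maxl n m).
have [Q' ->] := clopen_codeW Q (leq_maxr n m).
exists (maxn n m), (predU P' Q'); apply/seteqP; split => x /=; by move/orP.
Qed.

Lemma clopen_codeC A : clopen_code A -> clopen_code (~` A).
Proof.
move=> [n [P ->]]; exists n, (predC P).
by apply/seteqP; split => x /=; move/negP.
Qed.

Lemma measurable_clopen_code A : clopen_code A -> measurable A.
Proof.
move=> [n [P ->]]; have := @measurable_code _ bool n P.
by move=> /(_ measurableT [set true] I); rewrite setTI.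
Qed.

Hypothesis genU : forall B, measurable B -> <<s range U>> B.

(** The sets that can be approximated to every accuracy form a sigma-algebra containing each [U n].
    For a countable union, finiteness of [mu] allows a finite partial union to be approximated
    instead, at the cost of half the error. *)
Lemma clopen_code_approx (mu : {finite_measure set T -> \bar R}) B (e : R) :
  measurable B -> 0 < e -> exists2 A, clopen_code A & (mu (A `+` B) <= e%:E)%E.
Proof.
pose D := [set B | measurable B /\ forall e : R, 0 < e ->
  exists2 A, clopen_code A & (mu (A `+` B) <= e%:E)%E].
have mY (A C : set T) : measurable A -> measurable C -> measurable (A `+` C).
  by move=> mA mC; apply: measurableU; exact: measurableD.
suff DB : forall B, measurable B -> D B by move=> /DB[_]; apply.
have DC C : D C -> D (~` C).
  move=> [mC hC]; split; first exact: measurableC.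
  move=> e' /hC[A cA h]; exists (~` A); first exact: clopen_codeC.
  rewrite (_ : ~` A `+` ~` C = A `+` C)//.
  by apply/seteqP; split => x /=; have [] := pselect (A x); have [] := pselect (C x); tauto.
have DU A C : D A -> D C -> D (A `|` C).
  move=> [mA hA] [mC hC]; split; first exact: measurableU.
  move=> e' e0; have e20 : 0 < e' / 2 by rewrite divr_gt0.
  have [A' cA' hA'] := hA _ e20; have [C' cC' hC'] := hC _ e20.
  have mA' := measurable_clopen_code cA'; have mC' := measurable_clopen_code cC'.
  exists (A' `|` C'); first exact: clopen_codeU.
  apply: (@le_trans _ _ (mu ((A' `+` A) `|` (C' `+` C)))).
    apply: le_measure; rewrite ?inE.
    - by apply: (mY (A' `|` C') (A `|` C)); exact: measurableU.
    - by apply: measurableU; [exact: (mY A' A)|exact: (mY C' C)].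
    - by move=> x /=; tauto.
  apply: (le_trans (measureU2 _ _ _)); [exact: mY|exact: mY|].
  by rewrite [e' in leRHS]splitr EFinD leeD.
have D0 : D set0.
  split => // e' e0; exists set0; last by rewrite setYK measure0 lee_fin ltW.
  by exists 0%N, pred0; apply/seteqP; split.
have Dbig (F : nat -> set T) : (forall n, D (F n)) -> D (\bigcup_n F n).
  move=> DF; pose G n := \big[setU/set0]_(i < n.+1) F i.
  have DG n : D (G n) by apply: (big_ind D).
  have mG n : measurable (G n) by case: (DG n).
  have GF : \bigcup_n F n = \bigcup_n G n by rewrite bigcup_bigsetU_bigcup.
  rewrite GF; have mGG : measurable (\bigcup_n G n) by apply: bigcup_measurable => n _.
  split => // e' e0; have e20 : 0 < e' / 2 by rewrite divr_gt0.
  have ndG : nondecreasing_seq G by move=> m n mn; apply/subsetPset; exact: subset_bigsetU.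
  have cvG := nondecreasing_cvg_mu (mu := mu) mG mGG ndG.
  have muf : mu (\bigcup_n G n) \is a fin_num by exact: fin_num_measure.
  have [n hn] : exists n, (mu (\bigcup_n G n) - (e' / 2)%:E <= mu (G n))%E.
    have muG n : mu (G n) \is a fin_num by exact: fin_num_measure.
    have /fine_cvg cvG' : mu \o G @ \oo --> (fine (mu (\bigcup_n G n)))%:E by rewrite fineK.
    have : \forall n \near \oo, fine (mu (\bigcup_n G n)) - e' / 2 < fine (mu (G n)).
      by apply: (cvgr_gt _ cvG'); rewrite ltrBlDr ltrDl.
    move=> [N _ hN]; exists N; rewrite -(fineK muf) -(fineK (muG N)) -EFinB lee_fin ltW//.
    exact: (hN N (leqnn N)).
  have [A cA hA] := (DG n).2 _ e20; have mA := measurable_clopen_code cA.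
  exists A => //.
  apply: (@le_trans _ _ (mu ((A `+` G n) `|` (\bigcup_n G n `\` G n)))).
    apply: le_measure; rewrite ?inE.
    - exact: mY.
    - by apply: measurableU; [exact: mY|exact: measurableD].
    - move=> x /= [[Ax nG]|[Gx nA]].
        left; left; split => // Gn; apply: nG; by exists n.
      have [Gn|nGn] := pselect (G n x); [by left; right|by right].
  apply: (le_trans (measureU2 _ _ _)); [exact: mY|exact: measurableD|].
  rewrite [e' in leRHS]splitr EFinD leeD//.
  rewrite measureD//; last by rewrite -ge0_fin_numE.
  rewrite setIidr; last by apply: bigcup_sup.
  by rewrite leeBlDr ?fin_num_measure// addeC -leeBlDr.
move=> C /genU; apply; split; first split.
- exact: D0.
- by move=> A DA; rewrite setTD; exact: DC.
- exact: Dbig.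
move=> _ [n _ <-]; split => // e' e0; exists (U n); last by rewrite setYK measure0 lee_fin ltW.
exists n.+1, (fun c => c ord_max); apply/seteqP; split => x /=; rewrite /code ffunE inE//.
Qed.

Lemma charge_code (nu : {charge set T -> \bar R}) n (s : seq {ffun 'I_n -> bool}) :
  uniq s -> (nu [set x | code n x \in s] = \sum_(c <- s) nu (cell c))%E.
Proof.
elim: s => [_|c s IH /= /andP[cs us]].
  by rewrite big_nil (_ : [set x | _] = set0) ?charge0//; apply/seteqP; split.
rewrite big_cons -(IH us) (_ : [set x | _] = cell c `|` [set x | code n x \in s]).
  rewrite chargeU//; first exact: measurable_cell.
    by apply: measurable_clopen_code; exists n, (mem s).
  apply/seteqP; split => // x [/= xc xs].
  by move: cs; rewrite -xc xs.
apply/seteqP; split => x /=; rewrite inE.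
  by move=> /orP[/eqP|]; [left|right].
by move=> [->|->]; rewrite ?eqxx ?orbT.
Qed.

(** Additivity passes from cells to the algebra [clopen_code], which is stable under intersection
    and generates the measurable sets; Dynkin induction does the rest. *)
Lemma charge_ext_cells (nu1 nu2 : {charge set T -> \bar R}) :
  (forall n c, nu1 (@cell n c) = nu2 (cell c)) ->
  forall B, measurable B -> nu1 B = nu2 B.
Proof.
move=> nuE.
have clE A : clopen_code A -> nu1 A = nu2 A.
  move=> [n [P ->]].
  have -> : [set x | P (code n x)] = [set x | code n x \in enum P].
    by apply/seteqP; split => x /=; rewrite mem_enum.
  by rewrite !charge_code ?enum_uniq//; apply: eq_bigr => c _; exact: nuE.
have cT : clopen_code setT by exists 0%N, predT; apply/seteqP; split.
have mE : @measurable _ T = <<s clopen_code >>.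
  apply/seteqP; split => [B /genU|].
    apply: smallest_sub; first exact: smallest_sigma_algebra.
    move=> _ [n _ <-]; apply: sub_sigma_algebra; exists n.+1, (fun c => c ord_max).
    by apply/seteqP; split => x /=; rewrite /code ffunE inE.
  apply: smallest_sub; first exact: sigma_algebra_measurable.
  exact: measurable_clopen_code.
move=> B; rewrite mE; move: B; apply: (dynkin_induction mE).
- move=> A B cA cB; rewrite -(setCK (A `&` B)) setCI.
  by apply: clopen_codeC; apply: clopen_codeU; exact: clopen_codeC.
- exact: clE.
- exact: clE.
- by move=> B mB e; rewrite -setTD !chargeD// setTI e clE.
- move=> F mF tF FE.
  have mbF : measurable (\bigcup_n F n) by exact: bigcup_measurable.
  have h1 := @charge_semi_sigma_additive _ _ _ nu1 F mF tF mbF.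
  have h2 := @charge_semi_sigma_additive _ _ _ nu2 F mF tF mbF.
  apply: (cvg_unique _ h1); first exact: ereal_hausdorff.
  rewrite (_ : (fun n => _) = (fun n => \sum_(0 <= i < n) nu2 (F i))%E)//.
  by apply/funext => n; apply: eq_bigr => i _; exact: FE.
Qed.

End cells.

(** A specification instead of a chosen derivative: it leaves room to exhibit representatives that
    are measurable in time as well. *)
Definition is_density d (T : measurableType d) (R : realType)
    (nu : {charge set T -> \bar R}) (mu : {measure set T -> \bar R}) (h : T -> R) :=
  mu.-integrable setT (EFin \o h) /\
  forall B, measurable B -> nu B = (\int[mu]_(x in B) (h x)%:E)%E.

Lemma measurable_fun_nat_index d (Z : measurableType d) (R : realType)
    (F : nat -> Z -> R) (K : Z -> nat) :
  (forall n, measurable_fun setT (F n)) -> (forall n, measurable [set z | K z = n]) ->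
  measurable_fun setT (fun z => F (K z) z).
Proof.
move=> mF mK _ B mB; rewrite setTI.
rewrite (_ : _ @^-1` _ = \bigcup_n ([set z | K z = n] `&` F n @^-1` B)).
  apply: bigcup_measurable => n _; apply: measurableI => //.
  by rewrite -[X in measurable X]setTI; exact: mF.
by apply/seteqP; split => [z Bz|z [n _ [/= <-]]//]; exists (K z).
Qed.

Lemma L1_triangle d (T : measurableType d) (R : realType)
    (mu : {measure set T -> \bar R}) (f g h : T -> R) :
  measurable_fun setT f -> measurable_fun setT g -> measurable_fun setT h ->
  (\int[mu]_x `|f x - h x|%:E <=
   \int[mu]_x `|f x - g x|%:E + \int[mu]_x `|g x - h x|%:E)%E.
Proof.
move=> mf mg mh.
have md (a b : T -> R) : measurable_fun setT a -> measurable_fun setT b ->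
    measurable_fun setT (fun x => `|a x - b x|%:E : \bar R).
  move=> ma mb; apply/measurable_EFinP.
  by apply: (measurableT_comp (@normr_measurable R setT)); exact: measurable_funB.
rewrite -ge0_integralD//; [|exact: md|exact: md].
apply: ge0_le_integral => //; first exact: md.
  by apply: emeasurable_funD; exact: md.
move=> x _; rewrite -EFinD lee_fin.
by rewrite (le_trans _ (ler_normD _ _))// addrA subrK.
Qed.

(** * Averages over cells converge in [L^1] *)

Section density_approx.
Context d (T : measurableType d) (R : realType) (U : nat -> set T).
Hypothesis mU : forall n, measurable (U n).
Hypothesis genU : forall B, measurable B -> <<s range U>> B.
Variable mu : {finite_measure set T -> \bar R}.

Let mcode n (g : _ -> R) := measurable_code mU (n := n) g.

Let muf B : measurable B -> mu B \is a fin_num.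
Proof. exact: fin_num_measure. Qed.

Let mufin : (mu setT < +oo)%E.
Proof. by rewrite -ge0_fin_numE// muf. Qed.

Lemma integrable_code n (g : {ffun 'I_n -> bool} -> R) :
  mu.-integrable setT (EFin \o (g \o code U n)).
Proof.
apply: measurable_bounded_integrable => //.
exists (\sum_c `|g c|); split => [|x gx y _]; first exact: num_real.
by apply: (le_trans _ (ltW gx)); rewrite /= (bigD1 (code U n y))//= lerDl sumr_ge0.
Qed.

Let approximable (f : T -> R) := measurable_fun setT f /\
  forall e : R, 0 < e -> exists n (g : {ffun 'I_n -> bool} -> R),
    (\int[mu]_x `|f x - g (code U n x)|%:E <= e%:E)%E.

Let approximable_indic B : measurable B -> approximable \1_B.
Proof.
move=> mB; split; first exact: measurable_indic.
move=> e e0; have [_ [n [P ->]] hA] := clopen_code_approx mU genU mu mB e0.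
exists n, (fun c => (P c)%:R); apply: le_trans hA.
have mY : measurable ([set x | P (code U n x)] `+` B).
  have mP : measurable [set x | P (code U n x)].
    by apply: (measurable_clopen_code mU); exists n, P.
  by apply: measurableU; exact: measurableD.
rewrite -[X in mu X]setIT -integral_indic//.
apply: ge0_le_integral => //.
- apply/measurable_EFinP; apply: (measurableT_comp (@normr_measurable R setT)).
  apply: measurable_funB; first exact: measurable_indic.
  exact: (mcode (fun c => (P c)%:R)).
- exact/measurable_EFinP/measurable_indic.
- move=> x _; rewrite lee_fin !indicE in_setU !in_setD.
  have -> : (x \in [set x | P (code U n x)]) = P (code U n x).
    by apply/idP/idP; rewrite inE.
  by case: (x \in B); case: (P _); rewrite /= ?subrr ?subr0 ?sub0r ?normrN ?normr1 ?normr0.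
Qed.

Let approximableD f1 f2 : approximable f1 -> approximable f2 ->
  approximable (fun x => f1 x + f2 x).
Proof.
move=> [m1 h1] [m2 h2]; split; first exact: measurable_funD.
move=> e e0; have e20 : 0 < e / 2 by rewrite divr_gt0.
have [n1 [g1 H1]] := h1 _ e20; have [n2 [g2 H2]] := h2 _ e20.
have le1 := leq_maxl n1 n2; have le2 := leq_maxr n1 n2.
exists (maxn n1 n2), (fun c => g1 [ffun k => c (widen_ord le1 k)] + g2 [ffun k => c (widen_ord le2 k)]).
apply: (@le_trans _ _ (\int[mu]_x (`|f1 x - g1 (code U n1 x)|%:E + `|f2 x - g2 (code U n2 x)|%:E)))%E.
  have ma (f : T -> R) n (g : _ -> R) : measurable_fun setT f ->
      measurable_fun setT (fun x => `|f x - g (code U n x)|%:E : \bar R).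
    move=> mf; apply/measurable_EFinP.
    apply: (measurableT_comp (@normr_measurable R setT)).
    by apply: measurable_funB => //; exact: mcode.
  apply: ge0_le_integral => //.
  - apply: (ma (fun x => f1 x + f2 x) _ (fun c => g1 [ffun k => c (widen_ord le1 k)] + g2 [ffun k => c (widen_ord le2 k)])).
    exact: measurable_funD.
  - by apply: emeasurable_funD; exact: ma.
  - move=> x _; rewrite -EFinD lee_fin -!code_le.
    by rewrite (le_trans _ (ler_normD _ _))// opprD addrACA.
rewrite ge0_integralD//.
- by rewrite [e in leRHS]splitr EFinD leeD.
- apply/measurable_EFinP; apply: (measurableT_comp (@normr_measurable R setT)).
  by apply: measurable_funB => //; exact: mcode.
- apply/measurable_EFinP; apply: (measurableT_comp (@normr_measurable R setT)).
  by apply: measurable_funB => //; exact: mcode.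
Qed.

Let approximableZ k f : approximable f -> approximable (fun x => k * f x).
Proof.
move=> [mf hf]; split; first exact: measurable_funM.
move=> e e0; have ek : 0 < e / (`|k| + 1) by rewrite divr_gt0// ltr_wpDl.
have [n [g H]] := hf _ ek; exists n, (fun c => k * g c).
have mfg : measurable_fun setT (fun x => `|f x - g (code U n x)|%:E : \bar R).
  apply/measurable_EFinP; apply: (measurableT_comp (@normr_measurable R setT)).
  by apply: measurable_funB => //; exact: mcode.
under eq_integral do rewrite -mulrBr normrM EFinM.
rewrite ge0_integralZl//.
apply: (@le_trans _ _ (`|k|%:E * (e / (`|k| + 1))%:E))%E; first by rewrite lee_wpmul2l.
rewrite -EFinM lee_fin mulrCA ger_pMr// ler_pdivrMr ?ltr_wpDl// mul1r lerDl//.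
Qed.

Let approximable_sum (I : Type) (s : seq I) (f : I -> T -> R) :
  (forall i, approximable (f i)) -> approximable (fun x => \sum_(i <- s) f i x).
Proof.
move=> af; elim: s => [|i s IH].
  under eq_fun do rewrite big_nil.
  split => // e e0; exists 0%N, (fun=> 0).
  by under eq_integral do rewrite subrr normr0; rewrite integral0 lee_fin ltW.
by under eq_fun do rewrite big_cons; exact: approximableD.
Qed.

Import HBSimple.

(** Simple functions are dense in [L^1], and each of their level sets is approximated in measure by
    a set of the algebra, whose indicator is a function of the code. *)
Lemma L1_code_approx (f : T -> R) (e : R) : mu.-integrable setT (EFin \o f) -> 0 < e ->
  exists n (g : {ffun 'I_n -> bool} -> R),
    (\int[mu]_x `|f x - g (code U n x)|%:E <= e%:E)%E.
Proof.
move=> fi e0; have mf : measurable_fun setT f by apply/measurable_EFinP; exact: measurable_int fi.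
have [s [si sf cv]] := approximation_sfun_integrable measurableT fi.
have e20 : 0 < e / 2 by rewrite divr_gt0.
have [k hk] : exists k, (\int[mu]_x `|f x - s k x|%:E <= (e / 2)%:E)%E.
  move/fine_cvgP : cv => [[N1 _ hfin] /cvgrPdist_le/(_ _ e20)[N2 _ h]].
  exists (maxn N1 N2); have := h (maxn N1 N2) (leq_maxr _ _).
  have := hfin (maxn N1 N2) (leq_maxl _ _).
  move=> /= fin; rewrite sub0r normrN => /(le_trans (ler_norm _)).
  by rewrite -lee_fin fineK.
have [_ h] : approximable (s k).
  rewrite (funext (fimfunEord (s k))).
  apply: approximable_sum => i; apply: approximableZ; apply: approximable_indic.
  exact: measurable_funPTI.
have [n [g hg]] := h _ e20; exists n, g.
have msk : measurable_fun setT (s k) by exact: measurable_funPT.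
apply: (le_trans (@L1_triangle _ _ _ mu f (s k) (g \o code U n) mf msk (mcode _))).
by rewrite [e in leRHS]splitr EFinD leeD.
Qed.

(** The conditional expectation of a density of [nu], as a function of the code. On a cell of
    measure zero the quotient is 0 by the convention for division. *)
Definition avg (nu : {charge set T -> \bar R}) n (c : {ffun 'I_n -> bool}) : R :=
  fine (nu (cell U c)) / fine (mu (cell U c)).

Lemma avgM (nu : {charge set T -> \bar R}) n (c : {ffun 'I_n -> bool}) :
  (mu (cell U c) = 0 -> nu (cell U c) = 0)%E ->
  avg nu c * fine (mu (cell U c)) = fine (nu (cell U c)).
Proof.
move=> h; rewrite /avg; have [m0|m0] := eqVneq (fine (mu (cell U c))) 0; last by rewrite divfK.
have /h -> : (mu (cell U c) = 0)%E by rewrite -(fineK (muf (measurable_cell mU c))) m0.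
by rewrite m0 mulr0.
Qed.

Lemma integral_cst_cell n (c : {ffun 'I_n -> bool}) (g : {ffun 'I_n -> bool} -> R) :
  (\int[mu]_(x in cell U c) (g (code U n x))%:E = (g c * fine (mu (cell U c)))%:E)%E.
Proof.
rewrite (eq_integral (cst (g c)%:E)) => [|x].
  by rewrite integral_cst ?EFinM ?fineK ?muf//; exact: measurable_cell.
by rewrite inE /cell/= => ->.
Qed.

(** Averaging is an [L^1] contraction that fixes functions of the code. If [g] is such a function
    close to [h], then on each cell the integral of [|g - avg|] is [|int (h - g)|], so the distance
    from [h] to its average is at most twice that from [h] to [g]. A function of a coarse code is
    also one of every finer code, hence the bound for all [n >= N]. *)
Lemma avg_L1_cvg (nu : {charge set T -> \bar R}) (h : T -> R) (e : R) :
  is_density nu mu h -> 0 < e -> exists N, forall n, (N <= n)%N ->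
   (\int[mu]_x `|h x - avg nu (code U n x)|%:E <= e%:E)%E.
Proof.
move=> [hi nuE] e0; have e20 : 0 < e / 2 by rewrite divr_gt0.
have mh : measurable_fun setT h by apply/measurable_EFinP; exact: measurable_int hi.
have [N [g0 hg0]] := L1_code_approx hi e20.
exists N => n Nn.
pose g (c : {ffun 'I_n -> bool}) := g0 [ffun k => c (widen_ord Nn k)].
have gE x : g0 (code U N x) = g (code U n x) by rewrite /g -code_le.
have hg : (\int[mu]_x `|h x - g (code U n x)|%:E <= (e / 2)%:E)%E.
  by under eq_integral do rewrite -gE.
have tri := L1_triangle mu mh (mcode g) (mcode (@avg nu n)).
apply: (le_trans tri).
rewrite [e in leRHS]splitr EFinD leeD//; apply: le_trans hg.
rewrite (integral_cells mU mu n)//; last first.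
  apply/measurable_EFinP; apply: (measurableT_comp (@normr_measurable R setT)).
  by apply: measurable_funB; exact: mcode.
rewrite [leRHS](integral_cells mU mu n)//; last first.
  apply/measurable_EFinP; apply: (measurableT_comp (@normr_measurable R setT)).
  by apply: measurable_funB => //; exact: mcode.
apply: lee_sum => c _.
have mc := measurable_cell mU c.
have hic : mu.-integrable (cell U c) (EFin \o h) by exact: (integrableS measurableT).
have gic : mu.-integrable (cell U c) (EFin \o (g \o code U n)).
  by apply: (integrableS measurableT) => //; exact: integrable_code.
rewrite (integral_cst_cell c (fun c => `|g c - avg nu c|)).
have -> : `|g c - avg nu c| * fine (mu (cell U c)) =
    `|g c * fine (mu (cell U c)) - fine (nu (cell U c))|.
  rewrite -[X in _ * X]ger0_norm ?fine_ge0// -normrM mulrBl avgM//.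
  by move=> m0; rewrite nuE// null_set_integral//; exact: (measurable_int _ hic).
rewrite distrC.
have -> : fine (nu (cell U c)) - g c * fine (mu (cell U c)) =
    \int[mu]_(x in cell U c) (h x - g (code U n x)).
  by rewrite RintegralB// /Rintegral -nuE// integral_cst_cell.
have hgi : mu.-integrable (cell U c) (EFin \o (fun x => h x - g (code U n x))).
  exact: (integrableB mc hic gic).
rewrite EFin_normr_Rintegral//.
by apply: (le_abse_integral mu mc (measurable_int _ hgi)).
Qed.

End density_approx.

(** * Densities measurable jointly in time and space *)

Section joint_density.
Context d0 (T0 : measurableType d0) d (T : measurableType d) (R : realType).
Variable U : nat -> set T.
Hypothesis mU : forall n, measurable (U n).
Hypothesis genU : forall B, measurable B -> <<s range U>> B.
Variable mu : {finite_measure set T -> \bar R}.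
Variable nu : T0 -> {charge set T -> \bar R}.
Hypothesis mnu : forall B, measurable B -> measurable_fun setT (fun t => nu t B).

Let F n (z : T0 * T) : R := avg U mu (nu z.1) (code U n z.2).

Let mF n : measurable_fun setT (F n).
Proof.
move=> _ B mB; rewrite setTI.
pose A (c : {ffun 'I_n -> bool}) := (fun t => avg U mu (nu t) c) @^-1` B.
rewrite (_ : _ @^-1` _ = \bigcup_(c in [set: {ffun 'I_n -> bool}]) (A c `*` cell U c)).
  apply: fin_bigcup_measurable => [|c _]; first exact: finite_finset.
  apply: measurableX; last exact: measurable_cell.
  rewrite /A -[X in measurable X]setTI.
  suff : measurable_fun setT (fun t => avg U mu (nu t) c) by apply.
  apply: measurable_funM => //.
  apply: (measurableT_comp (@fine_measurable _ _ measurableT)).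
  by apply: mnu; exact: measurable_cell.
apply/seteqP; split => [z Bz|z [c _ [Ac cc]]].
  by exists (code U n z.2).
by rewrite /= /F cc.
Qed.

Let dist n m (t : T0) : \bar R := (\int[mu]_x `|F n (t, x) - F m (t, x)|%:E)%E.

Let mdist n m : measurable_fun setT (dist n m).
Proof.
apply: (measurable_fun_fubini_tonelli_F (fun z => `|F n z - F m z|%:E)) => //.
apply/measurable_EFinP; apply: (measurableT_comp (@normr_measurable R setT)).
exact: measurable_funB.
Qed.

(** From [N] on, the averages at time [t] are within [2^-(j+1)] of each other in [L^1]. The
    requirement [j <= N] makes the selected indices tend to infinity, even at times where the
    averages are stationary early. *)
Let P j N (t : T0) := (j <= N)%N /\ forall n m, (N <= n)%N -> (N <= m)%N ->
  (dist n m t <= (1 / (2 ^ j.+1)%:R)%:E)%E.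

Let mP j N : measurable [set t | P j N t].
Proof.
have [jN|jN] := leqP j N; last first.
  rewrite (_ : [set t | _] = set0)//; apply/seteqP; split => // t [].
  by rewrite leqNgt jN.
rewrite (_ : [set t | _] = \bigcap_(n in [set n | (N <= n)%N])
   \bigcap_(m in [set m | (N <= m)%N]) [set t | (dist n m t <= (1 / (2 ^ j.+1)%:R)%:E)%E]).
  apply: bigcap_measurableType => n _; apply: bigcap_measurableType => m _.
  by rewrite -[X in measurable X]setTI; exact: measurable_lee.
apply/seteqP; split => [t [_ h] n Nn m Nm|t h]; first exact: h.
by split => // n m Nn Nm; exact: h.
Qed.

Let Null n (c : {ffun 'I_n -> bool}) (t : T0) := (mu (cell U c) = 0 -> nu t (cell U c) = 0)%E.

(** Countably many measurable conditions that turn out to characterise [nu t << mu]. The condition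
    [Null] has to be added to the Cauchy condition because averages forget any charge carried by a
    cell of measure zero. *)
Let S := [set t | (forall n (c : {ffun 'I_n -> bool}), Null c t) /\ forall j, exists N, P j N t].

Let mS : measurable S.
Proof.
rewrite (_ : S = (\bigcap_n \bigcap_(c in [set: {ffun 'I_n -> bool}]) [set t | Null c t])
    `&` \bigcap_j \bigcup_N [set t | P j N t]).
  apply: measurableI.
    apply: bigcap_measurableType => n _; apply: fin_bigcap_measurable => [|c _].
      exact: finite_finset.
    have [m0|m0] := pselect (mu (cell U c) = 0)%E; last first.
      rewrite (_ : [set t | _] = setT)//; apply/seteqP; split => // t _ /=.
      by move=> /m0.
    rewrite (_ : [set t | _] = setT `&` [set t | nu t (cell U c) = 0%E]).
      by apply: measurable_eqe => //; apply: mnu; exact: measurable_cell.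
    rewrite setTI; apply/seteqP; split => t /=; first exact.
    by move=> + _.
  by apply: bigcap_measurableType => j _; apply: bigcup_measurable => N _; exact: mP.
apply/seteqP; split => t [h1 h2]; split.
- by move=> n _ c _; exact: h1.
- by move=> j _; have [N PN] := h2 j; exists N.
- by move=> n c; exact: h1.
- by move=> j; have [N _ PN] := h2 j I; exists N.
Qed.

Let least j t : {N | (exists N', P j N' t) -> P j N t /\ forall M, P j M t -> (N <= M)%N}.
Proof.
apply: cid; have [[N PN]|nP] := pselect (exists N', P j N' t); last by exists 0%N.
have ex : exists n, `[< P j n t >] by exists N; exact/asboolP.
exists (ex_minn ex) => _; case: ex_minnP => m /asboolP Pm h; split => // M PM.
by apply: h; exact/asboolP.
Qed.

(** Choosing the least index makes the choice measurable in [t]: each level set of [K j] is a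
    countable Boolean combination of the sets [P j N]. *)
Let K j t := if `[< exists N, P j N t >] then sval (least j t) else 0%N.

Let mK j N : measurable [set t | K j t = N].
Proof.
have mE : measurable (\bigcup_N [set t | P j N t]).
  by apply: bigcup_measurable => M _; exact: mP.
have mL : measurable ([set t | P j N t] `&` \bigcap_(M in [set M | (M < N)%N]) ~` [set t | P j M t]).
  apply: measurableI; first exact: mP.
  by apply: bigcap_measurableType => M _; apply: measurableC; exact: mP.
have h t M : P j M t -> K j t = N <-> P j N t /\ forall M, (M < N)%N -> ~ P j M t.
  move=> PM; rewrite /K asboolT; last by exists M.
  case: least => n /=; move=> /(_ (ex_intro _ M PM))[Pn ln]; split => [<-|[PN hN]].
    by split => // m mn /ln; rewrite leqNgt mn.
  apply/eqP; rewrite eqn_leq ln//= leqNgt; apply/negP => nN.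
  exact: hN Pn.
have [N0|N0] := eqVneq N 0%N.
  rewrite (_ : [set t | _] = ~` (\bigcup_N [set t | P j N t]) `|`
      ([set t | P j N t] `&` \bigcap_(M in [set M | (M < N)%N]) ~` [set t | P j M t])).
    by apply: measurableU => //; exact: measurableC.
  apply/seteqP; split => t.
    have [[M PM]|nP] := pselect (exists N', P j N' t).
      by move=> /(h _ _ PM) [? ?]; right.
    by move=> _; left => -[M _ PM]; apply: nP; exists M.
  have [[M PM]|nP] := pselect (exists N', P j N' t).
    by move=> [[]|[? ?]]; [exists M|apply/(h _ _ PM)].
  by move=> _; rewrite /= /K asboolF.
rewrite (_ : [set t | _] = ([set t | P j N t] `&` \bigcap_(M in [set M | (M < N)%N]) ~` [set t | P j M t]))//.
apply/seteqP; split => t.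
  have [[M PM]|nP] := pselect (exists N', P j N' t); first by move/(h _ _ PM).
  by rewrite /= /K asboolF// => /esym/eqP; rewrite (negbTE N0).
by move=> [PN hN]; apply/(h _ _ PN).
Qed.

Let G j z := F (K j z.1) z.

Let mG j : measurable_fun setT (G j).
Proof.
apply: (@measurable_fun_nat_index _ _ _ F (fun z => K j z.1)) => // n.
rewrite (_ : [set z | _] = [set t | K j t = n] `*` setT).
  by apply: measurableX.
by apply/seteqP; split => z //= [].
Qed.

(** The martingale property: a cell of level [n] is a union of cells of the finer level [m], and on
    each of these the average has the right integral. *)
Let charge_avg (t : T0) n m (c : {ffun 'I_n -> bool}) : (n <= m)%N -> S t ->
  (\int[mu]_(x in cell U c) (avg U mu (nu t) (code U m x))%:E)%E = nu t (cell U c).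
Proof.
move=> nm [nul _].
have ia := integrable_code mU mu (@avg _ _ _ U mu (nu t) m).
pose ka : {charge set T -> \bar R} := induced_charge ia.
have [Q QE] := clopen_codeW U (pred1 c) nm.
have -> : cell U c = [set x | code U m x \in enum Q].
  transitivity [set x | pred1 c (code U n x)].
    by apply/seteqP; split => x /= => [->|/eqP].
  by rewrite QE; apply/seteqP; split => x /=; rewrite mem_enum.
transitivity (ka [set x | code U m x \in enum Q]); first by [].
rewrite !(charge_code mU) ?enum_uniq//; apply: eq_bigr => c' _.
rewrite /ka/= /induced_charge /= integral_cst_cell// avgM//; last exact: nul.
rewrite fineK// fin_num_measure//; exact: measurable_cell.
Qed.

(** For [t] in [S], the averages at the indices [K j t] have summable [L^1] increments, so they
    converge almost everywhere, and their limit has the integral of a density over every cell, hence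
    over every measurable set. Conversely, if [nu t << mu], the averages converge in [L^1] to the
    Radon-Nikodym derivative and are therefore Cauchy, which puts [t] in [S]. *)
Theorem joint_density : exists (D : set T0) (h : T0 * T -> R),
  [/\ measurable D, measurable_fun setT h, (forall t, D t <-> nu t `<< mu) &
      forall t, D t -> is_density (nu t) mu (fun x => h (t, x))].
Proof.
have mufin : (mu setT < +oo)%E by rewrite -ge0_fin_numE// fin_num_measure.
have dens t : S t -> is_density (nu t) mu (fun x => lim_fun G (t, x)).
  move=> St; have [nul PS] := St.
  have KP j : P j (K j t) t /\ forall M, P j M t -> (K j t <= M)%N.
    by rewrite /K asboolT//; case: least => n /=; apply.
  have K_nd j : (K j t <= K j.+1 t)%N.
    apply: (KP j).2; have [[jK h] _] := KP j.+1; split; first exact: ltnW.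
    move=> n m Kn Km; apply: (le_trans (h _ _ Kn Km)); rewrite lee_fin !div1r.
    by rewrite lef_pV2 ?posrE ?ltr0n ?expn_gt0// ler_nat leq_exp2l.
  pose f j x := G j (t, x).
  have mf j : measurable_fun setT (f j).
    exact: (measurableT_comp (mG j) (measurable_pair1 t)).
  have if0 j : mu.-integrable setT (EFin \o f j).
    exact: (integrable_code mU mu (@avg _ _ _ U mu (nu t) (K j t))).
  have [|cv [g ig fg]] := @L1_fast_cvg _ _ _ mu f mf (if0 0%N).
    apply: (@le_lt_trans _ _ 1%:E); last exact: ltry.
    apply: le_trans (epsilon_trick0 predT ler01).
    apply: lee_nneseries => [n _ _|n _]; first exact: integral_ge0.
    have h := ((KP n).1).2 (K n.+1 t) (K n t) (K_nd n) (leqnn _).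
    by rewrite /f /G.
  have fE x : lim_fun G (t, x) = lim_fun f x by [].
  have DC B : measurable B -> mu.-integrable B (EFin \o lim_fun f) /\
     (\int[mu]_(x in B) (f n x)%:E)%E @[n --> \oo] --> (\int[mu]_(x in B) (lim_fun f x)%:E)%E.
    move=> mB; have [] // := @dominated_convergence _ _ _ mu _ mB
      (fun n => EFin \o f n) (EFin \o lim_fun f) g.
    - by move=> n; apply/measurable_EFinP; exact: measurable_funTS.
    - by apply/measurable_EFinP; apply: measurable_funTS; exact: measurable_lim_fun.
    - move: cv; apply: filterS => z xz _.
      by apply: cvg_EFin => //; exact: nearW.
    - exact: (integrableS measurableT).
    - by apply: aeW => z n _; exact: fg.
  split; first exact: (DC _ measurableT).1.
  have il := (DC _ measurableT).1.
  pose kl : {charge set T -> \bar R} := induced_charge il.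
  move=> B mB; apply: (charge_ext_cells mU genU (nu2 := kl)) => // n c.
  have := (DC _ (measurable_cell mU c)).2.
  apply: cvg_unique; first exact: ereal_hausdorff.
  (* Since [K m t >= m >= n], the integrals over a cell of level [n] are all equal to its charge
     from [m = n] on. *)
  apply: cvg_near_cst; exists n => // m /= nm.
  transitivity (\int[mu]_(x in cell U c) (avg U mu (nu t) (code U (K m t) x))%:E)%E; first by [].
  apply: charge_avg => //; apply: (leq_trans nm); exact: ((KP m).1).1.
exists S, (lim_fun G); split => //; first exact: measurable_lim_fun.
move=> t; split => [/dens[hi nuE]|nut].
  apply/null_content_dominatesP => B mB B0.
  rewrite nuE// null_set_integral//.
  by apply: measurable_funTS; exact: measurable_int hi.
have [rn [rnfin rni rnE]] : exists rn : T -> \bar R, [/\ forall x, rn x \is a fin_num,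
    mu.-integrable setT rn & forall B, measurable B -> nu t B = (\int[mu]_(x in B) rn x)%E].
  exists (Radon_Nikodym (nu t) mu); split.
  - by move=> x; exact: Radon_Nikodym_fin_num.
  - exact: Radon_Nikodym_integrable.
  - by move=> B mB; exact: Radon_Nikodym_integral.
have dn : is_density (nu t) mu (fine \o rn).
  have rE : EFin \o (fine \o rn) = rn by apply/funext => x /=; rewrite fineK.
  by split => [|B mB]; [rewrite rE|rewrite rnE//; apply: eq_integral => x _ /=; rewrite fineK].
split.
  by move=> n c m0; move/null_content_dominatesP : nut; apply => //; exact: measurable_cell.
move=> j; have e0 : 0 < 1 / (2 ^ j.+1)%:R / 2 :> R by rewrite !divr_gt0// ltr0n expn_gt0.
have [N hN] := avg_L1_cvg mU genU dn e0.
exists (maxn j N); split; first exact: leq_maxl.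
move=> n m; rewrite !geq_max => /andP[_ Nn] /andP[_ Nm].
have mh : measurable_fun setT (fine \o rn).
  by apply/measurable_EFinP; exact: (measurable_int _ dn.1).
have mc k := measurable_code mU (@avg _ _ _ U mu (nu t) k).
have tri := L1_triangle mu (mc n) mh (mc m).
rewrite [X in (_ <= X%:E)%E]splitr EFinD; apply: (le_trans tri); apply: leeD.
  by under eq_integral do rewrite distrC; exact: hN.
exact: hN.
Qed.

End joint_density.

(** * The functions Psi *)

Lemma lee_of_real_lt (R : realType) (x y : \bar R) :
  (forall c : R, (c%:E < x)%E -> (c%:E <= y)%E) -> (x <= y)%E.
Proof.
move: x y => [r| |] [s| |] h //; rewrite ?leey ?leNye//.
- rewrite lee_fin leNgt; apply/negP => sr.
  have : (((s + r) / 2)%:E < r%:E)%E by rewrite lte_fin; clear h; lra.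
  move=> /h; rewrite lee_fin; clear h; by lra.
- by have /h : ((r - 1)%:E < r%:E)%E by rewrite lte_fin ltrBlDr ltrDl.
- have := h (s + 1) (ltry _); by rewrite lee_fin gerDl ler10.
- by have := h 0 (ltry _).
Qed.

Section mobility.
Context (R : realType) (m : R -> \bar R) (a b : R).
Hypothesis m_adm : admissible_mobility m a b.

Lemma mobility_cases z : m z = -oo%E \/ exists2 r : R, 0 <= r & m z = r%:E.
Proof.
case: (mob_range m_adm z) => [->|]; first by left.
case: (m z) => [r /andP[r0 _]|/andP[]|/andP[]]//.
by right; exists r.
Qed.

(** The midpoint [y] of the domain is halfway between [z] and its reflection [a + b - z]. There [m]
    is nonnegative, so concavity gives [m z <= 2 m y]. *)
Lemma mobility_bounded : exists2 C : R, 0 <= C & forall z, (m z <= C%:E)%E.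
Proof.
pose y := (a + b) / 2; have ab := mob_a_lt_b m_adm.
have [my|[r r0 my]] := mobility_cases y.
  have : (-oo < m y)%E by apply/(mob_dom m_adm)/andP; split; rewrite /y; lra.
  by rewrite my.
exists (2 * r); first by rewrite mulr_ge0.
move=> z; have [->|[s s0 mz]] := mobility_cases z; first exact: leNye.
have : (-oo < m z)%E by rewrite mz ltNyr.
move=> /(mob_dom m_adm) zab.
have [mz'|[s' s'0 mz']] := mobility_cases (a + b - z).
  have : (-oo < m (a + b - z))%E by apply/(mob_dom m_adm)/andP; split; lra.
  by rewrite mz'.
have h : 0 <= (2^-1 : R) <= 1 by apply/andP; split; lra.
have := mob_concave m_adm z (a + b - z) h.
have -> : 2^-1 * z + (1 - 2^-1) * (a + b - z) = y by rewrite /y; field.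
by rewrite mz mz' my -!EFinM -EFinD !lee_fin; lra.
Qed.

Lemma measurable_mobility : measurable_fun setT m.
Proof.
have -> : m = (fun z => - (- m z))%E by apply/funext => z; rewrite oppeK.
apply: measurableT_comp; first exact: oppe_measurable.
exact: lower_semicontinuous_measurable (mob_usc m_adm).
Qed.

Variable N : nat.
Implicit Types (z : R) (w : 'rV[R]_N) (p : 'I_N -> R).

(** For fixed [p] this is affine in [w], and convex and lower semicontinuous in [z], since the
    concave upper semicontinuous [m] enters with a nonpositive factor. The supremum over [p] is
    [Psi], a Legendre transform of [|w|^2 / m] in the variable [w]. *)
Definition Psi_affine p z w : \bar R :=
  ((2 * \sum_i p i * w ord0 i)%:E - (\sum_i p i ^+ 2)%:E * m z)%E.

Lemma enorm_sqr w : enorm w ^+ 2 = \sum_i w ord0 i ^+ 2.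
Proof. by rewrite sqr_sqrtr// sumr_ge0// => i _; exact: sqr_ge0. Qed.

(** For [r = m z > 0] this is the square [(p_i r - w_i)^2 >= 0] divided by [r], summed over the
    components. *)
Lemma Psi_affine_le p z w : (Psi_affine p z w <= Psi m z w)%E.
Proof.
rewrite /Psi_affine /Psi; have [->|[r r0 ->]] := mobility_cases z.
  by rewrite eqxx leey.
rewrite eqe (_ : (r%:E == -oo%E) = false)//; case: (eqVneq r 0) => [->|rn0].
  case: (eqVneq w 0) => [->|_]; last exact: leey.
  rewrite -EFinM mulr0 -EFinB subr0 lee_fin big1 ?mulr0// => i _.
  by rewrite mxE mulr0.
have {r0 rn0} r0 : 0 < r by rewrite lt_neqAle eq_sym rn0.
rewrite -EFinM -EFinB lee_fin ler_pdivlMr// enorm_sqr mulrBl !mulr_sumr !mulr_suml.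
rewrite -sumrB; apply: ler_sum => i _; move: (p i) (w ord0 i) => x y.
have : 0 <= (x * r - y) ^+ 2 by rewrite sqr_ge0.
rewrite /=; nra.
Qed.

(* The supremum of the affine minorants is approached at [p = w / m z], along
   [p = k w] with [k] large if [m z = 0], and at any [p <> 0] off the domain. *)
Lemma Psi_affine_sup (c : R) z w : (0 < N)%N ->
  (c%:E < Psi m z w)%E -> exists p, (c%:E < Psi_affine p z w)%E.
Proof.
move=> N0; rewrite /Psi_affine /Psi; have [->|[r r0 ->]] := mobility_cases z.
  move=> _; exists (fun=> 1).
  have -> : \sum_(i < N) (1 : R) ^+ 2 = N%:R.
    by under eq_bigr do rewrite expr1n; rewrite sumr_const cardT size_enum_ord.
  by rewrite gt0_muleNy ?lte_fin ?ltr0n// addey ?ltry.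
rewrite eqe (_ : (r%:E == -oo%E) = false)//; case: (eqVneq r 0) => [->|rn0].
  case: (eqVneq w 0) => [->|wn0].
    move=> c0; exists (fun=> 0); rewrite -EFinM mulr0 -EFinB subr0 big1 ?mulr0// => i _.
    by rewrite mul0r.
  move=> _; have w0 : 0 < enorm w ^+ 2.
    rewrite enorm_sqr lt_neqAle eq_sym sumr_ge0 ?andbT => [|i _]; last exact: sqr_ge0.
    apply: contra wn0 => /eqP/psumr_eq0P h; apply/eqP/rowP => i; rewrite mxE.
    by apply/eqP; rewrite -sqrf_eq0 h// => j _; exact: sqr_ge0.
  exists (fun i => (`|c| + 1) / (enorm w ^+ 2) * w ord0 i).
  rewrite -EFinM mulr0 -EFinB subr0 lte_fin.
  rewrite (eq_bigr (fun i => (`|c| + 1) / (enorm w ^+ 2) * w ord0 i ^+ 2)) => [|i _]; last by rewrite expr2 mulrA.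
  rewrite -mulr_sumr -enorm_sqr divfK ?gt_eqF//.
  by have := ler_norm c; have := normr_ge0 c; lra.
have {r0 rn0} r0 : 0 < r by rewrite lt_neqAle eq_sym rn0.
move=> cw; exists (fun i => w ord0 i / r); move: cw.
rewrite -EFinM -EFinB !lte_fin; congr (_ < _).
rewrite (eq_bigr (fun i => r^-1 * w ord0 i ^+ 2)) => [|i _]; last by field; rewrite gt_eqF.
rewrite [in X in _ = _ - X](eq_bigr (fun i => r^-1 ^+ 2 * w ord0 i ^+ 2)) => [|i _]; last by field; rewrite gt_eqF.
by rewrite -!mulr_sumr -enorm_sqr /=; field; rewrite gt_eqF.
Qed.

Lemma Psi_ge0 z w : (0 <= Psi m z w)%E.
Proof.
rewrite /Psi; have [->|[r r0 ->]] := mobility_cases z; first by rewrite eqxx.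
rewrite eqe/=; case: eqP => // _; first by case: ifP.
by rewrite lee_fin divr_ge0// sqr_ge0.
Qed.

(** If [Psi] at the midpoint exceeded the mean of its values, so would some minorant [Psi_affine p];
    but this minorant is midpoint convex and lies below [Psi] at both ends. *)
Lemma Psi_midpoint_convex z1 z2 w1 w2 : (0 < N)%N ->
  (Psi m (2^-1 * (z1 + z2)) (2^-1 *: (w1 + w2)) <=
   2^-1%:E * (Psi m z1 w1 + Psi m z2 w2))%E.
Proof.
move=> N0.
have [mz1|[r1 r10 mz1]] := mobility_cases z1.
  by rewrite {2}/Psi mz1 eqxx addye ?gt0_muley ?leey ?lte_fin ?invr_gt0// -ltNye (lt_le_trans _ (Psi_ge0 _ _)).
have [mz2|[r2 r20 mz2]] := mobility_cases z2.
  by rewrite {3}/Psi mz2 eqxx addey ?gt0_muley ?leey ?lte_fin ?invr_gt0// -ltNye (lt_le_trans _ (Psi_ge0 _ _)).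
rewrite leNgt; apply/negP => h.
have P0 := adde_ge0 (Psi_ge0 z1 w1) (Psi_ge0 z2 w2).
have [s sE] : exists s, (2^-1%:E * (Psi m z1 w1 + Psi m z2 w2))%E = s%:E.
  exists (fine (2^-1%:E * (Psi m z1 w1 + Psi m z2 w2))%E); rewrite fineK//.
  rewrite ge0_fin_numE; first by apply: (lt_le_trans h); exact: leey.
  by rewrite mule_ge0.
rewrite sE in h.
have [p] := Psi_affine_sup N0 h; rewrite ltNge => /negP; apply.
rewrite -sE; apply: (@le_trans _ _ (2^-1%:E * (Psi_affine p z1 w1 + Psi_affine p z2 w2)))%E; last first.
  by rewrite lee_wpmul2l// leeD// Psi_affine_le.
have hh : 0 <= (2^-1 : R) <= 1 by apply/andP; split; lra.
have := mob_concave m_adm z1 z2 hh.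
have -> : 2^-1 * z1 + (1 - 2^-1) * z2 = 2^-1 * (z1 + z2) by field.
have -> : 1 - 2^-1 = 2^-1 :> R by field.
rewrite /Psi_affine mz1 mz2.
have -> : \sum_i p i * (2^-1 *: (w1 + w2)) ord0 i =
   2^-1 * (\sum_i p i * w1 ord0 i + \sum_i p i * w2 ord0 i).
  rewrite -big_split/= mulr_sumr; apply: eq_bigr => i _; rewrite !mxE; ring.
have [->//|[r r0 ->]] := mobility_cases (2^-1 * (z1 + z2)).
move: (\sum_i p i * w1 ord0 i) (\sum_i p i * w2 ord0 i) => x1 x2.
have : 0 <= \sum_i p i ^+ 2 by rewrite sumr_ge0// => i _; exact: sqr_ge0.
move: (\sum_i p i ^+ 2) => P P1.
rewrite -?EFinM -?EFinB -?EFinD -?EFinM !lee_fin => hr.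
have := ler_wpM2l P1 hr; lra.
Qed.

(** A minorant that exceeds [c] at the limit still does so along the sequence: its linear part is
    continuous, and upper semicontinuity of [m] bounds the other part from the right side. *)
Lemma Psi_lower_semicontinuous (zn : nat -> R) (wn : nat -> 'rV[R]_N) z w : (0 < N)%N ->
  zn @ \oo --> z -> (forall i, wn ^~ ord0 ^~ i @ \oo --> w ord0 i) ->
  (Psi m z w <= limn_einf (fun n => Psi m (zn n) (wn n)))%E.
Proof.
move=> N0 zz ww; have usc := mob_usc m_adm; rewrite /lower_semicontinuous in usc.
apply: lee_of_real_lt => c; move=> /(Psi_affine_sup N0)[p cp].
have cn : \forall n \near \oo, (c%:E <= Psi m (zn n) (wn n))%E.
  move: cp; rewrite /Psi_affine; have [mz _|[r r0 mz]] := mobility_cases z.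
    (* Off the domain, upper semicontinuity makes [m] negative near [z]. Its only negative value is
       [-oo], so [Psi] is infinite there. *)
    have [|V Vz V0] := usc z 0; first by rewrite mz ltry.
    near=> n; rewrite /Psi.
    have : V (zn n) by near: n; exact: zz.
    move=> /V0; have [->|[s s0 ->]] := mobility_cases (zn n); first by rewrite eqxx leey.
    by rewrite -EFinN lte_fin oppr_gt0 ltNge s0.
  rewrite mz -EFinM -EFinB lte_fin.
  have wwp : 2 * (\sum_i p i * wn n ord0 i) @[n --> \oo] --> 2 * \sum_i p i * w ord0 i.
    by apply: cvgMr; apply: cvg_sumr => i; apply: cvgMr; exact: ww.
  have s0 : 0 <= \sum_i p i ^+ 2 by rewrite sumr_ge0// => i _; exact: sqr_ge0.
  move: (2 * \sum_i p i * w ord0 i) wwp => x wx.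
  set s := (\sum_i p i ^+ 2) in s0 * => cx.
  (* The slack [e] is shared equally between the linear part and [s * m]. The tolerance [e1] for [m]
     is chosen so that [s * e1 <= e / 2], with [s + 1] in the denominator because [s] may vanish. *)
  pose e := x - s * r - c; have e0 : 0 < e by rewrite /e; lra.
  pose e1 := e / (2 * (s + 1)); have e10 : 0 < e1 by rewrite divr_gt0//; lra.
  have se1 : s * e1 <= e / 2.
    by rewrite /e1 mulrA ler_pdivrMr//; [nra|lra].
  have [|V Vz Vr] := usc z (- (r + e1)).
    by rewrite mz -EFinN lte_fin; lra.
  near=> n.
  have xn : x - e / 2 < 2 * (\sum_i p i * wn n ord0 i).
    by near: n; apply: cvgr_gt wx _ _; lra.
  have : V (zn n) by near: n; exact: zz.
  move=> /Vr; have [mzn|[s' s'0 mzn]] := mobility_cases (zn n).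
    by rewrite /Psi mzn eqxx leey.
  rewrite mzn -EFinN lte_fin ltrN2 => hs.
  apply: le_trans (Psi_affine_le p (zn n) (wn n)).
  rewrite /Psi_affine mzn -EFinM -EFinB lee_fin.
  have : s * s' <= s * (r + e1) by rewrite ler_wpM2l// ltW.
  by rewrite mulrDr; have := se1; have := xn; rewrite /e -/s; lra.
rewrite limn_einf_lim; apply: lime_ge; first exact: is_cvg_einfs.
have [n0 _ hn0] := cn.
near=> n; rewrite /einfs/=; apply: le_ereal_inf_tmp => _ [k /= nk <-].
by apply: hn0 => /=; apply: leq_trans nk; near: n; exact: nbhs_infty_ge.
Unshelve. all: by end_near.
Qed.


(** Where [Psi] is finite, [z] lies in [[a, b]] with [a >= 0], so [z^2 <= b^2]; and [m <= C] gives
    [w_i^2 <= C |w|^2 / m(z)]. The summand 1 keeps the constant positive, so that its product with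
    [+oo] is [+oo]. *)
Lemma Psi_coercive : exists2 C : R, 0 <= C & forall z w,
  ((z ^+ 2)%:E <= C%:E * (1 + Psi m z w))%E /\
  (forall i, (w ord0 i ^+ 2)%:E <= C%:E * (1 + Psi m z w))%E.
Proof.
have [C C0 mC] := mobility_bounded.
have b0 : 0 <= b by have := mob_a_ge0 m_adm; have := mob_a_lt_b m_adm; lra.
exists (b ^+ 2 + C + 1) => [|z w]; first by have := sqr_ge0 b; lra.
have cpos : 0 < b ^+ 2 + C + 1 by have := sqr_ge0 b; lra.
have top : ((b ^+ 2 + C + 1)%:E * (1 + +oo))%E = +oo%E by rewrite addey// gt0_muley.
rewrite /Psi; have [->|[r r0 mz]] := mobility_cases z.
  by rewrite eqxx top; split => [|i]; exact: leey.
have zab : a <= z <= b by apply/(mob_dom m_adm); rewrite mz ltNyr.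
have zb : z ^+ 2 <= b ^+ 2.
  have z0 : 0 <= z by have := mob_a_ge0 m_adm; move: zab => /andP[]; lra.
  by rewrite ler_pXn2r ?nnegrE//; have := mob_a_ge0 m_adm; move: zab => /andP[]; lra.
have hz e : 0 <= e -> z ^+ 2 <= (b ^+ 2 + C + 1) * (1 + e).
  move=> e0; have : 0 <= (b ^+ 2 + C + 1) * e by rewrite mulr_ge0// ltW.
  lra.
rewrite mz eqe (_ : (r%:E == -oo%E) = false)//; case: (eqVneq r 0) => [_|rn0].
  case: (eqVneq w 0) => [->|_]; last by rewrite top; split => [|i]; exact: leey.
  rewrite -EFinD -EFinM lee_fin; split => [|i]; first exact: hz.
  by rewrite mxE expr0n /= lee_fin mulr_ge0 ?addr0 ?(ltW cpos).
have {r0 rn0} r0 : 0 < r by rewrite lt_neqAle eq_sym rn0.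
rewrite -EFinD -EFinM lee_fin/=.
have e0 : 0 <= enorm w ^+ 2 / r by rewrite divr_ge0 ?sqr_ge0// ltW.
split => [|i]; first exact: hz.
rewrite lee_fin.
have wi : w ord0 i ^+ 2 <= enorm w ^+ 2.
  rewrite enorm_sqr (bigD1 i)//= lerDl sumr_ge0// => j _; exact: sqr_ge0.
have rC : r <= C by rewrite -lee_fin -mz.
have h : w ord0 i ^+ 2 <= C * (enorm w ^+ 2 / r).
  apply: (le_trans wi).
  by rewrite mulrA ler_pdivlMr// [leRHS]mulrC ler_wpM2l// sqr_ge0.
apply: (le_trans h).
have : 0 <= (b ^+ 2 + 1) * (enorm w ^+ 2 / r) by rewrite mulr_ge0// addr_ge0 ?sqr_ge0.
have := sqr_ge0 b; lra.
Qed.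

Lemma measurable_Psi d (T : measurableType d) (f : T -> R) (g : T -> 'rV[R]_N) :
  measurable_fun setT f -> (forall i, measurable_fun setT (fun x => g x ord0 i)) ->
  measurable_fun setT (fun x => Psi m (f x) (g x)).
Proof.
move=> mf mg.
have mmf : measurable_fun setT (m \o f) by apply: measurableT_comp => //; exact: measurable_mobility.
have mq : measurable_fun setT (fun x => enorm (g x) ^+ 2).
  under eq_fun do rewrite enorm_sqr.
  by apply: measurable_sum => i; exact: measurable_funX.
have wE x : (g x == 0) = (enorm (g x) ^+ 2 == 0).
  rewrite enorm_sqr; apply/eqP/eqP => [->|/psumr_eq0P h].
    by rewrite big1// => i _; rewrite mxE expr0n.
  apply/rowP => i; rewrite mxE; apply/eqP; rewrite -sqrf_eq0 h// => j _; exact: sqr_ge0.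
rewrite /Psi; apply: measurable_fun_ifT => //.
  by apply: measurable_fun_eqe.
apply: measurable_fun_ifT => //; first exact: measurable_fun_eqe.
  under eq_fun do rewrite wE.
  apply: measurable_fun_ifT => //; exact: measurable_fun_eqr.
have -> : (fun x => (enorm (g x) ^+ 2 / fine (m (f x)))%:E) =
    (fun x => (enorm (g x) ^+ 2 * (fine (m (f x))) `^ (-1))%:E).
  apply/funext => x; congr (_ * _)%:E; rewrite powRN powRr1//.
  by have [->|[r r0 ->]] := mobility_cases (f x).
apply/measurable_EFinP/measurable_funM => //.
apply: (measurableT_comp (measurable_powR _)).
by apply: measurableT_comp mmf.
Qed.


End mobility.

(** * Borel sets of R^d and integration against charges *)

Definition topological_basis_seq (T : topologicalType) (U : nat -> set T) :=
  (forall n, open (U n)) /\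
  forall (W : set T) x, open W -> W x -> exists2 n, U n x & U n `<=` W.

Lemma open_bigcup_basis (T : topologicalType) (U : nat -> set T) (W : set T) :
  topological_basis_seq U -> open W -> W = \bigcup_(n in [set n | U n `<=` W]) U n.
Proof.
move=> [_ hU] oW; apply/seteqP; split => [x Wx|x [n /= UW Ux]]; last exact: UW.
by have [n Ux UW] := hU W x oW Wx; exists n.
Qed.

(** Sup-norm balls with rational centre and radius [1/(n+1)]. A ball of radius less than [e/2] whose
    centre is that close to [x] contains [x] and lies in the ball of radius [e] around [x]. *)
Lemma matrix_basis_seq (R : realType) (d : nat) :
  exists U : nat -> set 'rV[R]_d, topological_basis_seq U.
Proof.
pose B (p : {ffun 'I_d -> rat} * nat) : set 'rV[R]_d :=
  [set x | forall i, `|ratr (p.1 i) - x ord0 i| < p.2.+1%:R^-1].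
exists (fun k => if unpickle k is Some p then B p else set0).
have Bball p : B p = ball (\row_i (ratr (p.1 i) : R)) p.2.+1%:R^-1.
  apply/seteqP; split => x /= => [h|[_ h] i].
    by split => [|i j]; rewrite ?invr_gt0// ord1 mxE; exact: h.
  by have := h ord0 i; rewrite mxE.
split => [n|W x oW Wx].
  case: unpickle => [p|]; last exact: open0.
  by rewrite Bball; apply: ball_open; rewrite invr_gt0.
have /nbhs_ballP[e /= e0 xW] : nbhs x W by exact: open_nbhs_nbhs.
have e20 : 0 < e / 2 by rewrite divr_gt0.
have [n _ hn] := near_infty_natSinv_lt (PosNum e20).
have {hn} hn : n.+1%:R^-1 < e / 2 by exact: (hn n (leqnn n)).
have n0 : 0 < n.+1%:R^-1 :> R by rewrite invr_gt0.
have [r rE] : exists r : R, r = n.+1%:R^-1 by exists n.+1%:R^-1.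
rewrite -rE in hn n0.
have [q hq] : exists q : 'I_d -> rat, forall i, `|ratr (q i) - x ord0 i| < r.
  suff /boolp.choice[q hq] : forall i, exists q : rat, `|ratr q - x ord0 i| < r by exists q.
  move=> i; have [|q] := @rat_in_itvoo R (x ord0 i - r) (x ord0 i + r); first lra.
  by rewrite in_itv/= => /andP[h1 h2]; exists q; rewrite ltr_norml; apply/andP; split; lra.
exists (pickle ([ffun i => q i], n)); rewrite pickleK /B/= -rE.
  by move=> i; rewrite ffunE.
move=> y yB; apply: xW; split => // i j; rewrite ord1; have := yB j; rewrite ffunE => h1.
rewrite /ball/=; have := hq j; rewrite ltr_norml => /andP[h2 h3].
by move: h1; rewrite !ltr_norml => /andP[h4 h5]; apply/andP; split; lra.
Qed.

Lemma real_basis_seq (R : realType) : exists U : nat -> set R, topological_basis_seq U.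
Proof.
exists (fun k => if unpickle k is Some p then `]ratr p.1, ratr p.2[%classic else set0).
split => [n|W x oW Wx].
  by case: unpickle => [p|]; [exact: interval_open|exact: open0].
have /nbhs_ballP[e /= e0 xW] : nbhs x W by exact: open_nbhs_nbhs.
have [|q1] := @rat_in_itvoo R (x - e) x; first lra.
have [|q2] := @rat_in_itvoo R x (x + e); first lra.
rewrite !in_itv/= => /andP[h1 h2] /andP[h3 h4].
exists (pickle (q1, q2)); rewrite pickleK /=; first by rewrite in_itv/= h4.
move=> y; rewrite /= in_itv/= => /andP[h5 h6]; apply: xW.
by rewrite /ball/= ltr_norml; apply/andP; split; lra.
Qed.

(** With countable bases, an open set of the product is a countable union of open rectangles, so it
    belongs to the product sigma-algebra. The maps [i1] and [i2] are needed because the topological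
    and the measurable structure sit on different types. *)
Lemma measurable_basis_prod (T1 T2 : topologicalType) (d1 d2 : measure_display)
    (M1 : measurableType d1) (M2 : measurableType d2)
    (i1 : M1 -> T1) (i2 : M2 -> T2) (U1 : nat -> set T1) (U2 : nat -> set T2)
    (W : set (T1 * T2)) :
  topological_basis_seq U1 -> topological_basis_seq U2 ->
  (forall W, open W -> measurable (i1 @^-1` W)) ->
  (forall W, open W -> measurable (i2 @^-1` W)) ->
  open W -> measurable [set z : M1 * M2 | W (i1 z.1, i2 z.2)].
Proof.
move=> [open1 b1] [open2 b2] m1 m2 oW.
rewrite (_ : [set z | _] = \bigcup_m \bigcup_(n in [set n | U1 m `*` U2 n `<=` W])
    ((i1 @^-1` U1 m) `*` (i2 @^-1` U2 n))).
  apply: bigcup_measurable => m _; apply: bigcup_measurable => n _.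
  by apply: measurableX; [exact: m1 (open1 m)|exact: m2 (open2 n)].
apply/seteqP; split => [[x y] /= Wz|[x y] [m _ [n /= UW [Ux Uy]]]]; last exact: UW.
have /= [[A B] /= [nA nB] ABW] : nbhs (i1 x, i2 y) W by exact: open_nbhs_nbhs.
move: nA nB; rewrite !nbhsE => -[A' [oA' A'x] A'A] [B' [oB' B'y] B'B].
have [m Ux UA] := b1 _ _ oA' A'x; have [n Uy UB] := b2 _ _ oB' B'y.
by exists m => //; exists n => //= z [/UA/A'A z1 /UB/B'B z2]; exact: ABW.
Qed.

Section borel_Rd.
Context (R : realType) (d : nat).

Lemma open_measurable_Rd (W : set 'rV[R]_d) : open W -> measurable (W : set (Rd R d)).
Proof. by move=> oW; exact: sub_sigma_algebra. Qed.

Lemma closed_measurable_Rd (W : set 'rV[R]_d) : closed W -> measurable (W : set (Rd R d)).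
Proof.
move=> cW; rewrite -[X in measurable X]setCK; apply: measurableC.
by apply: open_measurable_Rd; exact: closed_openC.
Qed.

Lemma compact_measurable_Rd (W : set 'rV[R]_d) : compact W -> measurable (W : set (Rd R d)).
Proof.
by move=> cW; apply: closed_measurable_Rd; apply: compact_closed => //; exact: norm_hausdorff.
Qed.

Lemma Rd_generating_seq : exists2 U : nat -> set (Rd R d), (forall n, measurable (U n)) &
  forall B : set (Rd R d), measurable B -> <<s range U>> B.
Proof.
have [U hU] := matrix_basis_seq R d.
exists U => [n|]; first by apply: open_measurable_Rd; case: hU.
apply: smallest_sub; first exact: smallest_sigma_algebra.
move=> W oW; rewrite (open_bigcup_basis hU oW) bigcup_mkcond.
have [s0 _ sU] := smallest_sigma_algebra [set: Rd R d] (range U).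
apply: sU => n; case: ifP => _; last exact: s0.
by apply: sub_sigma_algebra; exists n.
Qed.

Lemma measurable_continuous_Rd (f : R * 'rV[R]_d -> R) : continuous f ->
  measurable_fun setT (f : R * Rd R d -> R).
Proof.
move=> /continuousP cf; apply: (measurability (@RGenOInfty.G R)).
  exact: RGenOInfty.measurableE.
move=> _ [_ [r ->] <-]; rewrite setTI.
have [U1 b1] := real_basis_seq R; have [U2 b2] := matrix_basis_seq R d.
have := measurable_basis_prod (i1 := idfun : R -> R) (i2 := idfun : Rd R d -> 'rV[R]_d)
  b1 b2 _ _ (cf _ (rray_open r)).
rewrite (_ : [set z | _] = f @^-1` `]r, +oo[).
  by apply => W oW; [exact: open_measurable|exact: open_measurable_Rd].
by apply/seteqP; split => -[].
Qed.

Lemma measurable_continuous_prod_real (f : R * R -> R) : continuous f ->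
  measurable_fun setT f.
Proof.
move=> /continuousP cf; apply: (measurability (@RGenOInfty.G R)).
  exact: RGenOInfty.measurableE.
move=> _ [_ [r ->] <-]; rewrite setTI.
have [U1 b1] := real_basis_seq R.
have := measurable_basis_prod (i1 := idfun : R -> R) (i2 := idfun : R -> R)
  b1 b1 _ _ (cf _ (rray_open r)).
rewrite (_ : [set z | _] = f @^-1` `]r, +oo[).
  by apply => W oW; exact: open_measurable.
by apply/seteqP; split => -[].
Qed.

End borel_Rd.

Lemma continuous_compact_bounded (T : topologicalType) (R : realType) (f : T -> R) (K : set T) :
  {within K, continuous f} -> compact K -> exists C : R, forall x, K x -> `|f x| <= C.
Proof.
move=> cf cK; have := @compact_bounded R R^o _ (continuous_compact cf cK).
move=> [C [_ hC]]; exists (C + 1) => x Kx.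
by apply: (hC (C + 1)); [rewrite ltrDl|exists x].
Qed.

(** * Integrals against charges *)

Section cint_lemmas.
Context d (T : measurableType d) (R : realType).
Implicit Types (nu : {charge set T -> \bar R}) (mu : {finite_measure set T -> \bar R}).

Lemma bounded_integrable (m : {measure set T -> \bar R}) (D : set T) (g : T -> R) (C : R) :
  (m setT < +oo)%E -> measurable D -> measurable_fun D g ->
  (forall x, D x -> `|g x| <= C) -> m.-integrable D (EFin \o g).
Proof.
move=> mfin mD mg gC; apply: measurable_bounded_integrable => //.
  by apply: le_lt_trans mfin; apply: le_measure; rewrite ?inE.
exists C; split => [|x Cx y Dy]; first exact: num_real.
by rewrite /= (le_trans (gC y Dy))// ltW.
Qed.

Lemma charge_jordan nu B : measurable B ->
  nu B = (jordan_pos (hahn_cid nu) B - jordan_neg (hahn_cid nu) B)%E.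
Proof.
move=> mB; have := jordan_decomp (hahn_cid nu) mB; rewrite /cadd cscaleN1 => e.
transitivity (jordan_pos (hahn_cid nu) B + - jordan_neg (hahn_cid nu) B)%E; last by [].
rewrite [LHS]e; congr (_ + _)%E.
transitivity ((-1)%:E * jordan_neg (hahn_cid nu) B)%E; first by [].
by rewrite EFinN mulN1e.
Qed.

(** Equality of the differences means that [p + m2] and [m1 + n] are the same nonnegative measure;
    integrating [g] against it in both forms gives the claim. *)
Lemma Rintegral_measure_diff (m1 m2 p n : {measure set T -> \bar R})
    (D : set T) (g : T -> R) (C : R) :
  (m1 setT < +oo)%E -> (m2 setT < +oo)%E -> (p setT < +oo)%E -> (n setT < +oo)%E ->
  (forall B, measurable B -> m1 B - m2 B = p B - n B)%E ->
  measurable D -> measurable_fun D g -> (forall x, D x -> `|g x| <= C) ->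
  \int[p]_(x in D) g x - \int[n]_(x in D) g x =
  \int[m1]_(x in D) g x - \int[m2]_(x in D) g x.
Proof.
move=> m1f m2f pf nf mE mD mg gC.
have fin (m : {measure set T -> \bar R}) B : (m setT < +oo)%E -> measurable B -> m B \is a fin_num.
  move=> mf mB; rewrite ge0_fin_numE//; apply: le_lt_trans mf.
  by apply: le_measure; rewrite ?inE.
have gi (m : {measure set T -> \bar R}) : (m setT < +oo)%E -> m.-integrable D (EFin \o g).
  by move=> mf; exact: (bounded_integrable mf mD mg gC).
have : (\int[measure_add p m2]_(x in D) (g x)%:E =
       \int[measure_add m1 n]_(x in D) (g x)%:E)%E.
  apply: eq_measure_integral => B mB BD; transitivity (p B + m2 B)%E; first exact: measure_addE.
  transitivity (m1 B + n B)%E; last exact/esym/measure_addE.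
  have := mE _ mB.
  rewrite -(fineK (fin m1 _ m1f mB)) -(fineK (fin m2 _ m2f mB)).
  rewrite -(fineK (fin p _ pf mB)) -(fineK (fin n _ nf mB)).
  rewrite -!EFinB -!EFinD => -[h]; congr EFin; lra.
rewrite !integral_measure_add//; [|exact: gi..].
have fi (m : {measure set T -> \bar R}) : (m setT < +oo)%E ->
    (\int[m]_(x in D) (g x)%:E)%E = (\int[m]_(x in D) g x)%:E.
  by move=> mf; rewrite fineK//; apply: integrable_fin_num => //; exact: gi.
by rewrite !fi// -!EFinD => -[h]; lra.
Qed.

Lemma finite_measure_lty (m : {finite_measure set T -> \bar R}) : (m setT < +oo)%E.
Proof. by rewrite -ge0_fin_numE// fin_num_measure. Qed.

Lemma cint_decomp nu (m1 m2 : {measure set T -> \bar R}) (D : set T) (g : T -> R) (C : R) :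
  (m1 setT < +oo)%E -> (m2 setT < +oo)%E ->
  (forall B, measurable B -> nu B = m1 B - m2 B)%E ->
  measurable D -> measurable_fun D g -> (forall x, D x -> `|g x| <= C) ->
  cint nu D g = \int[m1]_(x in D) g x - \int[m2]_(x in D) g x.
Proof.
move=> m1f m2f nuE mD mg gC; apply: (@Rintegral_measure_diff _ _ _ _ D g C) => //.
- exact: (@finite_measure_lty (jordan_pos (hahn_cid nu))).
- exact: (@finite_measure_lty (jordan_neg (hahn_cid nu))).
- by move=> B mB; rewrite -nuE// charge_jordan.
Qed.

(** Both Jordan parts are dominated by [mu], so each has a derivative. The difference of the two
    derivatives has the same integrals as [h] and so equals it almost everywhere. *)
Lemma cint_density nu mu (h : T -> R) (D : set T) (g : T -> R) (C : R) :
  is_density nu mu h -> measurable D -> measurable_fun D g ->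
  (forall x, D x -> `|g x| <= C) ->
  cint nu D g = \int[mu]_(x in D) (g x * h x).
Proof.
move=> [hi nuE] mD mg gC; rewrite /cint.
have mh : measurable_fun setT (EFin \o h) by exact: measurable_int hi.
have numu : nu `<< mu.
  apply/null_content_dominatesP => B mB B0; rewrite nuE// null_set_integral//.
  exact: measurable_funTS.
have jpd := jordan_pos_dominates (hahn_cid nu) numu.
have jnd := jordan_neg_dominates (hahn_cid nu) numu.
pose jp : {finite_measure set T -> \bar R} := jordan_pos (hahn_cid nu).
pose jn : {finite_measure set T -> \bar R} := jordan_neg (hahn_cid nu).
have jpf := finite_measure_lty jp; have jnf := finite_measure_lty jn.
pose rp := Radon_Nikodym (charge_of_finite_measure jp) mu.
pose rn := Radon_Nikodym (charge_of_finite_measure jn) mu.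
have ip : mu.-integrable setT rp by exact: Radon_Nikodym_integrable.
have inn : mu.-integrable setT rn by exact: Radon_Nikodym_integrable.
rewrite /Rintegral.
rewrite -(Radon_Nikodym_change_of_variables jpd mD (bounded_integrable jpf mD mg gC)).
rewrite -(Radon_Nikodym_change_of_variables jnd mD (bounded_integrable jnf mD mg gC)).
rewrite -/rp -/rn.
have gb : [bounded g x | x in D].
  exists C; split => [|x Cx y Dy]; first exact: num_real.
  by rewrite /= (le_trans (gC y Dy))// ltW.
have gip : mu.-integrable D ((EFin \o g) \* rp)%E.
  by apply: integrableMr => //; exact: (integrableS measurableT).
have gin : mu.-integrable D ((EFin \o g) \* rn)%E.
  by apply: integrableMr => //; exact: (integrableS measurableT).
have gih : mu.-integrable D ((EFin \o g) \* (EFin \o h))%E.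
  by apply: integrableMr => //; exact: (integrableS measurableT).
have fp : (\int[mu]_(x in D) (((EFin \o g) x) * rp x) \is a fin_num)%E by exact: integrable_fin_num gip.
have fn : (\int[mu]_(x in D) (((EFin \o g) x) * rn x) \is a fin_num)%E by exact: integrable_fin_num gin.
rewrite -fineB//; congr fine.
rewrite -(integralB mD gip gin).
under [RHS]eq_integral do rewrite EFinM.
have aeq : ae_eq mu setT (rp \- rn)%E (EFin \o h).
  apply: integral_ae_eq => //; first exact: integrableB.
  move=> E _ mE; rewrite integralB//; [|exact: (integrableS measurableT)..].
  have -> : (\int[mu]_(x in E) rp x = jp E)%E by rewrite -Radon_Nikodym_integral.
  have -> : (\int[mu]_(x in E) rn x = jn E)%E by rewrite -Radon_Nikodym_integral.
  by rewrite -nuE// charge_jordan.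
apply: ae_eq_integral => //.
- exact: (measurable_int _ (integrableB mD gip gin)).
- exact: (measurable_int _ gih).
have rpf x : rp x \is a fin_num by exact: Radon_Nikodym_fin_num.
have rnf x : rn x \is a fin_num by exact: Radon_Nikodym_fin_num.
move: aeq; apply: filterS => x /(_ I) /= hx _.
by rewrite -hx muleBr// fin_num_adde_defr.
Qed.

End cint_lemmas.

(** The images of the Jordan parts of [nu] need not be the Jordan parts of the image, as they may
    overlap. They still form a decomposition into finite measures, which is enough for
    [cint_decomp]. *)
Lemma cint_pushcharge d1 d2 (T1 : measurableType d1) (T2 : measurableType d2) (R : realType)
    (nu : {charge set T1 -> \bar R}) (f : T1 -> T2) (D : set T2) (g : T2 -> R) (C : R) :
  measurable_fun setT f -> measurable D -> measurable_fun D g ->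
  (forall y, D y -> `|g y| <= C) ->
  cint (pushcharge nu f) D g = cint nu (f @^-1` D) (g \o f).
Proof.
move=> mf mD mg gC.
have mfD : measurable (f @^-1` D) by rewrite -[X in measurable X]setTI; exact: mf.
(* Extending [g] by 0 off [D] gives a function that is measurable and bounded everywhere, so that it
   can be composed with [f]. *)
pose g' y := if y \in D then g y else 0.
have mg' : measurable_fun setT g'.
  rewrite (_ : g' = g \_ D); first exact/(measurable_restrictT _ mD).
  by apply/funext => y; rewrite /g' /patch.
have g'C y : `|g' y| <= `|C|.
  rewrite /g'; case: ifPn => [|_]; last by rewrite normr0.
  by rewrite inE => Dy; rewrite (le_trans (gC y Dy))// ler_norm.
pose jp : {finite_measure set T1 -> \bar R} := jordan_pos (hahn_cid nu).
pose jn : {finite_measure set T1 -> \bar R} := jordan_neg (hahn_cid nu).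
have jpf : (jp setT < +oo)%E by exact: (@finite_measure_lty _ _ _ jp).
have jnf : (jn setT < +oo)%E by exact: (@finite_measure_lty _ _ _ jn).
pose m1 : {measure set T2 -> \bar R} :=
  measure_function_pushforward__canonical__measure_function_Measure jp mf.
pose m2 : {measure set T2 -> \bar R} :=
  measure_function_pushforward__canonical__measure_function_Measure jn mf.
have eg : cint (pushcharge nu f) D g = cint (pushcharge nu f) D g'.
  by rewrite /cint; congr (_ - _); apply: eq_Rintegral => y yD; rewrite /g' yD.
rewrite eg (@cint_decomp _ _ _ _ m1 m2 D g' `|C|)//.
- rewrite /cint -/jp -/jn.
  have pf (m : {measure set T1 -> \bar R}) : (m setT < +oo)%E ->
      \int[measure_function_pushforward__canonical__measure_function_Measure m mf]_(x in D) g' x =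
      \int[m]_(x in f @^-1` D) (g \o f) x.
    move=> mfin; rewrite /Rintegral integral_pushforward//.
    + congr fine; apply: eq_integral => x; rewrite inE => Dx /=.
      by rewrite /g' mem_set.
    + exact/measurable_EFinP.
    + apply: (@bounded_integrable _ _ _ m _ (g' \o f) `|C|) => //.
      by apply: measurable_funTS; exact: measurableT_comp.
      by move=> x _; exact: g'C.
  by rewrite -!pf.
- move=> B mB; rewrite /pushcharge; case: pselect => // mf'.
  have mfB : measurable (f @^-1` B) by rewrite -[X in measurable X]setTI; exact: (mf measurableT _ mB).
  by rewrite /= /pushforward charge_jordan.
- exact: measurable_funTS.
Qed.

(** * Convex integral functionals *)

Section limn_einf_ge0.
Context (R : realType).
Implicit Types f g : nat -> \bar R.
Local Open Scope ereal_scope.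

Lemma einfs_le f n m : (n <= m)%N -> einfs f n <= f m.
Proof. by move=> nm; apply: ereal_inf_lbound; exists m. Qed.

Lemma einfs_ge0 f n : (forall k, 0 <= f k) -> 0 <= einfs f n.
Proof. by move=> f0; apply: le_ereal_inf_tmp => _ [k _ <-]. Qed.

Lemma limn_einf_ge0 f : (forall k, 0 <= f k) -> 0 <= limn_einf f.
Proof.
move=> f0; rewrite limn_einf_lim; apply: lime_ge; first exact: is_cvg_einfs.
by apply: nearW => n; exact: einfs_ge0.
Qed.

Lemma limn_einfD f g : (forall k, 0 <= f k) -> (forall k, 0 <= g k) ->
  limn_einf f + limn_einf g <= limn_einf (f \+ g).
Proof.
move=> f0 g0; have Lf := limn_einf_ge0 f0; have Lg := limn_einf_ge0 g0.
rewrite [X in _ <= X]limn_einf_lim !(limn_einf_lim f, limn_einf_lim g).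
rewrite limn_einf_lim in Lf; rewrite limn_einf_lim in Lg.
rewrite -limeD; [|exact: is_cvg_einfs|exact: is_cvg_einfs|exact: ge0_adde_def].
apply: lee_lim; [|exact: is_cvg_einfs|].
  by apply: is_cvgeD; [exact: ge0_adde_def|exact: is_cvg_einfs|exact: is_cvg_einfs].
apply: nearW => n; apply: le_ereal_inf_tmp => _ [k nk <-].
by apply: leeD; exact: einfs_le.
Qed.

Lemma limn_einfZ (k : R) f : (0 <= k)%R -> (forall n, 0 <= f n) ->
  k%:E * limn_einf f <= limn_einf (fun n => k%:E * f n).
Proof.
move=> k0 f0; rewrite !limn_einf_lim.
have cv : (k%:E * einfs f n) @[n --> \oo] --> k%:E * limn (einfs f).
  by apply: cvgeZl => //; exact: is_cvg_einfs.
rewrite -(cvg_lim (@ereal_hausdorff R) cv).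
apply: lee_lim; [by apply/cvg_ex; eexists; exact: cv|exact: is_cvg_einfs|].
apply: nearW => n; apply: le_ereal_inf_tmp => _ [m nm <-].
by rewrite lee_wpmul2l// einfs_le.
Qed.

End limn_einf_ge0.

Section convex_integrands.
Context (R : realType) (I : Type).
Implicit Types (A : set I) (L : (I -> R) -> \bar R).

(** The set [A] lists the components on which [L] really depends. A component converges only almost
    everywhere for its own reference measure, so nothing may be asked of the others. *)
Record convex_integrand A L : Prop := {
  integrand_ge0 : forall a, (0 <= L a)%E;
  integrand_mid : forall a b,
    (L (fun i => 2^-1 * (a i + b i))%R <= 2^-1%:E * (L a + L b))%E;
  integrand_lsc : forall (an : nat -> I -> R) a,
    (forall i, A i -> an ^~ i @ \oo --> a i) -> (L a <= limn_einf (L \o an))%E;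
  integrand_measurable : forall d (Z : measurableType d) (u : I -> Z -> R),
    (forall i, A i -> measurable_fun setT (u i)) ->
    measurable_fun setT (fun z => L (fun i => u i z))
}.

Lemma convex_integrandD A L1 L2 : convex_integrand A L1 -> convex_integrand A L2 ->
  convex_integrand A (fun a => L1 a + L2 a)%E.
Proof.
move=> [p1 m1 l1 b1] [p2 m2 l2 b2]; split.
- by move=> a; exact: adde_ge0.
- move=> a b; apply: (le_trans (leeD (m1 a b) (m2 a b))).
  by rewrite -ge0_muleDr ?adde_ge0// addeACA.
- move=> an a cv; apply: (le_trans (leeD (l1 _ _ cv) (l2 _ _ cv))).
  by apply: limn_einfD => n /=.
- by move=> d Z u mu; apply: emeasurable_funD; [exact: b1|exact: b2].
Qed.

Lemma convex_integrandZ A L (k : R) : 0 <= k -> convex_integrand A L ->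
  convex_integrand A (fun a => k%:E * L a)%E.
Proof.
move=> k0 [p m l b]; split.
- by move=> a; rewrite mule_ge0.
- move=> x y; apply: (@le_trans _ _ (k%:E * (2^-1%:E * (L x + L y)))%E).
    by rewrite lee_wpmul2l.
  by rewrite muleCA ge0_muleDr.
- move=> an a cv; apply: (@le_trans _ _ (k%:E * limn_einf (L \o an))%E).
    by rewrite lee_wpmul2l// l.
  by apply: limn_einfZ => // n /=.
- by move=> d Z u mu; apply: measurable_funeM; exact: b.
Qed.

Lemma convex_integrand_Psi A (m : R -> \bar R) a b N (k : I) (w : 'I_N -> I) :
  (0 < N)%N -> admissible_mobility m a b -> A k -> (forall j, A (w j)) ->
  convex_integrand A (fun x => Psi m (x k) (\row_j x (w j))).
Proof.
move=> N0 adm Ak Aw; split.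
- by move=> x; exact: (Psi_ge0 adm).
- move=> x y; have -> : \row_j (2^-1 * (x (w j) + y (w j))) =
      2^-1 *: (\row_j x (w j) + \row_j y (w j)).
    by apply/rowP => j; rewrite !mxE.
  exact: (Psi_midpoint_convex adm).
- move=> xn x cv; apply: (Psi_lower_semicontinuous adm N0); first exact: cv.
  by move=> j; rewrite mxE; under eq_fun do rewrite mxE; exact: cv.
- move=> d Z u mu; apply: (measurable_Psi adm); first exact: mu.
  by move=> j; under eq_fun do rewrite mxE; exact: mu.
Qed.

Lemma convex_integrand_Psi1 A (m : R -> \bar R) a b (k w : I) :
  admissible_mobility m a b -> A k -> A w ->
  convex_integrand A (fun x => Psi1 m (x k) (x w)).
Proof.
move=> adm Ak Aw.
have := @convex_integrand_Psi A m a b 1%N k (fun=> w) isT adm Ak (fun=> Aw).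
congr convex_integrand; apply/funext => x; rewrite /Psi1; congr Psi.
by apply/rowP => j; rewrite !mxE.
Qed.

Section integral.
Context d (Z : measurableType d) (M : {measure set Z -> \bar R}).
Variables (A : set I) (L : (I -> R) -> \bar R).
Hypothesis L_ok : convex_integrand A L.
Implicit Types u v : I -> Z -> R.

Definition integral_functional u : \bar R := (\int[M]_z L (fun i => u i z))%E.

Lemma integral_functional_ge0 u : (0 <= integral_functional u)%E.
Proof. by apply: integral_ge0 => z _; exact: (integrand_ge0 L_ok). Qed.

Lemma integral_functional_mid u v :
  (forall i, measurable_fun setT (u i)) -> (forall i, measurable_fun setT (v i)) ->
  (integral_functional (mid u v) <=
   2^-1%:E * (integral_functional u + integral_functional v))%E.
Proof.
move=> mu mv; have [L0 Lm _ Lb] := L_ok.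
rewrite /integral_functional -ge0_integralD//; [|exact: Lb|exact: Lb].
rewrite -ge0_integralZl//; first last.
- by move=> z _; exact: adde_ge0.
- by apply: emeasurable_funD; exact: Lb.
apply: ge0_le_integral => //.
- by apply: Lb => i _; apply: measurable_funM => //; exact: measurable_funD.
- by apply: measurable_funeM; apply: emeasurable_funD; exact: Lb.
- by move=> z _; exact: Lm.
Qed.

(** Pointwise lower semicontinuity of [L] under the integral, followed by Fatou. *)
Lemma integral_functional_lsc (un : nat -> I -> Z -> R) u :
  (forall n i, measurable_fun setT (un n i)) -> (forall i, measurable_fun setT (u i)) ->
  {ae M, forall z i, A i -> un ^~ i ^~ z @ \oo --> u i z} ->
  (integral_functional u <= limn_einf (integral_functional \o un))%E.
Proof.
move=> mun mu cv; have [L0 _ Ll Lb] := L_ok.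
have mL n : measurable_fun setT (fun z => L (fun i => un n i z)) by exact: Lb.
apply: le_trans (fatou M measurableT mL (fun n z _ => L0 _)).
apply: ae_ge0_le_integral => //.
- exact: Lb.
- by move=> z _; apply: limn_einf_ge0 => k; exact: L0.
- rewrite (_ : (fun x => _) = (fun z => - limn_esup (fun n => - L (fun i => un n i z)))%E)//.
  apply: measurableT_comp => //; apply: measurable_fun_limn_esup => n.
  exact: measurableT_comp.
- by move: cv; apply: filterS => z cz _; apply: (Ll (fun n i => un n i z)) => i Ai; exact: cz.
Qed.

End integral.

End convex_integrands.

(** * Integration in time *)

Section time_measure.
Context (R : realType).
Local Notation Time := (measurableTypeR R).

Lemma measurable_Icc01 : measurable (@Icc01 R : set Time).
Proof. exact: measurable_itv. Qed.

Lemma lebesgue_Icc01_lty : (@lebesgue_measure R Icc01 < +oo)%E.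
Proof. by rewrite /Icc01 lebesgue_measure_itv/= lte_fin ltr01 -EFinB ltry. Qed.

(** A finite measure on the whole line that ignores times outside [[0,1]]: densities can then be
    functions on a full product space. *)
Definition time_measure : {finite_measure set Time -> \bar R} :=
  mfrestr measurable_Icc01 lebesgue_Icc01_lty.

Lemma time_measureE (B : set Time) : time_measure B = lebesgue_measure (B `&` Icc01).
Proof. by []. Qed.

Lemma time_measureC : time_measure (~` Icc01) = 0%E.
Proof. by rewrite time_measureE setICl measure0. Qed.

Lemma integral_time_measure_Icc01 (f : Time -> \bar R) :
  (\int[time_measure]_(t in Icc01) f t = \int[lebesgue_measure]_(t in Icc01) f t)%E.
Proof.
by apply: eq_measure_integral => B mB BI; have := time_measureE B; rewrite (setIidl BI).
Qed.

Lemma integrable_time_measure_Icc01 (f : Time -> \bar R) :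
  time_measure.-integrable Icc01 f <-> lebesgue_measure.-integrable Icc01 f.
Proof.
by split => /integrableP[mf fi]; apply/integrableP; split => //; move: fi;
  rewrite integral_time_measure_Icc01.
Qed.

Lemma ge0_integral_time_measure (f : Time -> \bar R) :
  measurable_fun setT f -> (forall t, 0 <= f t)%E ->
  (\int[time_measure]_t f t = \int[lebesgue_measure]_(t in Icc01) f t)%E.
Proof.
move=> mf f0; rewrite -integral_time_measure_Icc01.
have mC := measurableC measurable_Icc01.
rewrite (ge0_negligible_integral mC _ mf)//; last exact: time_measureC.
by rewrite setDE setCK setTI.
Qed.

Lemma integral_time_measure (f : Time -> \bar R) :
  time_measure.-integrable setT f ->
  (\int[time_measure]_t f t = \int[lebesgue_measure]_(t in Icc01) f t)%E.
Proof.
move=> fi; rewrite -integral_time_measure_Icc01.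
have mC := measurableC measurable_Icc01.
rewrite (negligible_integral mC measurableT fi time_measureC).
by rewrite setDE setCK setTI.
Qed.

End time_measure.

(** * Pairing space-time densities with test functions *)

Section pairing.
Context (R : realType) d (T : measurableType d) (lam : {finite_measure set T -> \bar R}).
Local Notation Time := (measurableTypeR R).

Definition space_time : {measure set (Time * T) -> \bar R} := (time_measure R \x lam)%E.

Lemma space_time_lty : (space_time setT < +oo)%E.
Proof.
rewrite -setXTT [X in (X < _)%E]product_measure1E// lte_mul_pinfty//.
- by rewrite fin_num_measure.
- exact: finite_measure_lty.
Qed.

(** The cut-off turns integrals over [[0,1] x D] into integrals over the full product, and makes
    bounded a test function known to be bounded on the slab only. *)
Definition on_slab (D : set T) (g : Time * T -> R) : Time * T -> R :=
  fun z => \1_(Icc01 `*` D) z * g z.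

Lemma measurable_on_slab D g : measurable D -> measurable_fun setT g ->
  measurable_fun setT (on_slab D g).
Proof.
move=> mD mg; apply: measurable_funM => //; apply: measurable_indic.
by apply: measurableX => //; exact: measurable_Icc01.
Qed.

Lemma on_slab_bounded D g C : (forall t p, Icc01 t -> D p -> `|g (t, p)| <= C) ->
  forall z, `|on_slab D g z| <= `|C|.
Proof.
move=> gC [t p]; rewrite /on_slab indicE; case: (boolP (_ \in _)) => [|_].
  by rewrite inE => -[/= t01 Dp]; rewrite mul1r (le_trans (gC _ _ t01 Dp))// ler_norm.
by rewrite mul0r normr0.
Qed.

Lemma Rintegral_on_slab D (g u : Time * T -> R) t : Icc01 t ->
  \int[lam]_p (on_slab D g (t, p) * u (t, p)) = \int[lam]_(p in D) (g (t, p) * u (t, p)).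
Proof.
move=> t01; rewrite [RHS]Rintegral_mkcond; apply: eq_Rintegral => p _.
rewrite /on_slab indicE /patch; case: (boolP (p \in D)) => pD.
  by rewrite mem_set ?mul1r//; split => //; rewrite inE in pD.
by rewrite memNset ?mul0r// => -[_ /= Dp]; rewrite notin_setE in pD.
Qed.

Variable u : Time * T -> R.
Hypothesis u_int : space_time.-integrable setT (EFin \o u).
Hypothesis u_slice : forall t, lam.-integrable setT (fun p => (u (t, p))%:E).

(** Fubini. Since the slices of [u] are integrable at every time, [c] coincides with the inner
    integral at every time, which makes it measurable as it stands. *)
Lemma pairing_time (phi : Time * T -> R) (C : R) :
  measurable_fun setT phi -> (forall z, `|phi z| <= C) ->
  let c t := \int[lam]_p (phi (t, p) * u (t, p)) in
  measurable_fun setT c /\ tintegrable c /\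
  tint c = \int[space_time]_z (phi z * u z).
Proof.
move=> mphi phiC c.
have pi : space_time.-integrable setT (EFin \o (fun z => phi z * u z)).
  exact: (integrable_bounded_mul _ mphi (fun z _ => phiC z)).
have sl t : lam.-integrable setT (EFin \o (fun p => phi (t, p) * u (t, p))).
  apply: (@integrable_bounded_mul _ _ _ lam _ (fun p => phi (t, p)) (fun p => u (t, p)) C) => //.
    exact: (measurableT_comp mphi (measurable_pair1 t)).
  exact: u_slice.
have cE s : (c s)%:E = fubini_F lam (EFin \o (fun z => phi z * u z)) s.
  by rewrite /fubini_F /c /Rintegral fineK//; apply: integrable_fin_num => //; exact: sl.
have cE' : EFin \o c = fubini_F lam (EFin \o (fun z => phi z * u z)) by apply/funext => x; exact: cE.
have ci : (time_measure R).-integrable setT (EFin \o c).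
  by rewrite cE'; exact: integrable_fubini_F.
split; first by apply/measurable_EFinP; exact: measurable_int ci.
split.
  apply/integrable_time_measure_Icc01; apply: integrableS ci => //; exact: measurable_Icc01.
rewrite /tint /Rintegral -(integral_time_measure ci) -integral12_prod_meas1//.
by congr fine; apply: eq_integral => t _; exact: cE.
Qed.

Lemma cint_slab (nu : {charge set T -> \bar R}) (D : set T) (g : Time * T -> R) (C : R) t :
  Icc01 t -> is_density nu lam (fun p => u (t, p)) ->
  measurable D -> measurable_fun setT g -> (forall p, D p -> `|g (t, p)| <= C) ->
  cint nu D (fun p => g (t, p)) = \int[lam]_p (on_slab D g (t, p) * u (t, p)).
Proof.
move=> t01 nud mD mg gC; rewrite (cint_density nud mD _ gC); last first.
  by apply: measurable_funTS; exact: (measurableT_comp mg (measurable_pair1 t)).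
exact: (esym (Rintegral_on_slab D g u t01)).
Qed.

End pairing.

Section tint_lemmas.
Context (R : realType).
Implicit Types c : R -> R.

Lemma tint_ae (E : set (measurableTypeR R)) c c' :
  measurable E -> lebesgue_measure (Icc01 `\` E) = 0%E ->
  tintegrable c -> tintegrable c' ->
  (forall t, Icc01 t -> E t -> c t = c' t) -> tint c = tint c'.
Proof.
move=> mE E0 ic ic' cE; rewrite /tint /Rintegral; congr fine; apply: ae_eq_integral.
- exact: measurable_Icc01.
- exact: measurable_int ic.
- exact: measurable_int ic'.
exists (Icc01 `\` E); split => //; first by apply: measurableD => //; exact: measurable_Icc01.
move=> t /= h; have t01 : Icc01 t by apply: contrapT => nt; apply: h => /nt.
by split => // Et; apply: h => _; congr EFin; exact: cE.
Qed.

Lemma eq_tint c c' : (forall t, Icc01 t -> c t = c' t) ->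
  tintegrable c' -> tintegrable c /\ tint c = tint c'.
Proof.
move=> cE ic'; split; last by apply: eq_Rintegral => t; rewrite inE => /cE.
apply: eq_integrable ic'; first exact: measurable_Icc01.
by move=> t; rewrite inE => t01 /=; congr EFin; rewrite cE.
Qed.

Lemma tint_sum (K : Type) (s : seq K) (c : K -> R -> R) :
  (forall k, tintegrable (c k)) ->
  tintegrable (fun t => \sum_(k <- s) c k t) /\
  tint (fun t => \sum_(k <- s) c k t) = \sum_(k <- s) tint (c k).
Proof.
move=> ic; elim: s => [|k s [is_ IH]].
  rewrite /tintegrable /tint; split.
    by rewrite (_ : _ \o _ = cst 0%E); [exact: integrable0|apply/funext => t /=; rewrite big_nil].
  by rewrite big_nil; under eq_Rintegral do rewrite big_nil;
      rewrite Rintegral_cst ?mul0r//; exact: measurable_Icc01.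
have e : (fun t => \sum_(j <- k :: s) c j t) = (fun t => c k t + \sum_(j <- s) c j t).
  by apply/funext => t; rewrite big_cons.
rewrite e big_cons -IH.
have i1 : lebesgue_measure.-integrable Icc01 (EFin \o c k) by exact: ic.
have i2 : lebesgue_measure.-integrable Icc01 (EFin \o (fun t => \sum_(j <- s) c j t)) by [].
split; first exact: (integrableD (@measurable_Icc01 R) i1 i2).
exact: (RintegralD (@measurable_Icc01 R) i1 i2).
Qed.

End tint_lemmas.

(** * The curve *)

Section curve_facts.
Context (R : realType) (d : nat) (gamma : R -> 'rV[R]_d).

(** Close to [s] the difference quotient is bounded by [|v| + 1], where [v] is its limit, so the
    increment of [gamma] is at most [|x - s| (|v| + 1)]. *)
Lemma C1_curve_continuous : C1_curve gamma -> {within Icc01, continuous gamma}.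
Proof.
move=> [cg _]; apply/subspace_continuousP => s s01.
have /cvg_ex[v dqv] := cg s s01.
have /cvgrPdist_lt/(_ 1 ltr01) := dqv.
rewrite /increments !near_withinE => h1.
apply/cvgrPdist_lt => e e0; rewrite near_withinE.
have v1 : 0 < `|v| + 1 by rewrite ltr_wpDl.
have [a /= a0 ha] := h1.
exists (Num.min a (e / (`|v| + 1))) => /=; first by rewrite lt_min a0 divr_gt0.
move=> x /=; rewrite lt_min => /andP[xa xe] x01.
have [->|xs] := eqVneq x s; first by rewrite subrr normr0.
have xsh : `|v - diff_quotient gamma s (x - s)| < 1.
  apply: (ha (x - s)).
  - by rewrite /= sub0r normrN distrC.
  - by rewrite subr_eq0.
  - by rewrite /= (_ : s + (x - s) = x)// addrC subrK.
have gE : gamma x - gamma s = (x - s) *: diff_quotient gamma s (x - s).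
  have e1 : s + (x - s) = x by rewrite addrC subrK.
  by rewrite /diff_quotient e1 scalerA divff ?scale1r// subr_eq0.
rewrite distrC gE normrZ (@le_lt_trans _ _ (`|x - s| * (`|v| + 1)))//.
  rewrite ler_wpM2l// -[X in `|X|](subKr v); apply: (le_trans (ler_normB _ _)).
  by rewrite lerD2l ltW.
by rewrite distrC -ltr_pdivlMr.
Qed.

Hypothesis gamma_cont : {within Icc01, continuous gamma}.
Hypothesis gamma_inj : non_self_intersecting gamma.

Lemma trace_compact : compact (trace gamma).
Proof. by apply: continuous_compact => //; exact: segment_compact. Qed.

Lemma measurable_trace : measurable (trace gamma : set (Rd R d)).
Proof. by apply: compact_measurable_Rd; exact: trace_compact. Qed.

Lemma param_inv_gamma s : Icc01 s -> param_inv gamma (gamma s) = s.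
Proof.
move=> s01; rewrite /param_inv pinvKV ?inE//.
by move=> x y; rewrite !inE; exact: gamma_inj.
Qed.

Lemma param_inv_Icc01 p : Icc01 (param_inv gamma p).
Proof.
have [[s s01 <-]|np] := pselect (trace gamma p); first by rewrite param_inv_gamma.
(* Off the trace [param_inv] has the default value 0, which still lies in [[0,1]]. Functions defined
   on [[0,1]] can thus be composed with it on all of space. *)
have -> : param_inv gamma p = 0.
  by rewrite /param_inv /pinv_ splitV oinv_surj; case: pselect.
by rewrite /Icc01 /= in_itv/= lexx ler01.
Qed.

Lemma measurable_param_inv_comp (f : R -> R) : {within Icc01, continuous f} ->
  measurable_fun setT (fun p : Rd R d => f (param_inv gamma p)).
Proof.
move=> cf; have mI : measurable (@Icc01 R) by exact: measurable_itv.
have mf : measurable_fun setT (f \_ Icc01).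
  by apply/(measurable_restrictT _ mI); exact: subspace_continuous_measurable_fun.
have -> : (fun p : Rd R d => f (param_inv gamma p)) = (f \_ Icc01) \o param_inv gamma.
  by apply/funext => p /=; rewrite /patch mem_set//; exact: param_inv_Icc01.
by apply: measurableT_comp => //; exact: measurable_param_inv.
Qed.

Hypothesis speed_cont : {within Icc01, continuous (speed gamma)}.
Hypothesis gamma_regular : regular gamma.

Lemma inv_speed_continuous : {within Icc01, continuous (fun s => (enorm (speed gamma s))^-1)}.
Proof.
apply/subspace_continuousP => s s01.
have /subspace_continuousP/(_ s s01) sc := speed_cont.
apply: cvgV; first exact: gamma_regular.
rewrite /enorm; apply: (@cvg_comp _ _ _ (fun s => \sum_(i < d) speed gamma s ord0 i ^+ 2) Num.sqrt); last exact: sqrt_continuous.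
apply: (cvg_big (@add_continuous R^o)) => i _.
have cc : speed gamma x ord0 i @[x --> within Icc01 (nbhs s)] --> speed gamma s ord0 i.
  by apply: (@cvg_comp _ _ _ (speed gamma) (fun M : 'rV[R]_d => M ord0 i)); [exact: sc|exact: coord_continuous].
by apply: cvgM.
Qed.

Lemma measurable_unit_tangent i :
  measurable_fun setT (fun p : Rd R d => unit_tangent gamma p ord0 i).
Proof.
under eq_fun do rewrite /unit_tangent mxE.
apply: (@measurable_param_inv_comp (fun s => (enorm (speed gamma s))^-1 * speed gamma s ord0 i)).
apply/subspace_continuousP => s s01.
have /subspace_continuousP/(_ s s01) sc := speed_cont.
have /subspace_continuousP/(_ s s01) ic := inv_speed_continuous.
apply: cvgM => //.
by apply: (@cvg_comp _ _ _ (speed gamma) (fun M : 'rV[R]_d => M ord0 i)); [exact: sc|exact: coord_continuous].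
Qed.

Lemma unit_tangent_le1 p i : `|unit_tangent gamma p ord0 i| <= 1.
Proof.
rewrite /unit_tangent mxE; set v := speed gamma _.
have v0 : 0 < enorm v.
  by rewrite lt_neqAle eq_sym gamma_regular ?sqrtr_ge0//; exact: param_inv_Icc01.
rewrite normrM normfV (ger0_norm (ltW v0)) mulrC ler_pdivrMr// mul1r.
rewrite -(@ler_pXn2r _ 2)// ?nnegrE ?(ltW v0)// enorm_sqr real_normK ?num_real//.
by rewrite (bigD1 i)//= lerDl sumr_ge0// => j _; exact: sqr_ge0.
Qed.

(** In dimension 0 the curve would be constant, against injectivity. Positivity matters for the flux
    term: with no component of [w] there is no [p <> 0], and the minorants cannot reach the value
    [+oo] of [Psi] off the domain. *)
Lemma curve_dim_gt0 : (0 < d)%N.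
Proof.
rewrite lt0n; apply/eqP => d0.
have g01 : gamma 0 = gamma 1 by apply/rowP => i; have := ltn_ord i; rewrite {2}d0.
have /eqP : 0 = 1 :> R.
  by apply: gamma_inj g01; rewrite in_itv/= ?lexx ?ler01.
by rewrite eq_sym oner_eq0.
Qed.

End curve_facts.

(** * The action as a functional of densities *)

(* The scalar densities in which a flow is encoded: [fldMu0], [fldMu1] are those
   of the restrictions of [mu_t] to the end points, relative to [lambda_E]. *)
Inductive field (d : nat) : Type :=
  | fldJ of 'I_d | fldRho | fldMu | fldV | fldF
  | fldMu0 | fldG0 | fldMu1 | fldG1.
Arguments fldRho {d}. Arguments fldMu {d}. Arguments fldV {d}. Arguments fldF {d}.
Arguments fldMu0 {d}. Arguments fldG0 {d}. Arguments fldMu1 {d}. Arguments fldG1 {d}.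

Section field_finType.
Variable d : nat.

Definition field_code (i : field d) : 'I_d + 'I_8 :=
  match i with
  | fldJ k => inl k | fldRho => inr (inord 0) | fldMu => inr (inord 1)
  | fldV => inr (inord 2) | fldF => inr (inord 3) | fldMu0 => inr (inord 4)
  | fldG0 => inr (inord 5) | fldMu1 => inr (inord 6) | fldG1 => inr (inord 7)
  end.

Definition field_decode (c : 'I_d + 'I_8) : field d :=
  match c with
  | inl k => fldJ k
  | inr n => nth fldRho [:: fldRho; fldMu; fldV; fldF; fldMu0; fldG0; fldMu1; fldG1] n
  end.

Lemma field_codeK : cancel field_code field_decode.
Proof. by case=> [k||||||||] //=; rewrite inordK. Qed.

HB.instance Definition _ := Finite.copy (field d) (can_type field_codeK).

Lemma sum_field (R : nmodType) (F : field d -> R) :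
  \sum_i F i = \sum_(k < d) F (fldJ k) + (F fldRho + (F fldMu + (F fldV + (F fldF +
    (F fldMu0 + (F fldG0 + (F fldMu1 + F fldG1))))))).
Proof.
have fdK : cancel field_decode field_code.
  case=> [k|[n n8]] //=.
  do 8 (case: n n8 => [|n] n8; first by congr inr; apply: val_inj; rewrite /= inordK).
  by [].
rewrite (reindex field_decode)/=; last by exists field_code => i _; [exact: fdK|exact: field_codeK].
by rewrite big_sumType/= !big_ord_recl big_ord0/= addr0.
Qed.

End field_finType.

Section density_action.
Context (R : realType) (d : nat).
Variables (mO mG : R -> \bar R) (aO bO aG bG alpha1 alpha2 alpha3 : R).
Hypothesis mO_adm : admissible_mobility mO aO bO.
Hypothesis mG_adm : admissible_mobility mG aG bG.
Hypothesis alpha1_gt0 : 0 < alpha1.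
Hypothesis alpha2_gt0 : 0 < alpha2.
Hypothesis alpha3_gt0 : 0 < alpha3.
Hypothesis d_gt0 : (0 < d)%N.
Variables lamO lamG lamE : {finite_measure set (Rd R d) -> \bar R}.
Local Notation Time := (measurableTypeR R).
Local Notation Z := (Time * Rd R d)%type.
Implicit Types (a : field d -> R) (u v : field d -> Z -> R).

Definition reference (i : field d) : {finite_measure set (Rd R d) -> \bar R} :=
  match i with
  | fldJ _ | fldRho => lamO
  | fldMu | fldV | fldF => lamG
  | fldMu0 | fldG0 | fldMu1 | fldG1 => lamE
  end.

Definition is_bulk_field (i : field d) := match i with fldJ _ | fldRho => True | _ => False end.
Definition is_curve_field (i : field d) := match i with fldMu | fldV | fldF => True | _ => False end.
Definition is_endpoint_field (i : field d) :=
  match i with fldMu0 | fldG0 | fldMu1 | fldG1 => True | _ => False end.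

Definition integrandO a : \bar R := Psi mO (a fldRho) (\row_k a (fldJ k)).

Definition integrandG a : \bar R :=
  (alpha1%:E * Psi1 mG (a fldMu) (a fldV) + alpha2%:E * Psi1 mG (a fldMu) (a fldF))%E.

Definition integrandE a : \bar R :=
  (alpha3%:E * (Psi1 mG (a fldMu0) (a fldG0) + Psi1 mG (a fldMu1) (a fldG1)))%E.

Lemma convex_integrandO : convex_integrand is_bulk_field integrandO.
Proof. by apply: convex_integrand_Psi; [exact: d_gt0|exact: mO_adm| |]. Qed.

Lemma convex_integrandG : convex_integrand is_curve_field integrandG.
Proof.
by apply: convex_integrandD; apply: convex_integrandZ; rewrite ?ltW//;
  apply: (convex_integrand_Psi1 mG_adm).
Qed.

Lemma convex_integrandE : convex_integrand is_endpoint_field integrandE.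
Proof.
apply: convex_integrandZ; first exact: ltW.
by apply: convex_integrandD; apply: (convex_integrand_Psi1 mG_adm).
Qed.

Definition density_action u : \bar R :=
  (integral_functional (space_time lamO) integrandO u +
   (integral_functional (space_time lamG) integrandG u +
    integral_functional (space_time lamE) integrandE u))%E.

Lemma density_action_ge0 u : (0 <= density_action u)%E.
Proof.
have pO := integral_functional_ge0 (space_time lamO) convex_integrandO u.
have pG := integral_functional_ge0 (space_time lamG) convex_integrandG u.
have pE := integral_functional_ge0 (space_time lamE) convex_integrandE u.
by apply: adde_ge0 => //; exact: adde_ge0.
Qed.

Lemma density_action_mid u v :
  (forall i, measurable_fun setT (u i)) -> (forall i, measurable_fun setT (v i)) ->
  forall c : R, (density_action u <= c%:E)%E -> (density_action v <= c%:E)%E ->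
  (density_action (mid u v) <= c%:E)%E.
Proof.
move=> mu mv c uc vc.
have cO := convex_integrandO; have cG := convex_integrandG; have cE := convex_integrandE.
apply: (@le_trans _ _ (2^-1%:E * (density_action u + density_action v))%E); last first.
  apply: (@le_trans _ _ (2^-1%:E * (c%:E + c%:E))%E); first by rewrite lee_wpmul2l// leeD.
  by rewrite -EFinD -EFinM lee_fin; lra.
have pO w := integral_functional_ge0 (space_time lamO) cO w.
have pG w := integral_functional_ge0 (space_time lamG) cG w.
have pE w := integral_functional_ge0 (space_time lamE) cE w.
rewrite /density_action.
apply: le_trans (leeD (integral_functional_mid (space_time lamO) cO mu mv)
  (leeD (integral_functional_mid (space_time lamG) cG mu mv)
        (integral_functional_mid (space_time lamE) cE mu mv))) _.
move: (pO u) (pO v) (pG u) (pG v) (pE u) (pE v).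
move: (integral_functional _ _ u) (integral_functional _ _ v)
  (integral_functional _ integrandG u) (integral_functional _ integrandG v)
  (integral_functional _ integrandE u) (integral_functional _ integrandE v).
move=> x1 x2 y1 y2 z1 z2 ? ? ? ? ? ?.
have h y : (0 <= y)%E -> (0 <= 2^-1%:E * y)%E by move=> y0; rewrite mule_ge0.
rewrite -(@ge0_muleDr _ _ (y1 + y2) (z1 + z2))%E ?adde_ge0//.
rewrite -(@ge0_muleDr _ _ (x1 + x2)%E)%E ?adde_ge0//.
by rewrite (addeACA y1) (addeACA x1).
Qed.

(** Each of the three integrands depends only on the fields sharing one reference measure, so the
    almost everywhere convergences of these finitely many fields combine for that measure. *)
Lemma density_action_lsc (un : nat -> field d -> Z -> R) u :
  (forall n i, measurable_fun setT (un n i)) -> (forall i, measurable_fun setT (u i)) ->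
  (forall i, {ae space_time (reference i), forall z, un ^~ i ^~ z @ \oo --> u i z}) ->
  (density_action u <= limn_einf (density_action \o un))%E.
Proof.
move=> mun mu cv.
have cO := convex_integrandO; have cG := convex_integrandG; have cE := convex_integrandE.
have ae_in (A : set (field d)) lam : (forall i, A i -> reference i = lam) ->
    {ae space_time lam, forall z i, A i -> un ^~ i ^~ z @ \oo --> u i z}.
  move=> Alam; apply: filter_forall => i.
  have [Ai|nAi] := pselect (A i); last by apply: aeW => z /nAi.
  by have := cv i; rewrite (Alam i Ai); apply: filterS.
have pO w := integral_functional_ge0 (space_time lamO) cO w.
have pG w := integral_functional_ge0 (space_time lamG) cG w.
have pE w := integral_functional_ge0 (space_time lamE) cE w.
apply: le_trans (leeD _ (leeD _ _)) _.
- by apply: (integral_functional_lsc cO mun mu); apply: ae_in; case.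
- by apply: (integral_functional_lsc cG mun mu); apply: ae_in; case.
- by apply: (integral_functional_lsc cE mun mu); apply: ae_in; case.
apply: le_trans (leeD (lexx _) (limn_einfD _ _)) _ => //=.
by apply: limn_einfD => n //=; rewrite adde_ge0.
Qed.

Let integral_sqr_le (lam : {finite_measure set (Rd R d) -> \bar R}) A L
    (cL : convex_integrand A L) (C : R) (i : field d) u : 0 <= C ->
  (forall j, measurable_fun setT (u j)) ->
  (forall a, ((a i ^+ 2)%:E <= C%:E * (1 + L a))%E) ->
  (\int[space_time lam]_z (u i z ^+ 2)%:E <=
   (C * (1 + fine (space_time lam setT)))%:E *
   (1 + integral_functional (space_time lam) L u))%E.
Proof.
move=> C0 mu aC; have [L0 _ _ Lb] := cL.
have mLu : measurable_fun setT (fun z => L (fun j => u j z)) by exact: Lb.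
have M0 : (0 <= space_time lam setT)%E by exact: measure_ge0.
have Mf : space_time lam setT \is a fin_num.
  by rewrite ge0_fin_numE// space_time_lty.
set X := integral_functional _ _ _; have X0 : (0 <= X)%E by exact: (integral_functional_ge0 _ cL).
apply: (@le_trans _ _ (C%:E * (space_time lam setT + X)))%E.
  rewrite /X /integral_functional.
  have -> : (space_time lam setT = \int[space_time lam]_z cst 1 z)%E.
    by rewrite integral_cst ?mul1e.
  rewrite -ge0_integralD// -ge0_integralZl//; first last.
  - by move=> z _; rewrite adde_ge0.
  - by apply: emeasurable_funD.
  apply: ge0_le_integral => //.
  - by move=> z _; rewrite lee_fin sqr_ge0.
  - by apply/measurable_EFinP; exact: measurable_funX.
  - by apply: measurable_funeM; exact: emeasurable_funD.
  - by move=> z _; exact: aC.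
move: (space_time lam setT) M0 Mf X X0 => M M0 Mf X X0.
rewrite EFinM -muleA lee_wpmul2l ?lee_fin// EFinD fineK//.
rewrite ge0_muleDl// mul1e ge0_muleDr// mule1 addeACA.
by apply: leeD; [rewrite leeDr|rewrite leeDl// mule_ge0].
Qed.

(** Every field is an argument of some [Psi] occurring in the action with a positive weight, so
    [Psi_coercive] bounds its square by the integrand; integration adds the finite mass of
    space-time. *)
Lemma density_action_coercive : exists C : R, forall u,
  (forall i, measurable_fun setT (u i)) -> forall i,
  (\int[space_time (reference i)]_z (u i z ^+ 2)%:E <= C%:E * (1 + density_action u))%E.
Proof.
have [CO CO0 hO] := @Psi_coercive _ _ _ _ mO_adm d.
have [CG CG0 hG] := @Psi_coercive _ _ _ _ mG_adm 1.
have cO := convex_integrandO; have cG := convex_integrandG; have cE := convex_integrandE.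
have up (C k x : R) (P L : \bar R) : 0 <= C -> 0 <= k -> (0 <= P)%E -> (0 <= L)%E ->
    (x%:E <= C%:E * (1 + P))%E -> (P <= k%:E * L)%E -> (x%:E <= (C * (1 + k))%:E * (1 + L))%E.
  move=> C0 k0 P0 L0 xP PL; apply: (le_trans xP).
  rewrite EFinM -muleA lee_wpmul2l ?lee_fin// EFinD.
  apply: (@le_trans _ _ (1 + k%:E * L)%E); first by rewrite leeD2l.
  rewrite ge0_muleDl ?lee_fin// mul1e ge0_muleDr// mule1 addeACA.
  by apply: leeD; [rewrite leeDl ?lee_fin|rewrite leeDr].
have inv (k : R) (P L : \bar R) : 0 < k -> (k%:E * P <= L)%E -> (P <= k^-1%:E * L)%E.
  move=> k0 kP; rewrite -[X in (X <= _)%E]mul1e -(@mulVf _ k) ?gt_eqF// EFinM -muleA.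
  by rewrite lee_wpmul2l// lee_fin invr_ge0 ltW.
have P0 x y : (0 <= Psi1 mG x y)%E by exact: (Psi_ge0 mG_adm).
have bdO i : is_bulk_field i -> forall a, ((a i ^+ 2)%:E <= CO%:E * (1 + integrandO a))%E.
  case: i => // [k|] _ a; rewrite /integrandO.
    have := (hO (a fldRho) (\row_k a (fldJ k))).2 k.
    by rewrite mxE.
  exact: (hO (a fldRho) (\row_k a (fldJ k))).1.
have h1 x y : ((x ^+ 2)%:E <= CG%:E * (1 + Psi1 mG x y))%E by exact: (hG x (const_mx y)).1.
have h2 x y : ((y ^+ 2)%:E <= CG%:E * (1 + Psi1 mG x y))%E.
  by have := (hG x (const_mx y)).2 ord0; rewrite mxE.
(* The sum of the inverse weights dominates each of them, so that one constant removes any of the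
   three weights. *)
pose k := alpha1^-1 + alpha2^-1 + alpha3^-1.
have i1 : 0 < alpha1^-1 by rewrite invr_gt0.
have i2 : 0 < alpha2^-1 by rewrite invr_gt0.
have i3 : 0 < alpha3^-1 by rewrite invr_gt0.
have k0 : 0 <= k by rewrite /k; lra.
have kmono (x : R) (P L : \bar R) : x <= k -> (0 <= L)%E -> (P <= x%:E * L)%E -> (P <= k%:E * L)%E.
  by move=> xk L0 h; apply: (le_trans h); rewrite lee_wpmul2r// lee_fin.
have G0 a := integrand_ge0 cG a; have E0 a := integrand_ge0 cE a.
have g1 a : (Psi1 mG (a fldMu) (a fldV) <= k%:E * integrandG a)%E.
  apply: (kmono alpha1^-1) => //; first by rewrite /k; lra.
  by apply: inv => //; rewrite leeDl// mule_ge0// ?lee_fin ?ltW.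
have g2 a : (Psi1 mG (a fldMu) (a fldF) <= k%:E * integrandG a)%E.
  apply: (kmono alpha2^-1) => //; first by rewrite /k; lra.
  by apply: inv => //; rewrite leeDr// mule_ge0// ?lee_fin ?ltW.
have e1 a : (Psi1 mG (a fldMu0) (a fldG0) <= k%:E * integrandE a)%E.
  apply: (kmono alpha3^-1) => //; first by rewrite /k; lra.
  by apply: inv => //; apply: lee_wpmul2l; [rewrite lee_fin ltW|rewrite leeDl].
have e2 a : (Psi1 mG (a fldMu1) (a fldG1) <= k%:E * integrandE a)%E.
  apply: (kmono alpha3^-1) => //; first by rewrite /k; lra.
  by apply: inv => //; apply: lee_wpmul2l; [rewrite lee_fin ltW|rewrite leeDr].
pose CGk := CG * (1 + k); have CGk0 : 0 <= CGk by rewrite mulr_ge0// addr_ge0.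
have bdG i : is_curve_field i -> forall a, ((a i ^+ 2)%:E <= CGk%:E * (1 + integrandG a))%E.
  case: i => // _ a.
  - exact: (up _ _ _ _ _ CG0 k0 (P0 _ _) (G0 a) (h1 _ _) (g1 a)).
  - exact: (up _ _ _ _ _ CG0 k0 (P0 _ _) (G0 a) (h2 _ _) (g1 a)).
  - exact: (up _ _ _ _ _ CG0 k0 (P0 _ _) (G0 a) (h2 _ _) (g2 a)).
have bdE i : is_endpoint_field i -> forall a, ((a i ^+ 2)%:E <= CGk%:E * (1 + integrandE a))%E.
  case: i => // _ a.
  - exact: (up _ _ _ _ _ CG0 k0 (P0 _ _) (E0 a) (h1 _ _) (e1 a)).
  - exact: (up _ _ _ _ _ CG0 k0 (P0 _ _) (E0 a) (h2 _ _) (e1 a)).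
  - exact: (up _ _ _ _ _ CG0 k0 (P0 _ _) (E0 a) (h1 _ _) (e2 a)).
  - exact: (up _ _ _ _ _ CG0 k0 (P0 _ _) (E0 a) (h2 _ _) (e2 a)).
pose mass lam := 1 + fine (@space_time R _ (Rd R d) lam setT).
have m0 lam : 0 <= mass lam by rewrite addr_ge0// fine_ge0.
exists (CO * mass lamO + CGk * mass lamG + CGk * mass lamE) => u mu i.
have xO : 0 <= CO * mass lamO by rewrite mulr_ge0.
have xG : 0 <= CGk * mass lamG by rewrite mulr_ge0.
have xE : 0 <= CGk * mass lamE by rewrite mulr_ge0.
have pO := integral_functional_ge0 (space_time lamO) cO u.
have pG := integral_functional_ge0 (space_time lamG) cG u.
have pE := integral_functional_ge0 (space_time lamE) cE u.
have bound (x : R) (X : \bar R) : x <= CO * mass lamO + CGk * mass lamG + CGk * mass lamE ->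
    0 <= x -> (X <= density_action u)%E -> (0 <= X)%E ->
    (x%:E * (1 + X) <= (CO * mass lamO + CGk * mass lamG + CGk * mass lamE)%:E * (1 + density_action u))%E.
  move=> xC x0 XF X0; apply: lee_pmul; rewrite ?lee_fin ?adde_ge0//.
  by rewrite leeD2l.
have FO : (integral_functional (space_time lamO) integrandO u <= density_action u)%E.
  by rewrite leeDl// adde_ge0.
have FG : (integral_functional (space_time lamG) integrandG u <= density_action u)%E.
  by rewrite /density_action addeCA leeDl// adde_ge0.
have FE : (integral_functional (space_time lamE) integrandE u <= density_action u)%E.
  by rewrite /density_action addeA leeDr// adde_ge0.
have intO j : is_bulk_field j -> reference j = lamO -> (\int[space_time (reference j)]_z (u j z ^+ 2)%:E <=
    (CO * mass lamO + CGk * mass lamG + CGk * mass lamE)%:E * (1 + density_action u))%E.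
  move=> Oj ->; apply: (le_trans (integral_sqr_le lamO cO CO0 mu (bdO j Oj))).
  by apply: (bound (CO * mass lamO)) => //; clear bound; lra.
have intG j : is_curve_field j -> reference j = lamG -> (\int[space_time (reference j)]_z (u j z ^+ 2)%:E <=
    (CO * mass lamO + CGk * mass lamG + CGk * mass lamE)%:E * (1 + density_action u))%E.
  move=> Gj ->; apply: (le_trans (integral_sqr_le lamG cG CGk0 mu (bdG j Gj))).
  by apply: (bound (CGk * mass lamG)) => //; clear bound; lra.
have intE j : is_endpoint_field j -> reference j = lamE -> (\int[space_time (reference j)]_z (u j z ^+ 2)%:E <=
    (CO * mass lamO + CGk * mass lamG + CGk * mass lamE)%:E * (1 + density_action u))%E.
  move=> Ej ->; apply: (le_trans (integral_sqr_le lamE cE CGk0 mu (bdE j Ej))).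
  by apply: (bound (CGk * mass lamE)) => //; clear bound; lra.
by case: i => [k'||||||||]; [exact: intO|exact: intO|exact: intG|exact: intG|exact: intG|exact: intE..].
Qed.

End density_action.

(** * The action of a flow in terms of its densities *)

Section density_lemmas.
Context (R : realType) dT (T : measurableType dT).
Variable lam : {finite_measure set T -> \bar R}.
Implicit Types (nu : {charge set T -> \bar R}) (h : T -> R).

Lemma is_density_measurable nu h : is_density nu lam h -> measurable_fun setT h.
Proof. by move=> [hi _]; apply/measurable_EFinP; exact: measurable_int hi. Qed.

Lemma is_density_dominated nu h : is_density nu lam h -> nu `<< lam.
Proof.
move=> [hi nuE]; apply/null_content_dominatesP => B mB B0; rewrite nuE// null_set_integral//.
by apply: measurable_funTS; exact: measurable_int hi.
Qed.

Lemma measurable_density nu : nu `<< lam -> measurable_fun setT (density nu lam).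
Proof.
move=> nulam; apply: (measurableT_comp (@fine_measurable _ _ measurableT)).
by apply: (@measurable_int _ _ _ lam); exact: Radon_Nikodym_integrable.
Qed.

Lemma density_ae nu h : is_density nu lam h -> {ae lam, forall p, density nu lam p = h p}.
Proof.
move=> nud; have nulam := is_density_dominated nud; have [hi nuE] := nud.
have : ae_eq lam setT (Radon_Nikodym nu lam) (EFin \o h).
  apply: integral_ae_eq => //; first exact: Radon_Nikodym_integrable.
    exact: measurable_int hi.
  by move=> B _ mB; rewrite -Radon_Nikodym_integral// nuE.
by apply: filterS => p /(_ I) /= e; rewrite /density e.
Qed.

End density_lemmas.

Lemma integrand_ae_eq (R : realType) (I : finType) (A : set I) (L : (I -> R) -> \bar R)
    d (T : measurableType d) (lam : {finite_measure set T -> \bar R}) (D : set T)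
    (v w : I -> T -> R) :
  convex_integrand A L -> measurable D -> lam (~` D) = 0%E ->
  (forall i, A i -> measurable_fun setT (v i)) -> (forall i, A i -> measurable_fun setT (w i)) ->
  (forall i, A i -> {ae lam, forall p, v i p = w i p}) ->
  (forall a b : I -> R, (forall i, A i -> a i = b i) -> L a = L b) ->
  (\int[lam]_(p in D) L (fun i => v i p) = \int[lam]_p L (fun i => w i p))%E.
Proof.
move=> cL mD lD mv mw vw Lext; have [L0 _ _ Lb] := cL.
rewrite [RHS](ge0_negligible_integral (measurableC mD) measurableT)//; last exact: Lb.
rewrite setDE setCK setTI; apply: ge0_ae_eq_integral => //.
- by apply: measurable_funTS; exact: Lb.
- by apply: measurable_funTS; exact: Lb.
have : {ae lam, forall p i, A i -> v i p = w i p}.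
  apply: filter_forall => i; have [Ai|nAi] := pselect (A i); last by apply: aeW => p /nAi.
  by have := vw i Ai; apply: filterS.
by apply: filterS => p e _; exact: Lext.
Qed.

Section flow_action.
Context (R : realType) (d : nat).
Variables (Omega : set 'rV[R]_d) (gamma : R -> 'rV[R]_d).
Variables (mO mG : R -> \bar R) (aO bO aG bG alpha1 alpha2 alpha3 : R).
Hypothesis mO_adm : admissible_mobility mO aO bO.
Hypothesis mG_adm : admissible_mobility mG aG bG.
Hypothesis alpha1_gt0 : 0 < alpha1.
Hypothesis alpha2_gt0 : 0 < alpha2.
Hypothesis alpha3_gt0 : 0 < alpha3.
Hypothesis d_gt0 : (0 < d)%N.
Variables lamO lamG lamE : {finite_measure set (Rd R d) -> \bar R}.
Hypothesis mOmega : measurable (Omega : set (Rd R d)).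
Hypothesis mGamma : measurable (trace gamma : set (Rd R d)).
Hypothesis lamO_on : concentrated (Omega : set (Rd R d)) lamO.
Hypothesis lamG_on : concentrated (trace gamma : set (Rd R d)) lamG.
Hypothesis lamE_on : concentrated ([set gamma 0; gamma 1] : set (Rd R d)) lamE.
Local Notation Time := (measurableTypeR R).
Local Notation Z := (Time * Rd R d)%type.
Local Notation ref := (reference lamO lamG lamE).
Local Notation IO := (integrandO mO).
Local Notation IG := (integrandG mG alpha1 alpha2).
Local Notation IE := (integrandE mG alpha3).
Implicit Types (x : flow R d) (u : field d -> Z -> R).

Definition flow_charge x t (i : field d) : {charge set (Rd R d) -> \bar R} :=
  match i with
  | fldJ k => fJ x t k | fldRho => frho x t | fldMu => fmu x t
  | fldV => fcV x t | fldF => ff x t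
  | fldMu0 => restr_point (fmu x t) (gamma 0) | fldG0 => fcG0 x t
  | fldMu1 => restr_point (fmu x t) (gamma 1) | fldG1 => fcG1 x t
  end.

Lemma all_abs_contE x t :
  all_abs_cont gamma lamO lamG lamE x t <-> forall i, flow_charge x t i `<< ref i.
Proof.
split => [[[h1 h2] [h3 h4 h5] [h6 h7] [h8 h9]] []//|h].
split.
- by split => [|k]; [exact: (h fldRho)|exact: (h (fldJ k))].
- by split; [exact: (h fldMu)|exact: (h fldV)|exact: (h fldF)].
- by split; [exact: (h fldMu0)|exact: (h fldG0)].
- by split; [exact: (h fldMu1)|exact: (h fldG1)].
Qed.

Definition slice_action u (t : Time) : \bar R :=
  (\int[lamO]_p IO (fun i => u i (t, p)) + (\int[lamG]_p IG (fun i => u i (t, p)) +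
   \int[lamE]_p IE (fun i => u i (t, p))))%E.

(** Any densities may replace the Radon-Nikodym derivatives in the action, as they agree with them
    almost everywhere. The domains of integration disappear because each reference measure is
    concentrated on its own. *)
Lemma action_slice x u t :
  (forall i, is_density (flow_charge x t i) (ref i) (fun p => u i (t, p))) ->
  action Omega gamma mO mG alpha1 alpha2 alpha3 lamO lamG lamE x t = slice_action u t.
Proof.
move=> dens; rewrite /action asboolT; last first.
  by apply/all_abs_contE => i; exact: is_density_dominated (dens i).
have dd i : flow_charge x t i `<< ref i by exact: is_density_dominated (dens i).
pose v i p := density (flow_charge x t i) (ref i) p.
have mv i : measurable_fun setT (v i) by exact: measurable_density.
have mw i : measurable_fun setT (fun p => u i (t, p)) by exact: is_density_measurable (dens i).
have vw i : {ae ref i, forall p, v i p = u i (t, p)} by exact: density_ae (dens i).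
have cO := convex_integrandO mO_adm d_gt0.
have cG := convex_integrandG d mG_adm alpha1_gt0 alpha2_gt0.
have cE := convex_integrandE d mG_adm alpha3_gt0.
have mE : measurable ([set gamma 0; gamma 1] : set (Rd R d)).
  by apply: measurableU; exact: measurable_point.
have null (lam : {finite_measure set (Rd R d) -> \bar R}) (D : set (Rd R d)) :
    measurable D -> concentrated D lam -> lam (~` D) = 0%E.
  by move=> mD; apply => //; exact: measurableC.
rewrite /slice_action -addeA; congr (_ + (_ + _))%E.
- transitivity (\int[lamO]_(p in (Omega : set (Rd R d))) IO (fun i => v i p))%E; first by [].
  apply: (integrand_ae_eq cO mOmega (null _ _ mOmega lamO_on)) => //.
    by case=> // [k|] _; [exact: (vw (fldJ k))|exact: (vw fldRho)].
  move=> a b ab; rewrite /integrandO ab//; congr Psi; apply/rowP => k; rewrite !mxE.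
  exact: ab.
- transitivity (\int[lamG]_(p in (trace gamma : set (Rd R d))) IG (fun i => v i p))%E; first by [].
  apply: (integrand_ae_eq cG mGamma (null _ _ mGamma lamG_on)) => //.
    by case=> // _; [exact: (vw fldMu)|exact: (vw fldV)|exact: (vw fldF)].
  by move=> a b ab; rewrite /integrandG !ab.
- transitivity (\int[lamE]_(p in ([set gamma 0; gamma 1] : set (Rd R d))) IE (fun i => v i p))%E.
    rewrite /integrandE ge0_integralZl//.
    - have cE' : convex_integrand (@is_endpoint_field d) (fun a => Psi1 mG (a fldMu0) (a fldG0) + Psi1 mG (a fldMu1) (a fldG1))%E.
        by apply: convex_integrandD; apply: (convex_integrand_Psi1 mG_adm).
      by apply: measurable_funTS; apply: (integrand_measurable cE') => i _; exact: mv.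
    - by move=> p _; rewrite adde_ge0//; exact: (Psi_ge0 mG_adm).
    - by rewrite lee_fin ltW.
  apply: (integrand_ae_eq cE mE (null _ _ mE lamE_on)) => //.
    by case=> // _; [exact: (vw fldMu0)|exact: (vw fldG0)|exact: (vw fldMu1)|exact: (vw fldG1)].
  by move=> a b ab; rewrite /integrandE !ab.
Qed.

Lemma slice_action_ge0 u t : (0 <= slice_action u t)%E.
Proof.
have cO := convex_integrandO mO_adm d_gt0.
have cG := convex_integrandG d mG_adm alpha1_gt0 alpha2_gt0.
have cE := convex_integrandE d mG_adm alpha3_gt0.
apply: adde_ge0; first by apply: integral_ge0 => p _; exact: (integrand_ge0 cO).
by apply: adde_ge0; apply: integral_ge0 => p _; [exact: (integrand_ge0 cG)|exact: (integrand_ge0 cE)].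
Qed.

Lemma measurable_slice_action u : (forall i, measurable_fun setT (u i)) ->
  measurable_fun setT (slice_action u).
Proof.
move=> mu.
have cO := convex_integrandO mO_adm d_gt0.
have cG := convex_integrandG d mG_adm alpha1_gt0 alpha2_gt0.
have cE := convex_integrandE d mG_adm alpha3_gt0.
have mF A L (lam : {finite_measure set (Rd R d) -> \bar R}) : convex_integrand A L ->
    measurable_fun setT (fun t : Time => \int[lam]_p L (fun i => u i (t, p)))%E.
  move=> cL; apply: (measurable_fun_fubini_tonelli_F (fun z => L (fun i => u i z))).
    by apply: (integrand_measurable cL) => i _; exact: mu.
  by move=> z; exact: (integrand_ge0 cL).
apply: emeasurable_funD; first exact: mF cO.
by apply: emeasurable_funD; [exact: mF cG|exact: mF cE].
Qed.

Lemma density_action_slice u : (forall i, measurable_fun setT (u i)) ->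
  density_action mO mG alpha1 alpha2 alpha3 lamO lamG lamE u =
  (\int[lebesgue_measure]_(t in Icc01) slice_action u t)%E.
Proof.
move=> mu.
have cO := convex_integrandO mO_adm d_gt0.
have cG := convex_integrandG d mG_adm alpha1_gt0 alpha2_gt0.
have cE := convex_integrandE d mG_adm alpha3_gt0.
have mL A L : convex_integrand A L -> measurable_fun setT (fun z => L (fun i => u i z)).
  by move=> cL; apply: (integrand_measurable cL) => i _; exact: mu.
have mF A L (lam : {finite_measure set (Rd R d) -> \bar R}) : convex_integrand A L ->
    measurable_fun setT (fun t : Time => \int[lam]_p L (fun i => u i (t, p)))%E.
  move=> cL; apply: (measurable_fun_fubini_tonelli_F (fun z => L (fun i => u i z))).
    exact: mL cL.
  by move=> z; exact: (integrand_ge0 cL).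
have p0 A L (lam : {finite_measure set (Rd R d) -> \bar R}) : convex_integrand A L ->
    forall t, (0 <= \int[lam]_p L (fun i => u i (t, p)))%E.
  by move=> cL t; apply: integral_ge0 => p _; exact: (integrand_ge0 cL).
rewrite -ge0_integral_time_measure; [|exact: measurable_slice_action|exact: slice_action_ge0].
have hO := mF _ _ lamO cO; have hG := mF _ _ lamG cG; have hE := mF _ _ lamE cE.
have pO t := p0 _ _ lamO cO t; have pG t := p0 _ _ lamG cG t; have pE t := p0 _ _ lamE cE t.
have hGE := emeasurable_funD hG hE.
have pGE t := adde_ge0 (pG t) (pE t).
rewrite /slice_action (ge0_integralD _ _ _ hO _ hGE)//.
rewrite (ge0_integralD _ _ _ hG _ hE)//.
rewrite /density_action /integral_functional /space_time.
rewrite (fubini_tonelli1 (fun z => IO (fun i => u i z)));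
  [|exact: mL cO|by move=> z; exact: (integrand_ge0 cO)].
rewrite (fubini_tonelli1 (fun z => IG (fun i => u i z)));
  [|exact: mL cG|by move=> z; exact: (integrand_ge0 cG)].
rewrite (fubini_tonelli1 (fun z => IE (fun i => u i z)));
  [|exact: mL cE|by move=> z; exact: (integrand_ge0 cE)].
by [].
Qed.

End flow_action.

(** * The continuity equations as linear constraints on densities *)

Lemma is_C1_continuous (R : realType) (V : normedModType R) (f : V -> R) :
  is_C1 f -> continuous f.
Proof. by move=> [df _] x; apply: differentiable_continuous. Qed.

Section test_functions.
Context (R : realType) (d : nat).
Variables (Omega : set 'rV[R]_d) (gamma : R -> 'rV[R]_d).
Hypothesis Omega_compact : compact Omega.
Hypothesis gamma_Omega : trace gamma `<=` Omega.
Hypothesis gamma_cont : {within Icc01, continuous gamma}.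
Hypothesis gamma_inj : non_self_intersecting gamma.
Hypothesis speed_cont : {within Icc01, continuous (speed gamma)}.
Hypothesis gamma_regular : regular gamma.
Variables rho0 mu0 rho1 mu1 : {charge set (Rd R d) -> \bar R}.
Local Notation Time := (measurableTypeR R).
Local Notation Z := (Time * Rd R d)%type.
Local Notation s_ := (param_inv gamma).

(** Paired with the densities and summed over the fields, these functions reproduce the left-hand
    side of the bulk equation, signs included. *)
Definition bulk_test (phi : R * 'rV[R]_d -> R) (i : field d) : Z -> R :=
  match i with
  | fldJ k => on_slab (Omega : set (Rd R d)) (fun z : Z => 'D_(0, delta_mx ord0 k) phi z)
  | fldRho => on_slab (Omega : set (Rd R d)) (fun z : Z => 'D_(1, 0) phi z)
  | fldF => on_slab (trace gamma : set (Rd R d)) (fun z : Z => - phi z)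
  | fldG0 => on_slab ([set gamma 0] : set (Rd R d)) (fun z : Z => - phi z)
  | fldG1 => on_slab ([set gamma 1] : set (Rd R d)) (phi : Z -> R)
  | _ => fun=> 0
  end.

(** The curve equation is pulled back to space by [param_inv]. The preimage of [{0}] contains,
    besides [gamma 0], all points off the trace; this agrees with [pullback], which is the image
    under the same map with the same default value. *)
Definition curve_test (psi : R * R -> R) (i : field d) : Z -> R :=
  match i with
  | fldMu => on_slab (s_ @^-1` Icc01) (fun z : Z => 'D_(1, 0) psi (z.1, s_ z.2))
  | fldV => on_slab (s_ @^-1` Icc01)
      (fun z : Z => 'D_(0, 1) psi (z.1, s_ z.2) * (enorm (speed gamma (s_ z.2)))^-1)
  | fldF => on_slab (s_ @^-1` Icc01) (fun z : Z => psi (z.1, s_ z.2))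
  | fldG0 => on_slab (s_ @^-1` [set 0]) (fun z : Z => psi (z.1, s_ z.2))
  | fldG1 => on_slab (s_ @^-1` [set 1]) (fun z : Z => - psi (z.1, s_ z.2))
  | _ => fun=> 0
  end.

(* Testing against [1_A(t) 1_B(x)] forces [fldMu0], [fldMu1] to be the densities
   of the restrictions of [fldMu] to the end points ... *)
Definition restr_test (A : set Time) (B : set (Rd R d)) (j : bool) (i : field d) : Z -> R :=
  match i, j with
  | fldMu0, false | fldMu1, true => on_slab B (fun z : Z => \1_A z.1)
  | fldMu, false => on_slab (B `&` [set gamma 0]) (fun z : Z => - \1_A z.1)
  | fldMu, true => on_slab (B `&` [set gamma 1]) (fun z : Z => - \1_A z.1)
  | _, _ => fun=> 0
  end.

(* ... and [fldG0], [fldG1] to live at their respective end points. *)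
Definition point_test (A : set Time) (B : set (Rd R d)) (j : bool) (i : field d) : Z -> R :=
  match i, j with
  | fldG0, false => on_slab (B `\` [set gamma 0]) (fun z : Z => \1_A z.1)
  | fldG1, true => on_slab (B `\` [set gamma 1]) (fun z : Z => \1_A z.1)
  | _, _ => fun=> 0
  end.

Definition bulk_data (phi : R * 'rV[R]_d -> R) : R :=
  cint rho1 (Omega : set (Rd R d)) (fun p => phi (1, p))
  - cint rho0 (Omega : set (Rd R d)) (fun p => phi (0, p)).

Definition curve_data (psi : R * R -> R) : R :=
  cint (pullback gamma mu1) Icc01 (fun s => psi (1, s))
  - cint (pullback gamma mu0) Icc01 (fun s => psi (0, s)).

Inductive flow_test : (field d -> Z -> R) -> R -> Prop :=
  | flow_test_bulk phi : is_C1 phi -> flow_test (bulk_test phi) (bulk_data phi)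
  | flow_test_curve psi : is_C1 psi -> flow_test (curve_test psi) (curve_data psi)
  | flow_test_restr A B j : measurable A -> measurable B -> flow_test (restr_test A B j) 0
  | flow_test_point A B j : measurable A -> measurable B -> flow_test (point_test A B j) 0.

Definition flow_tests : set ((field d -> Z -> R) * R) := [set p | flow_test p.1 p.2].

Let measurable_s_ : measurable_fun setT s_.
Proof. exact: measurable_param_inv. Qed.

Lemma measurable_param_inv_preimage (D : set R) : measurable D -> measurable (s_ @^-1` D).
Proof. by move=> mD; rewrite -[X in measurable X]setTI; exact: measurable_s_. Qed.

Lemma measurable_bulk (f : R * 'rV[R]_d -> R) : continuous f -> measurable_fun setT (f : Z -> R).
Proof. by move=> cf; exact: (measurable_continuous_Rd cf). Qed.

Lemma measurable_curve (f : R * R -> R) : continuous f ->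
  measurable_fun setT (fun z : Z => f (z.1, s_ z.2)).
Proof.
move=> cf; have mf := measurable_continuous_prod_real cf.
apply: (measurableT_comp mf); apply/measurable_fun_pair => //=.
exact: (measurableT_comp measurable_s_).
Qed.

Lemma bulk_bounded (f : R * 'rV[R]_d -> R) : continuous f ->
  exists C, forall (t : R) (p : 'rV[R]_d), Icc01 t -> Omega p -> `|f (t, p)| <= C.
Proof.
move=> cf; have [||C hC] := @continuous_compact_bounded _ R f (Icc01 `*` Omega).
- exact: continuous_subspaceT.
- by apply: compact_setX => //; exact: segment_compact.
by exists C => t p t01 Op; exact: (hC (t, p)).
Qed.

Lemma curve_bounded (f : R * R -> R) : continuous f ->
  exists C, forall t s, Icc01 t -> Icc01 s -> `|f (t, s)| <= C.
Proof.
move=> cf; have [||C hC] := @continuous_compact_bounded _ R f (Icc01 `*` Icc01).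
- exact: continuous_subspaceT.
- by apply: compact_setX; exact: segment_compact.
by exists C => t s t01 s01; exact: (hC (t, s)).
Qed.

Lemma inv_speed_bounded : exists C, forall s, Icc01 s -> `|(enorm (speed gamma s))^-1| <= C.
Proof.
apply: continuous_compact_bounded; first exact: inv_speed_continuous.
exact: segment_compact.
Qed.

Definition slab_ok (D : set (Rd R d)) (g : Z -> R) :=
  [/\ measurable D, measurable_fun setT g &
     exists C, forall (t : R) (p : Rd R d), Icc01 t -> D p -> `|g (t, p)| <= C].

Lemma slab_okN D g : slab_ok D g -> slab_ok D (fun z => - g z).
Proof.
move=> [mD mg [C gC]]; split => //; first exact: (measurableT_comp (@oppr_measurable R setT)) mg.
by exists C => t p t01 Dp; rewrite normrN gC.
Qed.

Lemma slab_ok_bulk (D : set (Rd R d)) (f : R * 'rV[R]_d -> R) :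
  measurable D -> D `<=` (Omega : set (Rd R d)) -> continuous f ->
  slab_ok D (f : Z -> R).
Proof.
move=> mD DO cf; split => //; first exact: measurable_bulk.
have [C hC] := bulk_bounded cf.
by exists C => t p t01 /DO; exact: hC.
Qed.

Lemma slab_ok_curve D (f : R * R -> R) : measurable D -> continuous f ->
  slab_ok (s_ @^-1` D) (fun z : Z => f (z.1, s_ z.2)).
Proof.
move=> mD cf; split; [exact: measurable_param_inv_preimage|exact: measurable_curve|].
have [C hC] := curve_bounded cf.
by exists C => t p t01 _; apply: hC => //; exact: param_inv_Icc01.
Qed.

Lemma slab_ok_speed D (f : R * R -> R) : measurable D -> continuous f ->
  slab_ok (s_ @^-1` D) (fun z : Z => f (z.1, s_ z.2) * (enorm (speed gamma (s_ z.2)))^-1).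
Proof.
move=> mD cf; split; first exact: measurable_param_inv_preimage.
  apply: measurable_funM; first exact: measurable_curve.
  have m1 := measurable_param_inv_comp gamma_cont gamma_inj (inv_speed_continuous speed_cont gamma_regular).
  exact: (measurableT_comp m1).
have [C hC] := curve_bounded cf; have [C' hC'] := inv_speed_bounded.
exists (C * C') => t p t01 _; rewrite normrM.
have s01 := param_inv_Icc01 gamma_inj p.
by apply: ler_pM => //; [exact: hC|exact: hC'].
Qed.

Lemma slab_ok_indic D (A : set Time) : measurable D -> measurable A ->
  slab_ok D (fun z : Z => \1_A z.1).
Proof.
move=> mD mA; split => //.
  have m1 : measurable_fun setT (\1_A : Time -> R) by exact: measurable_indic.
  exact: (measurableT_comp m1).
by exists 1 => t p _ _; rewrite indicE; case: (_ \in _); rewrite ?normr1 ?normr0.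
Qed.

Lemma slab_okP D g : slab_ok D g -> measurable_fun setT (on_slab D g) /\
  exists C, forall z, `|on_slab D g z| <= C.
Proof.
move=> [mD mg [C gC]]; split; first exact: measurable_on_slab.
by exists `|C|; exact: on_slab_bounded gC.
Qed.

Let mOmega := compact_measurable_Rd Omega_compact.
Let mGamma := measurable_trace gamma_cont.

Lemma endpoint_Omega s : Icc01 s -> [set gamma s] `<=` Omega.
Proof. by move=> s01 _ ->; apply: gamma_Omega; exists s. Qed.

Lemma Icc01_0 : @Icc01 R 0. Proof. by rewrite /Icc01/= in_itv/= lexx ler01. Qed.
Lemma Icc01_1 : @Icc01 R 1. Proof. by rewrite /Icc01/= in_itv/= lexx ler01. Qed.

Lemma flow_tests_bounded p : flow_tests p -> forall i,
  measurable_fun setT (p.1 i) /\ exists C, forall z, `|p.1 i z| <= C.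
Proof.
have zero : measurable_fun setT ((fun=> 0) : Z -> R) /\
    exists C : R, forall z : Z, `|(fun=> 0 : R) z| <= C.
  by split => //; exists 0 => z; rewrite normr0.
case: p => T c; rewrite /flow_tests/= => h i; case: h => {T c}.
- move=> phi [dphi Dphi]; have cphi := is_C1_continuous (conj dphi Dphi).
  case: i => [k||||||||] //=; apply: slab_okP; do ?apply: slab_okN; apply: slab_ok_bulk => //;
    by [exact: measurable_point|exact: (endpoint_Omega Icc01_0)|exact: (endpoint_Omega Icc01_1)].
- move=> psi [dpsi Dpsi]; have cpsi := is_C1_continuous (conj dpsi Dpsi).
  case: i => [k||||||||]; try exact: zero; rewrite /curve_test; apply: slab_okP.
  + by apply: (@slab_ok_curve Icc01 ('D_(1, 0) psi)) => //; exact: measurable_itv.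
  + by apply: (@slab_ok_speed Icc01 ('D_(0, 1) psi)) => //; exact: measurable_itv.
  + by apply: (@slab_ok_curve Icc01 psi) => //; exact: measurable_itv.
  + exact: (@slab_ok_curve [set 0] psi).
  + by apply: (@slab_okN _ (fun z : Z => psi (z.1, s_ z.2))); apply: (@slab_ok_curve [set 1] psi).
- move=> A B j mA mB.
  by case: i => [k||||||||]; case: j => //=; apply: slab_okP; do ?apply: slab_okN;
    apply: slab_ok_indic => //; apply: measurableI => //; exact: measurable_point.
- move=> A B j mA mB.
  by case: i => [k||||||||]; case: j => //=; apply: slab_okP;
    apply: slab_ok_indic => //; apply: measurableD => //; exact: measurable_point.
Qed.

End test_functions.

(* [c] has time integral [r] once it is altered outside [E]. *)
Definition tint_mod (R : realType) (E : set R) (c : R -> R) (r : R) : Prop :=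
  exists c', [/\ tintegrable c', tint c' = r & forall t, Icc01 t -> E t -> c t = c' t].

Section tint_mod_lemmas.
Context (R : realType) (E : set (measurableTypeR R)).
Implicit Types c : R -> R.

Lemma tint_mod_tint c r : measurable E -> lebesgue_measure (Icc01 `\` E) = 0%E ->
  tint_mod E c r -> tintegrable c -> tint c = r.
Proof. by move=> mE E0 [c' [ic' <- cc']] ic; exact: (tint_ae mE E0). Qed.

Lemma tint_mod_full c r : Icc01 `<=` E -> tint_mod E c r -> tintegrable c /\ tint c = r.
Proof. by move=> IE [c' [ic' <- cc']]; apply: eq_tint => // t t01; apply: cc' => //; exact: IE. Qed.

Lemma tint_mod_sum (K : finType) (c : K -> R -> R) (r : K -> R) :
  (forall k, tint_mod E (c k) (r k)) -> tint_mod E (fun t => \sum_k c k t) (\sum_k r k).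
Proof.
move=> h; have /boolp.choice[c' hc'] := h.
exists (fun t => \sum_k c' k t).
have ic' k : tintegrable (c' k) by have [] := hc' k.
have [i1 i2] := tint_sum (index_enum K) ic'; split => //.
  by rewrite i2; apply: eq_bigr => k _; have [] := hc' k.
by move=> t t01 Et; apply: eq_bigr => k _; have [_ _ ->] := hc' k.
Qed.

End tint_mod_lemmas.

Section flow_pairing.
Context (R : realType) (d : nat).
Variables (Omega : set 'rV[R]_d) (gamma : R -> 'rV[R]_d).
Hypothesis Omega_compact : compact Omega.
Hypothesis gamma_Omega : trace gamma `<=` Omega.
Hypothesis gamma_cont : {within Icc01, continuous gamma}.
Hypothesis gamma_inj : non_self_intersecting gamma.
Hypothesis speed_cont : {within Icc01, continuous (speed gamma)}.
Hypothesis gamma_regular : regular gamma.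
Variables rho0 mu0 rho1 mu1 : {charge set (Rd R d) -> \bar R}.
Local Notation Time := (measurableTypeR R).
Local Notation Z := (Time * Rd R d)%type.
Local Notation s_ := (param_inv gamma).
Variables lamO lamG lamE : {finite_measure set (Rd R d) -> \bar R}.
Local Notation ref := (reference lamO lamG lamE).
Variables (x : flow R d) (u : field d -> Z -> R) (E : set Time).
Hypothesis u_int : forall i, (space_time (ref i)).-integrable setT (EFin \o u i).
Hypothesis u_slice : forall t i, (ref i).-integrable setT (fun p => (u i (t, p))%:E).
Hypothesis u_dens : forall t, Icc01 t -> E t ->
  forall i, is_density (flow_charge gamma x t i) (ref i) (fun p => u i (t, p)).

Definition pair_field (i : field d) (T : Z -> R) : R :=
  \int[space_time (ref i)]_z (T z * u i z).

Lemma tint_mod_slab i D g : slab_ok D g ->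
  tint_mod E (fun t => cint (flow_charge gamma x t i) D (fun p => g (t, p)))
    (pair_field i (on_slab D g)).
Proof.
move=> [mD mg [C gC]].
have := pairing_time (u_int i) (fun t => u_slice t i) (measurable_on_slab mD mg) (on_slab_bounded gC).
move=> [_ [ic e]]; exists (fun t => \int[ref i]_p (on_slab D g (t, p) * u i (t, p))).
split => // t t01 Et.
apply: (@cint_slab _ _ _ (ref i) (u i) _ D g C t t01) => //; first exact: (u_dens t01 Et).
by move=> p; exact: gC.
Qed.

Lemma pair_field0 i : pair_field i (fun=> 0) = 0.
Proof. by rewrite /pair_field; under eq_Rintegral do rewrite mul0r; rewrite Rintegral_cst// mul0r. Qed.

Lemma pair_fieldN i D g : slab_ok D g ->
  pair_field i (on_slab D (fun z => - g z)) = - pair_field i (on_slab D g).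
Proof.
move=> /slab_okP[mg [C gC]].
rewrite /pair_field -mulN1r -RintegralZl//; last first.
  exact: (integrable_bounded_mul measurableT mg (fun z _ => gC z)).
by apply: eq_Rintegral => z _; rewrite /on_slab mulrN mulNr mulN1r.
Qed.

Lemma tint_mod_pullback i (D : set R) (g : R * R -> R) :
  measurable D -> D `<=` Icc01 -> (forall t, measurable_fun D (fun s => g (t, s))) ->
  slab_ok (s_ @^-1` D) (fun z : Z => g (z.1, s_ z.2)) ->
  tint_mod E (fun t => cint (pullback gamma (flow_charge gamma x t i)) D (fun s => g (t, s)))
    (pair_field i (on_slab (s_ @^-1` D) (fun z : Z => g (z.1, s_ z.2)))).
Proof.
move=> mD DI mg ok; have [c' [ic' c'E cc']] := tint_mod_slab i ok.
exists c'; split => // t t01 Et; rewrite -cc'//.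
have [_ _ [C gC]] := ok.
rewrite /pullback (@cint_pushcharge _ _ _ _ _ _ _ D _ C)//.
- exact: measurable_param_inv.
- move=> s Ds; have /= := gC t (gamma s) t01; rewrite param_inv_gamma//; last exact: DI.
  exact.
Qed.

Let mOmega := compact_measurable_Rd Omega_compact.
Let mGamma := measurable_trace gamma_cont.

(** The five values are the pairings of the densities with the parts of [bulk_test]. One statement
    covers both directions: from flow to densities [E] has full measure in [[0,1]], from densities
    to flow it contains [[0,1]]. *)
Lemma tint_mod_bulk phi : is_C1 phi -> exists r1 r2 r3 r4 r5 : R,
  [/\ tint_mod E (fun t => cint (frho x t) Omega (fun p => 'D_(1, 0) phi (t, p))) r1,
      tint_mod E (fun t => \sum_(i < d)
        cint (fJ x t i) Omega (fun p => 'D_(0, delta_mx ord0 i) phi (t, p))) r2,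
      tint_mod E (fun t => cint (ff x t) (trace gamma) (fun p => phi (t, p))) r3,
      tint_mod E (fun t => cint (fcG0 x t) [set gamma 0] (fun p => phi (t, p))) r4 /\
      tint_mod E (fun t => cint (fcG1 x t) [set gamma 1] (fun p => phi (t, p))) r5 &
      \sum_i pair_field i (bulk_test Omega gamma phi i) = r1 + r2 - r3 - r4 + r5].
Proof.
move=> [dphi Dphi]; have cphi := is_C1_continuous (conj dphi Dphi).
have okO v : slab_ok (Omega : set (Rd R d)) ('D_v phi : Z -> R).
  exact: (slab_ok_bulk Omega_compact mOmega (fun=> id) (Dphi v)).
have okG : slab_ok (trace gamma : set (Rd R d)) (phi : Z -> R).
  exact: (slab_ok_bulk Omega_compact mGamma gamma_Omega cphi).
have okp s : Icc01 s -> slab_ok ([set gamma s] : set (Rd R d)) (phi : Z -> R).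
  move=> s01; apply: (slab_ok_bulk Omega_compact _ _ cphi); first exact: measurable_point.
  exact: (endpoint_Omega gamma_Omega).
have ok0 := okp _ (@Icc01_0 R); have ok1 := okp _ (@Icc01_1 R).
do 5 eexists; split.
- exact: (tint_mod_slab fldRho (okO _)).
- by apply: tint_mod_sum => k; exact: (tint_mod_slab (fldJ k) (okO _)).
- exact: (tint_mod_slab fldF okG).
- by split; [exact: (tint_mod_slab fldG0 ok0)|exact: (tint_mod_slab fldG1 ok1)].
rewrite sum_field /bulk_test !pair_field0 !pair_fieldN//; set a := \sum_(k < d) _; set b := pair_field _ _.
by rewrite !add0r (addrCA a) !addrA.
Qed.

Lemma tint_mod_curve psi : is_C1 psi -> exists r1 r2 r3 r4 r5 : R,
  [/\ tint_mod E (fun t => cint (pullback gamma (fmu x t)) Icc01 (fun s => 'D_(1, 0) psi (t, s))) r1,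
      tint_mod E (fun t => cint (pullback gamma (fcV x t)) Icc01
        (fun s => 'D_(0, 1) psi (t, s) * (enorm (speed gamma s))^-1)) r2,
      tint_mod E (fun t => cint (pullback gamma (ff x t)) Icc01 (fun s => psi (t, s))) r3,
      tint_mod E (fun t => cint (pullback gamma (fcG0 x t)) [set 0] (fun s => psi (t, s))) r4 /\
      tint_mod E (fun t => cint (pullback gamma (fcG1 x t)) [set 1] (fun s => psi (t, s))) r5 &
      \sum_i pair_field i (curve_test gamma psi i) = r1 + r2 + r3 + r4 - r5].
Proof.
move=> [dpsi Dpsi]; have cpsi := is_C1_continuous (conj dpsi Dpsi).
have mI : measurable (@Icc01 R) by exact: measurable_itv.
have I0 : [set 0 : R] `<=` Icc01 by move=> _ ->; exact: Icc01_0.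
have I1 : [set 1 : R] `<=` Icc01 by move=> _ ->; exact: Icc01_1.
have mslice (f : R * R -> R) t D : continuous f -> measurable_fun D (fun s => f (t, s)).
  move=> cf; apply: measurable_funTS.
  exact: (measurableT_comp (measurable_continuous_prod_real cf) (measurable_pair1 t)).
have mspeed : measurable_fun Icc01 (fun s => (enorm (speed gamma s))^-1).
  apply: subspace_continuous_measurable_fun => //.
  exact: (inv_speed_continuous speed_cont gamma_regular).
have ok := @slab_ok_curve _ _ _ gamma_cont gamma_inj.
do 5 eexists; split.
- exact: (@tint_mod_pullback fldMu Icc01 ('D_(1, 0) psi) mI _ (fun t => mslice _ t _ (Dpsi _)) (ok _ _ mI (Dpsi _))).
- apply: (@tint_mod_pullback fldV Icc01 (fun z => 'D_(0, 1) psi z * (enorm (speed gamma z.2))^-1) mI) => //.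
    by move=> t; apply: measurable_funM => //; exact: (mslice ('D_(0, 1) psi) t _ (Dpsi _)).
  exact: (slab_ok_speed gamma_cont gamma_inj speed_cont gamma_regular mI (Dpsi _)).
- exact: (@tint_mod_pullback fldF Icc01 psi mI _ (fun t => mslice _ t _ cpsi) (ok _ _ mI cpsi)).
- split.
    exact: (@tint_mod_pullback fldG0 [set 0] psi _ I0 (fun t => mslice _ t _ cpsi) (ok _ _ _ cpsi)).
  exact: (@tint_mod_pullback fldG1 [set 1] psi _ I1 (fun t => mslice _ t _ cpsi) (ok _ _ _ cpsi)).
rewrite sum_field /curve_test big1 => [|k _]; last exact: pair_field0.
have e := pair_fieldN fldG1 (ok [set 1] psi (measurable_set1 _) cpsi).
by rewrite e !pair_field0 !add0r !addrA.
Qed.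

Lemma bulk_equation_test phi : measurable E -> lebesgue_measure (Icc01 `\` E) = 0%E ->
  is_C1 phi -> CE_bulk Omega gamma rho0 rho1 x phi ->
  \sum_i pair_field i (bulk_test Omega gamma phi i) = bulk_data Omega rho0 rho1 phi.
Proof.
move=> mE E0 C1 [i1 i2 i3 [i4 i5] e].
have [r1 [r2 [r3 [r4 [r5 [m1 m2 m3 [m4 m5] ->]]]]]] := tint_mod_bulk C1.
rewrite /bulk_data -e -(tint_mod_tint mE E0 m1 i1) -(tint_mod_tint mE E0 m2 i2).
by rewrite -(tint_mod_tint mE E0 m3 i3) -(tint_mod_tint mE E0 m4 i4) -(tint_mod_tint mE E0 m5 i5).
Qed.

Lemma curve_equation_test psi : measurable E -> lebesgue_measure (Icc01 `\` E) = 0%E ->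
  is_C1 psi -> CE_curve gamma mu0 mu1 x psi ->
  \sum_i pair_field i (curve_test gamma psi i) = curve_data gamma mu0 mu1 psi.
Proof.
move=> mE E0 C1 [i1 i2 i3 [i4 i5] e].
have [r1 [r2 [r3 [r4 [r5 [m1 m2 m3 [m4 m5] ->]]]]]] := tint_mod_curve C1.
rewrite /curve_data -e -(tint_mod_tint mE E0 m1 i1) -(tint_mod_tint mE E0 m2 i2).
by rewrite -(tint_mod_tint mE E0 m3 i3) -(tint_mod_tint mE E0 m4 i4) -(tint_mod_tint mE E0 m5 i5).
Qed.

Lemma bulk_test_equation phi : Icc01 `<=` E -> is_C1 phi ->
  \sum_i pair_field i (bulk_test Omega gamma phi i) = bulk_data Omega rho0 rho1 phi ->
  CE_bulk Omega gamma rho0 rho1 x phi.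
Proof.
move=> IE C1; have [r1 [r2 [r3 [r4 [r5 [m1 m2 m3 [m4 m5] ->]]]]]] := tint_mod_bulk C1.
have [i1 e1] := tint_mod_full IE m1; have [i2 e2] := tint_mod_full IE m2.
have [i3 e3] := tint_mod_full IE m3; have [i4 e4] := tint_mod_full IE m4.
have [i5 e5] := tint_mod_full IE m5.
by move=> e; split => //; rewrite e1 e2 e3 e4 e5.
Qed.

Lemma curve_test_equation psi : Icc01 `<=` E -> is_C1 psi ->
  \sum_i pair_field i (curve_test gamma psi i) = curve_data gamma mu0 mu1 psi ->
  CE_curve gamma mu0 mu1 x psi.
Proof.
move=> IE C1; have [r1 [r2 [r3 [r4 [r5 [m1 m2 m3 [m4 m5] ->]]]]]] := tint_mod_curve C1.
have [i1 e1] := tint_mod_full IE m1; have [i2 e2] := tint_mod_full IE m2.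
have [i3 e3] := tint_mod_full IE m3; have [i4 e4] := tint_mod_full IE m4.
have [i5 e5] := tint_mod_full IE m5.
by move=> e; split => //; rewrite e1 e2 e3 e4 e5.
Qed.

End flow_pairing.

(** * The constraints at the end points *)

Section indicator_tests.
Context (R : realType) (d : nat).
Local Notation Time := (measurableTypeR R).
Local Notation Z := (Time * Rd R d)%type.
Variables lamO lamG lamE : {finite_measure set (Rd R d) -> \bar R}.
Local Notation ref := (reference lamO lamG lamE).
Variables (u : field d -> Z -> R).
Hypothesis u_int : forall i, (space_time (ref i)).-integrable setT (EFin \o u i).
Hypothesis u_slice : forall t i, (ref i).-integrable setT (fun p => (u i (t, p))%:E).

Lemma pair_indic i (A : set Time) (D : set (Rd R d)) : measurable A -> measurable D ->
  tintegrable (fun t => \1_A t * \int[ref i]_(p in D) u i (t, p)) /\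
  tint (fun t => \1_A t * \int[ref i]_(p in D) u i (t, p)) =
  pair_field lamO lamG lamE u i (on_slab D (fun z : Z => \1_A z.1)).
Proof.
move=> mA mD; have [_ mg [C gC]] := slab_ok_indic mD mA.
have := pairing_time (u_int i) (fun t => u_slice t i) (measurable_on_slab mD mg) (on_slab_bounded gC).
move=> [_ [ic e]]; rewrite /pair_field -e; apply: eq_tint => // t t01.
rewrite Rintegral_on_slab//= RintegralZl//.
exact: (integrableS measurableT mD _ (u_slice t i)).
Qed.

Variable gamma : R -> 'rV[R]_d.

Definition endpoint (j : bool) : 'rV[R]_d := gamma (if j then 1 else 0).
Definition end_mu (j : bool) : field d := if j then fldMu1 else fldMu0.
Definition end_G (j : bool) : field d := if j then fldG1 else fldG0.

(** The amount by which, at time [t] and on [B], the field for the restricted measure fails to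
    represent the restriction of [fldMu] to the end point. As a function of [B] it is a difference
    of two charges. *)
Definition restr_gap (B : set (Rd R d)) j (t : Time) : R :=
  \int[lamE]_(p in B) u (end_mu j) (t, p)
  - \int[lamG]_(p in B `&` [set endpoint j]) u fldMu (t, p).

Definition point_gap (B : set (Rd R d)) j (t : Time) : R :=
  \int[lamE]_(p in B `\` [set endpoint j]) u (end_G j) (t, p).

Lemma sum_restr_test A B j : measurable A -> measurable B ->
  tintegrable (fun t => \1_A t * restr_gap B j t) /\
  \sum_i pair_field lamO lamG lamE u i (restr_test gamma A B j i) =
  tint (fun t => \1_A t * restr_gap B j t).
Proof.
move=> mA mB; have mBp : measurable (B `&` [set endpoint j]).
  by apply: measurableI => //; exact: measurable_point.
have [i1 e1] := pair_indic (end_mu j) mA mB; have [i2 e2] := pair_indic fldMu mA mBp.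
have lE : ref (end_mu j) = lamE by case: j {mBp i1 e1 i2 e2}.
rewrite lE in i1 e1.
have mI := @measurable_Icc01 R.
have gapE : (fun t : R => \1_A t * restr_gap B j t) =
   (fun t => \1_A t * (\int[lamE]_(p in B) u (end_mu j) (t, p))
           - \1_A t * (\int[lamG]_(p in B `&` [set endpoint j]) u fldMu (t, p))).
  by apply/funext => t; rewrite /restr_gap mulrBr.
split; first by rewrite gapE; exact: (integrableB mI i1 i2).
rewrite gapE; have eB := RintegralB mI i1 i2; rewrite /tint eB.
move: e1 e2; rewrite /tint => -> ->.
have eN := pair_fieldN u_int fldMu (slab_ok_indic mBp mA).
rewrite -eN sum_field big1 => [|k _]; last exact: (pair_field0 _ _ _ u).
by clear -u; case: j; rewrite /= !(pair_field0 _ _ _ u) !(add0r, addr0) // addrC.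
Qed.

Lemma sum_point_test A B j : measurable A -> measurable B ->
  tintegrable (fun t => \1_A t * point_gap B j t) /\
  \sum_i pair_field lamO lamG lamE u i (point_test gamma A B j i) =
  tint (fun t => \1_A t * point_gap B j t).
Proof.
move=> mA mB; have mBp : measurable (B `\` [set endpoint j]).
  by apply: measurableD => //; exact: measurable_point.
have [i1 e1] := pair_indic (end_G j) mA mBp.
have lE : ref (end_G j) = lamE by case: j {mBp i1 e1}.
rewrite lE in i1 e1; split => //.
rewrite /point_gap e1 sum_field big1 => [|k _]; last exact: (pair_field0 _ _ _ u).
by clear; case: j; rewrite /= !(pair_field0 _ _ _ u) !(add0r, addr0).
Qed.

End indicator_tests.

(** * From flows to densities and back *)

Section charge_of.
Context (R : realType) dT (T : measurableType dT).
Variable lam : {finite_measure set T -> \bar R}.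

Definition charge_of (h : T -> R) : {charge set T -> \bar R} :=
  match pselect (lam.-integrable setT (EFin \o h)) with
  | left ih => induced_charge ih
  | right _ => czero
  end.

Lemma charge_of_density h : lam.-integrable setT (EFin \o h) -> is_density (charge_of h) lam h.
Proof. by rewrite /charge_of => ih; split => // B mB; case: pselect. Qed.

Lemma charge_of_fine h B : lam.-integrable setT (EFin \o h) -> measurable B ->
  charge_of h B = (\int[lam]_(p in B) h p)%:E.
Proof.
move=> ih mB; have [_ ->//] := charge_of_density ih; rewrite fineK//.
by apply: integrable_fin_num => //; exact: (integrableS measurableT).
Qed.

End charge_of.

Section flows_and_densities.
Context (R : realType) (d : nat).
Variables (Omega : set 'rV[R]_d) (gamma : R -> 'rV[R]_d).
Variables (mO mG : R -> \bar R) (aO bO aG bG alpha1 alpha2 alpha3 : R).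
Hypothesis mO_adm : admissible_mobility mO aO bO.
Hypothesis mG_adm : admissible_mobility mG aG bG.
Hypothesis alpha1_gt0 : 0 < alpha1.
Hypothesis alpha2_gt0 : 0 < alpha2.
Hypothesis alpha3_gt0 : 0 < alpha3.
Hypothesis Omega_compact : compact Omega.
Hypothesis gamma_Omega : trace gamma `<=` Omega.
Hypothesis gamma_cont : {within Icc01, continuous gamma}.
Hypothesis gamma_inj : non_self_intersecting gamma.
Hypothesis speed_cont : {within Icc01, continuous (speed gamma)}.
Hypothesis gamma_regular : regular gamma.
Variables lamO lamG lamE : {finite_measure set (Rd R d) -> \bar R}.
Hypothesis lamO_on : concentrated (Omega : set (Rd R d)) lamO.
Hypothesis lamG_on : concentrated (trace gamma : set (Rd R d)) lamG.
Hypothesis lamE_on : concentrated ([set gamma 0; gamma 1] : set (Rd R d)) lamE.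
Variables rho0 mu0 rho1 mu1 : {charge set (Rd R d) -> \bar R}.
Local Notation Time := (measurableTypeR R).
Local Notation Z := (Time * Rd R d)%type.
Local Notation ref := (reference lamO lamG lamE).
Local Notation tests := (flow_tests Omega gamma rho0 mu0 rho1 mu1).
Local Notation feas := (feasible (fun i => space_time (ref i)) tests).
Local Notation F := (density_action mO mG alpha1 alpha2 alpha3 lamO lamG lamE).
Local Notation act := (action Omega gamma mO mG alpha1 alpha2 alpha3 lamO lamG lamE).
Local Notation tact := (total_action Omega gamma mO mG alpha1 alpha2 alpha3 lamO lamG lamE).

Let d_gt0 : (0 < d)%N := curve_dim_gt0 gamma_inj.
Let mOmega : measurable (Omega : set (Rd R d)) := compact_measurable_Rd Omega_compact.
Let mGamma := measurable_trace gamma_cont.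

Lemma density_Rintegral nu (lam : {finite_measure set (Rd R d) -> \bar R}) h B :
  is_density nu lam h -> measurable B -> \int[lam]_(p in B) h p = fine (nu B).
Proof. by move=> [_ h_nu] mB; rewrite h_nu. Qed.

Lemma tint0 (E : set Time) (c : R -> R) : measurable E -> lebesgue_measure (Icc01 `\` E) = 0%E ->
  tintegrable c -> (forall t, Icc01 t -> E t -> c t = 0) -> tint c = 0.
Proof.
move=> mE E0 ic c0; have it0 : tintegrable (fun=> 0 : R) by exact: integrable0.
have -> : 0 = tint (fun=> 0 : R).
  by rewrite /tint Rintegral_cst ?mul0r//; exact: measurable_Icc01.
exact: (tint_ae mE E0).
Qed.

Lemma restr_pointE (nu : {charge set (Rd R d) -> \bar R}) p B : measurable B ->
  restr_point nu p B = nu (B `&` [set p]).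
Proof. by move=> mB; rewrite /restr_point/= /crestr0 mem_set. Qed.

Lemma flow_charge_family x i B : Dadm Omega gamma x -> measurable B ->
  measurable_fun Icc01 (fun t => flow_charge gamma x t i B).
Proof.
move=> [hJ [_ [_ hV] _] [_ hrho] [[_ hmu] [_ hf]] [[_ [_ h0] _] [_ [_ h1] _]]] mB.
have mBp p : measurable (B `&` [set p] : set (Rd R d)).
  by apply: measurableI => //; exact: measurable_point.
case: i => [k||||||||] /=; do ?[exact: hV|exact: hrho|exact: hmu|exact: hf|exact: h0|exact: h1].
- by have [_] := hJ k; exact.
- by under eq_fun do rewrite restr_pointE//; exact: hmu.
- by under eq_fun do rewrite restr_pointE//; exact: hmu.
Qed.

(** The set [E] collects the times at which all the measures of the flow are absolutely continuous.
    The indicator of [E] in the densities makes their slices integrable at every time, also where no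
    density exists. *)
Lemma flow_joint_density x : Dadm Omega gamma x ->
  exists (E : set Time) (u : field d -> Z -> R),
  [/\ measurable E, forall i, measurable_fun setT (u i),
      forall t i, (ref i).-integrable setT (fun p => (u i (t, p))%:E),
      forall t, Icc01 t -> E t ->
        forall i, is_density (flow_charge gamma x t i) (ref i) (fun p => u i (t, p)) &
      forall t, Icc01 t -> ~ E t -> act x t = +oo%E].
Proof.
move=> Dx; have [U mU genU] := Rd_generating_seq R d.
pose nu i (t : Time) : {charge set (Rd R d) -> \bar R} :=
  if t \in (Icc01 : set R) then flow_charge gamma x t i else czero.
have mnu i B : measurable B -> measurable_fun setT (fun t => nu i t B).
  move=> mB; have mI := @measurable_Icc01 R.
  have := flow_charge_family i Dx mB => /(measurable_restrictT _ mI).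
  by congr measurable_fun; apply/funext => t; rewrite /nu /patch; case: ifP.
have : forall i, exists Dh : set Time * (Z -> R), [/\ measurable Dh.1, measurable_fun setT Dh.2,
    (forall t, Dh.1 t <-> nu i t `<< ref i) &
    forall t, Dh.1 t -> is_density (nu i t) (ref i) (fun p => Dh.2 (t, p))].
  move=> i; have [D [h [mD mh Dnu dh]]] := joint_density mU genU (ref i) (mnu i).
  by exists (D, h); split.
move=> /boolp.choice[Dh hDh].
pose E := \bigcap_i (Dh i).1.
have mE : measurable E.
  apply: fin_bigcap_measurable; first exact: finite_finset.
  by move=> i _; have [] := hDh i.
exists E, (fun i z => \1_E z.1 * (Dh i).2 z).
have uE t i : E t -> (fun p => \1_E t * (Dh i).2 (t, p)) = (fun p => (Dh i).2 (t, p)).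
  by move=> Et; apply/funext => p; rewrite indicE mem_set// mul1r.
split => //.
- move=> i; have [_ mh _ _] := hDh i; apply: measurable_funM => //.
  have m1 : measurable_fun setT (\1_E : Time -> R) by exact: measurable_indic.
  exact: (measurableT_comp m1).
- move=> t i /=; have [Et|nEt] := pselect (E t).
    have [_ _ _ /(_ t (Et i I))[hi _]] := hDh i.
    by rewrite (_ : (fun p => _) = EFin \o (fun p => \1_E t * (Dh i).2 (t, p)))// uE.
  rewrite (_ : (fun p => _) = cst 0%E); first exact: integrable0.
  by apply/funext => p; rewrite indicE memNset// mul0r.
- move=> t t01 Et i /=; rewrite uE//; have [_ _ _ /(_ t (Et i I))] := hDh i.
  by rewrite /nu mem_set.
- move=> t t01 nEt; rewrite /action asboolF// => /all_abs_contE hac; apply: nEt => i _.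
  by have [_ _ -> _] := hDh i; rewrite /nu mem_set//; exact: hac.
Qed.

(** Finite action forces absolute continuity at almost every time. The continuity equations then
    become the first two kinds of constraints, and the other two hold because the flow has actual
    restrictions and end point measures concentrated at their points. *)
Lemma flow_density x : CE Omega gamma rho0 mu0 rho1 mu1 x -> (tact x < +oo)%E ->
  exists2 u, feas u & (F u <= tact x)%E.
Proof.
move=> [Dx bulk curve] fin.
have [E [u [mE mu us ud uoo]]] := flow_joint_density Dx.
have mI := @measurable_Icc01 R.
have sa_ge0 := slice_action_ge0 mO_adm mG_adm alpha1_gt0 alpha2_gt0 alpha3_gt0 d_gt0 lamO lamG lamE u.
have msa := measurable_slice_action mO_adm mG_adm alpha1_gt0 alpha2_gt0 alpha3_gt0 d_gt0 lamO lamG lamE mu.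
pose sa := slice_action mO mG alpha1 alpha2 alpha3 lamO lamG lamE u.
(* A representative of the action that is measurable on the whole line and equal to it on
   [[0,1]]. *)
pose g (t : Time) : \bar R := if t \in E then sa t else +oo%E.
have mg : measurable_fun setT g.
  apply: measurable_fun_if => //.
    apply: (measurable_fun_bool true); rewrite setTI (_ : _ @^-1` _ = E)//.
    by apply/seteqP; split => t /=; [exact: set_mem|exact: mem_set].
  by apply: measurable_funTS; exact: msa.
have g_ge0 t : (0 <= g t)%E by rewrite /g; case: ifP => // _; exact: sa_ge0.
have tactE : tact x = (\int[lebesgue_measure]_(t in Icc01) g t)%E.
  apply: eq_integral => t; rewrite inE => t01; rewrite /g; case: ifPn; [rewrite inE|rewrite notin_setE] => Et.
    apply: (action_slice mO_adm mG_adm) => //; exact: (ud t t01 Et).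
  exact: uoo.
(* The action is [+oo] on this set, so positive measure would make the total action infinite. *)
have E0 : lebesgue_measure (Icc01 `\` E) = 0%E.
  apply/eqP; rewrite -measure_le0 leNgt; apply/negP => pos.
  have mIE : measurable (Icc01 `\` E : set Time) by exact: measurableD.
  have : (\int[lebesgue_measure]_(t in Icc01 `\` E) g t <= tact x)%E.
    by rewrite tactE; apply: ge0_subset_integral => //; exact: measurable_funTS.
  rewrite (@eq_integral _ _ _ _ _ (cst +oo%E)); last first.
    by move=> t; rewrite inE => -[_ nEt]; rewrite /g memNset.
  rewrite integral_cst// gt0_mulye// leye_eq => /eqP e.
  by rewrite e ltxx in fin.
have Fx : (F u <= tact x)%E.
  rewrite (density_action_slice mO_adm mG_adm)// tactE; apply: ge0_le_integral => //.
  - by apply: measurable_funTS; exact: msa.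
  - by apply: measurable_funTS; exact: mg.
  - by move=> t t01; rewrite /g; case: ifP => // _; exact: leey.
exists u => //.
(* Integrability on space-time is not part of the definition of a flow: it follows from the [L^2]
   bound contained in the finite action. *)
have ui i : (space_time (ref i)).-integrable setT (EFin \o u i).
  apply: L2_integrable => //; first exact: space_time_lty.
  have [C hC] := density_action_coercive mO_adm mG_adm alpha1_gt0 alpha2_gt0 alpha3_gt0 d_gt0 lamO lamG lamE.
  apply/integrableP; split.
    apply/measurable_EFinP; exact: measurable_funX.
  under eq_integral do rewrite /= ger0_norm ?sqr_ge0//.
  apply: (le_lt_trans (hC u mu i)).
  have fF : F u \is a fin_num.
    rewrite ge0_fin_numE; first exact: (le_lt_trans Fx).
    exact: (density_action_ge0 mO_adm mG_adm).
  by rewrite -(fineK fF) -EFinD -EFinM ltry.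
split => //.
case=> T c; rewrite /flow_tests/= => -[{T c}phi C1|psi C1|A B j mA mB|A B j mA mB].
- apply: (bulk_equation_test Omega_compact gamma_Omega gamma_cont ui us ud mE E0 C1).
  exact: bulk.
- apply: (curve_equation_test gamma_cont gamma_inj speed_cont gamma_regular ui us ud mE E0 C1).
  exact: curve.
- have [ic ->] := sum_restr_test ui us gamma j mA mB; apply: (tint0 mE E0 ic) => t t01 Et.
  have mBp : measurable (B `&` [set endpoint gamma j]).
    by apply: measurableI => //; exact: measurable_point.
  have := ud t t01 Et (end_mu d j).
  rewrite /restr_gap (density_Rintegral (ud t t01 Et fldMu) mBp) => dj.
  suff -> : \int[lamE]_(p in B) u (end_mu d j) (t, p) = fine (fmu x t (B `&` [set endpoint gamma j])).
    by rewrite subrr mulr0.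
  by case: j dj {mBp ic} => dj; rewrite (density_Rintegral dj mB)/= restr_pointE.
- have [ic ->] := sum_point_test ui us gamma j mA mB; apply: (tint0 mE E0 ic) => t t01 Et.
  have mBp : measurable (B `\` [set endpoint gamma j]).
    by apply: measurableD => //; exact: measurable_point.
  have := ud t t01 Et (end_G d j) => dj.
  rewrite /point_gap.
  suff -> : \int[lamE]_(p in B `\` [set endpoint gamma j]) u (end_G d j) (t, p) = 0 by rewrite mulr0.
  have [_ _ _ _ [[_ [c0 _] _] [_ [c1 _] _]]] := Dx.
  have sC : B `\` [set endpoint gamma j] `<=` ~` [set endpoint gamma j] by apply: subIsetr.
  by case: j dj sC mBp {ic} => dj sC mBp; rewrite (density_Rintegral dj mBp)/= (c1, c0).
Qed.

(** The value 0 satisfies every homogeneous relation required at a fixed time, so bad times are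
    cured by it. *)
Definition off_null (N : set Time) (u : field d -> Z -> R) : field d -> Z -> R :=
  fun i z => \1_(~` N) z.1 * u i z.

Lemma off_nullE N u t i : ~ N t -> (fun p => off_null N u i (t, p)) = (fun p => u i (t, p)).
Proof. by move=> Nt; apply/funext => p; rewrite /off_null indicE mem_set// mul1r. Qed.

Lemma off_null0 N u t i : N t -> (fun p => off_null N u i (t, p)) = cst 0.
Proof. by move=> Nt; apply/funext => p; rewrite /off_null indicE memNset ?mul0r//; exact. Qed.

(** The change takes place on a null set of space-time, so all pairings persist. The inequality for
    [F] is lower semicontinuity along the constant sequence [u], which converges almost everywhere
    to the modified densities. *)
Lemma feasible_off_null u N : measurable N -> time_measure R N = 0%E -> feas u ->
  feas (off_null N u) /\ (F (off_null N u) <= F u)%E.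
Proof.
move=> mN N0 [mu iu eu].
have mind : measurable_fun setT (fun z : Z => \1_(~` N) z.1 : R).
  have m1 : measurable_fun setT (\1_(~` N) : Time -> R).
    by apply: measurable_indic; exact: measurableC.
  exact: (measurableT_comp m1).
have ind1 (z : Z) : `|\1_(~` N) z.1 : R| <= 1.
  by rewrite indicE; case: (_ \in _); rewrite ?normr1 ?normr0.
have mu' i : measurable_fun setT (off_null N u i) by exact: measurable_funM.
have iu' i : (space_time (ref i)).-integrable setT (EFin \o off_null N u i).
  exact: (integrable_bounded_mul measurableT mind (fun z _ => ind1 z)).
have aeu i : {ae space_time (ref i), forall z, off_null N u i z = u i z}.
  exists (N `*` setT); split; first exact: measurableX.
    have e := product_measure1E (time_measure R) (ref i) mN (@measurableT _ (Rd R d)).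
    by rewrite /space_time [LHS]e [X in (X * _)%E]N0 mul0e.
  move=> [t p] /= h; split => //; apply: contrapT => Nt; apply: h.
  by rewrite /off_null indicE mem_set// mul1r.
have bounded := @flow_tests_bounded _ _ _ _ Omega_compact gamma_Omega gamma_cont gamma_inj
  speed_cont gamma_regular rho0 mu0 rho1 mu1.
split.
  split => // p Phip; rewrite -(eu p Phip); apply: eq_bigr => i _.
  have [mp [C pC]] := bounded p Phip i.
  rewrite /Rintegral; congr fine; apply: ae_eq_integral => //.
  - by apply/measurable_EFinP; exact: measurable_funM.
  - by apply/measurable_EFinP; exact: measurable_funM.
  by have := aeu i; apply: filterS => z /= -> _.
have cv i : {ae space_time (ref i), forall z, (fun=> u) ^~ i ^~ z @ \oo --> off_null N u i z}.
  by have := aeu i; apply: filterS => z /= ->; exact: cvg_cst.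
have := density_action_lsc mO_adm mG_adm alpha1_gt0 alpha2_gt0 alpha3_gt0 d_gt0
  (fun=> mu) mu' cv.
have [-> _] := @cvg_limn_einf_sup R (fun=> F u) (F u) (cvg_cst _).
by [].
Qed.

Lemma ae_time_null (P : Time -> Prop) : {ae time_measure R, forall t, P t} ->
  exists N : set Time, [/\ measurable N, time_measure R N = 0%E & forall t, ~ N t -> P t].
Proof.
move=> [N [mN N0 PN]]; exists N; split => // t Nt; apply: contrapT => nP.
by apply: Nt; exact: PN.
Qed.

Lemma integrable_slices u : (forall i, (space_time (ref i)).-integrable setT (EFin \o u i)) ->
  {ae time_measure R, forall t i, (ref i).-integrable setT (fun p => (u i (t, p))%:E)}.
Proof.
move=> iu; apply: filter_forall => i.
exact: (ae_integrable1 (iu i)).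
Qed.

Lemma tint_indic_eq0 (g : Time -> R) :
  (forall A : set Time, measurable A ->
    tintegrable (fun t => \1_A t * g t) /\ tint (fun t => \1_A t * g t) = 0) ->
  {ae time_measure R, forall t, g t = 0}.
Proof.
move=> gA; have mI := @measurable_Icc01 R.
have gi : lebesgue_measure.-integrable Icc01 (EFin \o g).
  have [h _] := gA setT measurableT; move: h; congr (lebesgue_measure.-integrable _ _).
  by apply/funext => t /=; rewrite indicT mul1r.
have : ae_eq lebesgue_measure Icc01 (EFin \o g) (cst 0%E).
  apply: integral_ae_eq => // E EI mE; rewrite integral0.
  have [h1 h2] := gA E mE.
  rewrite -(setIidr EI) integral_mkcondr.
  transitivity (\int[lebesgue_measure]_(t in Icc01) (\1_E t * g t)%:E)%E.
    apply: eq_integral => t _; rewrite /patch indicE; case: ifP => _ /=; first by rewrite mul1r.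
    by rewrite mul0r.
  have := integrable_fin_num mI h1 => /fineK <-; congr EFin; exact: h2.
move=> [N [mN N0 gN]]; exists (N `|` ~` Icc01); split.
- by apply: measurableU => //; exact: measurableC.
- rewrite measureU0 //; [|exact: measurableC|exact: time_measureC].
  have NI : (lebesgue_measure (N `&` Icc01) <= lebesgue_measure N)%E.
    by apply: le_measure; rewrite ?inE//; exact: measurableI.
  by apply/eqP; rewrite -measure_le0; apply: (le_trans NI); rewrite N0.
- move=> t /= gt; have [t01|] := pselect (Icc01 t); last by right.
  by left; apply: gN => /= /(_ t01) [].
Qed.

Section gap_cells.
Variable U : nat -> set (Rd R d).
Hypothesis mU : forall n, measurable (U n).
Hypothesis genU : forall B : set (Rd R d), measurable B -> <<s range U>> B.
Variables (u : field d -> Z -> R) (t : Time) (j : bool).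
Hypothesis us : forall i, (ref i).-integrable setT (fun p => (u i (t, p))%:E).

(** The two terms of the gap are charges in [B], so equality on the countably many cells extends to
    all Borel sets. This is what keeps the exceptional times independent of [B]. *)
Lemma restr_gap_cells : (forall n (c : {ffun 'I_n -> bool}), restr_gap lamG lamE u gamma (cell U c) j t = 0) ->
  forall B, measurable B -> restr_gap lamG lamE u gamma B j t = 0.
Proof.
have iE : lamE.-integrable setT (EFin \o (fun p => u (end_mu d j) (t, p))).
  by case: (j); [exact: (us fldMu1)|exact: (us fldMu0)].
have iG := us fldMu.
have gapE (B : set (Rd R d)) : measurable B -> (restr_gap lamG lamE u gamma B j t)%:E =
   (charge_of lamE (fun p => u (end_mu d j) (t, p)) B -
    restr_point (charge_of lamG (fun p => u fldMu (t, p))) (endpoint gamma j) B)%E.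
  move=> mB; rewrite restr_pointE// charge_of_fine// charge_of_fine//.
  by apply: measurableI => //; exact: measurable_point.
have eqP0 (B : set (Rd R d)) : measurable B -> restr_gap lamG lamE u gamma B j t = 0 <->
   charge_of lamE (fun p => u (end_mu d j) (t, p)) B =
    restr_point (charge_of lamG (fun p => u fldMu (t, p))) (endpoint gamma j) B.
  move=> mB; have f1 := fin_num_measure (charge_of lamE (fun p => u (end_mu d j) (t, p))) B mB.
  have f2 := fin_num_measure (restr_point (charge_of lamG (fun p => u fldMu (t, p))) (endpoint gamma j)) B mB.
  split => h.
    by have := gapE B mB; rewrite h => /esym/eqP; rewrite sube_eq// add0e => /eqP.
  by apply: EFin_inj; rewrite gapE// h subee.
move=> hc B mB; apply/eqP0 => //; apply: (charge_ext_cells mU genU) => // n c.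
by apply/eqP0; [exact: measurable_cell|exact: hc].
Qed.

Lemma point_gap_cells : (forall n (c : {ffun 'I_n -> bool}), point_gap lamE u gamma (cell U c) j t = 0) ->
  forall B, measurable B -> point_gap lamE u gamma B j t = 0.
Proof.
have iE : lamE.-integrable setT (EFin \o (fun p => u (end_G d j) (t, p))).
  by case: (j); [exact: (us fldG1)|exact: (us fldG0)].
have mp : measurable (~` [set endpoint gamma j] : set (Rd R d)).
  by apply: measurableC; exact: measurable_point.
pose nu : {charge set (Rd R d) -> \bar R} :=
  crestr0 (charge_of lamE (fun p => u (end_G d j) (t, p))) mp.
have gapE (B : set (Rd R d)) : measurable B -> (point_gap lamE u gamma B j t)%:E = nu B.
  move=> mB; rewrite /nu /= /crestr0 mem_set//= /crestr charge_of_fine//.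
  exact: measurableI.
move=> hc B mB; apply: EFin_inj; rewrite gapE//.
rewrite (@charge_ext_cells _ _ _ U mU genU nu czero)// => n c.
by rewrite -gapE ?hc//; exact: measurable_cell.
Qed.

End gap_cells.

(** Two successive corrections: off [N1] all slices are integrable, by Fubini; off [N2] the gaps
    vanish on all cells. The order matters, since the gaps are differences of charges only when the
    slices are integrable. *)
Lemma regular_density u : feas u -> exists u', [/\ feas u', (F u' <= F u)%E,
  forall t i, (ref i).-integrable setT (fun p => (u' i (t, p))%:E) &
  forall t j B, measurable B -> restr_gap lamG lamE u' gamma B j t = 0 /\ point_gap lamE u' gamma B j t = 0].
Proof.
move=> fu; have [U mU genU] := Rd_generating_seq R d.
have sl_off v N : (forall t, ~ N t -> forall i, (ref i).-integrable setT (fun p => (v i (t, p))%:E)) ->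
    forall t i, (ref i).-integrable setT (fun p => (off_null N v i (t, p))%:E).
  move=> h t i; have [Nt|Nt] := pselect (N t).
    rewrite (_ : (fun p => _) = cst 0%E); first exact: integrable0.
    by apply/funext => p; have := congr1 (fun f => f p) (off_null0 v i Nt) => /= ->.
  rewrite (_ : (fun p => _) = (fun p => (v i (t, p))%:E)); first exact: h.
  by apply/funext => p; have := congr1 (fun f => f p) (off_nullE v i Nt) => /= ->.
have [N1 [mN1 N10 sl1]] := ae_time_null (integrable_slices (let: And3 _ h _ := fu in h)).
have [fu1 Fu1] := feasible_off_null mN1 N10 fu.
set u1 := off_null N1 u in fu1 Fu1.
have us1 : forall t i, (ref i).-integrable setT (fun p => (u1 i (t, p))%:E) by exact: sl_off.
clearbody u1; have [_ iu1 eu1] := fu1.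
have gaps : {ae time_measure R, forall t n (c : {ffun 'I_n -> bool}) j,
    restr_gap lamG lamE u1 gamma (cell U c) j t = 0 /\ point_gap lamE u1 gamma (cell U c) j t = 0}.
  apply: ae_foralln => n; apply: filter_forall => c; apply: filter_forall => j.
  have mc := measurable_cell mU c.
  have hr : {ae time_measure R, forall t, restr_gap lamG lamE u1 gamma (cell U c) j t = 0}.
    apply: tint_indic_eq0 => A mA; have [h1 <-] := sum_restr_test iu1 us1 gamma j mA mc.
    by split => //; exact: (eu1 (_, 0) (flow_test_restr _ _ _ _ _ _ j mA mc)).
  have hp : {ae time_measure R, forall t, point_gap lamE u1 gamma (cell U c) j t = 0}.
    apply: tint_indic_eq0 => A mA; have [h1 <-] := sum_point_test iu1 us1 gamma j mA mc.
    by split => //; exact: (eu1 (_, 0) (flow_test_point _ _ _ _ _ _ j mA mc)).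
  by move: hr hp; apply: filterS2 => t.
have [N2 [mN2 N20 gap2]] := ae_time_null gaps.
have [fu2 Fu2] := feasible_off_null mN2 N20 fu1.
exists (off_null N2 u1); split => //; first exact: (le_trans Fu2).
  by apply: sl_off => t _; exact: us1.
move=> t j B mB; rewrite /restr_gap /point_gap.
have [Nt|Nt] := pselect (N2 t).
  rewrite !off_null0// !Rintegral_cst ?mul0r ?subrr//.
  - by apply: measurableD => //; exact: measurable_point.
  - by apply: measurableI => //; exact: measurable_point.
rewrite !off_nullE//; split.
  apply: (restr_gap_cells mU genU (us1 t)) => // n c.
  by have [] := gap2 t Nt n c j.
apply: (point_gap_cells mU genU (us1 t)) => // n c.
by have [] := gap2 t Nt n c j.
Qed.

(** * The flow built from regular densities *)

Section flow_of_densities.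
Variable u : field d -> Z -> R.
Hypothesis u_feas : feas u.
Hypothesis us : forall t i, (ref i).-integrable setT (fun p => (u i (t, p))%:E).
Hypothesis u_restr : forall t j B, measurable B -> restr_gap lamG lamE u gamma B j t = 0.
Hypothesis u_point : forall t j B, measurable B -> point_gap lamE u gamma B j t = 0.

(** The weight is the constant 1 for the scalar measures and a component of the unit tangent for the
    tangential ones, so that both are treated by the same lemmas. *)
Definition weighted (i : field d) (w : Rd R d -> R) (t : R) : {charge set (Rd R d) -> \bar R} :=
  charge_of (ref i) (fun p => w p * u i (t, p)).

Definition tangential (i : field d) (t : R) (k : 'I_d) : {charge set (Rd R d) -> \bar R} :=
  weighted i (fun p => unit_tangent gamma p ord0 k) t.

Definition flow_of : flow R d :=
  let nu i t := weighted i (fun=> 1) t in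
  Flow (fun t k => nu (fldJ k) t) (tangential fldV) (nu fldRho) (nu fldMu) (nu fldF)
    (tangential fldG0) (tangential fldG1) (nu fldV) (nu fldG0) (nu fldG1).

Lemma weighted1_density i t : is_density (weighted i (fun=> 1) t) (ref i) (fun p => u i (t, p)).
Proof.
rewrite /weighted (_ : (fun p => 1 * _) = (fun p => u i (t, p))).
  exact: (charge_of_density (us t i)).
by apply/funext => p; rewrite mul1r.
Qed.

Section weight.
Variables (i : field d) (w : Rd R d -> R).
Hypothesis mw : measurable_fun setT w.
Hypothesis w1 : forall p, `|w p| <= 1.

Lemma weighted_integrable t : (ref i).-integrable setT (EFin \o (fun p => w p * u i (t, p))).
Proof. exact: (integrable_bounded_mul measurableT mw (fun p _ => w1 p) (us t i)). Qed.

Lemma weightedE t B : measurable B ->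
  weighted i w t B = (\int[ref i]_(p in B) (w p * u i (t, p)))%:E.
Proof. by move=> mB; rewrite /weighted charge_of_fine//; exact: weighted_integrable. Qed.

Lemma measurable_weighted B : measurable B -> measurable_fun Icc01 (fun t => weighted i w t B).
Proof.
move=> mB; apply: measurable_funTS; have [_ ui _] := u_feas.
under eq_fun do rewrite weightedE//.
apply/measurable_EFinP.
have mphi : measurable_fun setT (fun z : Z => \1_B z.2 * w z.2).
  have m1 : measurable_fun setT (fun p : Rd R d => \1_B p * w p).
    by apply: measurable_funM => //; exact: measurable_indic.
  exact: (measurableT_comp m1).
have phi1 (z : Z) : `|\1_B z.2 * w z.2| <= 1.
  rewrite normrM -[leRHS]mulr1; apply: ler_pM => //.
  by rewrite indicE; case: (_ \in _); rewrite ?normr1 ?normr0.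
have [m _] := pairing_time (ui i) (fun t => us t i) mphi phi1.
move: m; congr measurable_fun; apply/funext => t.
rewrite [RHS]Rintegral_mkcond; apply: eq_Rintegral => p _.
by rewrite /patch indicE /=; case: ifP => _; rewrite ?mul1r ?mul0r.
Qed.

Lemma weighted_null t B : measurable B -> ref i B = 0%E -> weighted i w t B = 0%E.
Proof.
move=> mB B0; rewrite weightedE// /Rintegral null_set_integral//.
by apply: measurable_funTS; exact: measurable_int (weighted_integrable t).
Qed.

Lemma weighted_family A : concentrated A (ref i) -> Mfamily A (weighted i w).
Proof.
move=> refA; split; last exact: measurable_weighted.
by move=> t _ B mB BA; apply: weighted_null => //; exact: refA.
Qed.

Lemma weighted_tangential (t : R) B : measurable B ->
  weighted i w t B = (cint (weighted i (fun=> 1) t) B w)%:E.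
Proof.
move=> mB; rewrite weightedE//; congr EFin; apply/esym.
by rewrite (cint_density (weighted1_density i t) mB _ (fun p _ => w1 p))//; exact: measurable_funTS.
Qed.

End weight.

(** The measure [lamE] may charge both end points, so concentration at one of them cannot come from
    the reference measure. The constraint [u_point] supplies it: the density vanishes [lamE]-almost
    everywhere off the point. *)
Lemma weighted_point_family j (w : Rd R d -> R) : measurable_fun setT w -> (forall p, `|w p| <= 1) ->
  Mfamily ([set endpoint gamma j] : set (Rd R d)) (weighted (end_G d j) w).
Proof.
move=> mw w1; split; last exact: measurable_weighted.
move=> t _ B mB BA; rewrite weightedE//.
have lE : ref (end_G d j) = lamE by case: (j).
have ui := us t (end_G d j); rewrite lE in ui.
have uiB : lamE.-integrable B (EFin \o (fun p => u (end_G d j) (t, p))).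
  exact: (integrableS measurableT).
have ae0 : ae_eq lamE B (EFin \o (fun p => u (end_G d j) (t, p))) (cst 0%E).
  apply: integral_ae_eq => // B' B'B mB'; rewrite integral0.
  have := u_point t j mB'; rewrite /point_gap (_ : B' `\` _ = B').
    have iB' : lamE.-integrable B' (EFin \o (fun p => u (end_G d j) (t, p))).
      exact: (integrableS measurableT).
    have := integrable_fin_num mB' iB' => /fineK <- e; congr EFin; exact: e.
  by rewrite setDE setIidl// => p /B'B /BA.
rewrite lE /Rintegral (@ae_eq_integral _ _ _ _ _ (cst 0%E)) ?integral0//.
  apply/measurable_EFinP; apply: measurable_funM; first exact: measurable_funTS.
  by apply/measurable_EFinP; exact: measurable_int uiB.
by move: ae0; apply: filterS => p /= h /h [->]; rewrite mulr0.
Qed.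

(** Only the restrictions of [mu_t] call for an argument: the flow defines them through [fldMu] and
    [lamG], and [u_restr] says that the corresponding fields are their densities with respect to
    [lamE]. *)
Lemma flow_of_density t i :
  is_density (flow_charge gamma flow_of t i) (ref i) (fun p => u i (t, p)).
Proof.
have dens j := weighted1_density j t.
have densE j : is_density (restr_point (weighted fldMu (fun=> 1) t) (endpoint gamma j)) lamE
    (fun p => u (end_mu d j) (t, p)).
  have lE : ref (end_mu d j) = lamE by case: (j).
  have ui := us t (end_mu d j); rewrite lE in ui.
  split => // B mB; rewrite restr_pointE//.
  have mBp : measurable (B `&` [set endpoint gamma j]).
    by apply: measurableI => //; exact: measurable_point.
  have [_ ->//] := dens fldMu.
  have /eqP := u_restr t j mB; rewrite /restr_gap subr_eq0 => /eqP e.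
  have f1 := integrable_fin_num mB (integrableS measurableT mB (@subsetT _ _) ui).
  have f2 := integrable_fin_num mBp (integrableS measurableT mBp (@subsetT _ _) (us t fldMu)).
  by rewrite -(fineK f1) -(fineK f2); congr EFin; exact: esym e.
case: i => [k||||||||]; do ?exact: dens.
- exact: (densE false).
- exact: (densE true).
Qed.

Lemma flow_of_Dadm : Dadm Omega gamma flow_of.
Proof.
have one1 (p : Rd R d) : `|(fun=> 1 : R) p| <= 1 by rewrite normr1.
have m1 : measurable_fun setT ((fun=> 1) : Rd R d -> R) by [].
have mt := measurable_unit_tangent gamma_cont gamma_inj speed_cont gamma_regular.
have tl k p := unit_tangent_le1 gamma_inj gamma_regular p k.
have tang i A : (forall w : Rd R d -> R, measurable_fun setT w -> (forall p, `|w p| <= 1) ->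
    Mfamily A (weighted i w)) -> tangential_family gamma A (tangential i) (weighted i (fun=> 1)).
  move=> h; split; [by move=> k; apply: h|exact: h|].
  by move=> t _ k B mB; apply: weighted_tangential.
split.
- by move=> k; apply: weighted_family.
- by apply: tang => w mw w1; apply: weighted_family.
- exact: weighted_family.
- by split; apply: weighted_family.
- split; apply: tang => w mw w1.
    exact: (@weighted_point_family false).
  exact: (@weighted_point_family true).
Qed.

Lemma flow_of_CE : CE Omega gamma rho0 mu0 rho1 mu1 flow_of.
Proof.
have [mu iu eu] := u_feas.
have IT : Icc01 `<=` [set: Time] by [].
have dens t (_ : Icc01 t) (_ : [set: Time] t) i := flow_of_density t i.
split; first exact: flow_of_Dadm.
- move=> phi C1.
  apply: (bulk_test_equation Omega_compact gamma_Omega gamma_cont iu us dens IT C1).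
  exact: (eu (_, _) (flow_test_bulk _ _ _ _ _ _ C1)).
- move=> psi C1.
  apply: (curve_test_equation gamma_cont gamma_inj speed_cont gamma_regular iu us dens IT C1).
  exact: (eu (_, _) (flow_test_curve _ _ _ _ _ _ C1)).
Qed.

Lemma total_action_flow_of : tact flow_of = F u.
Proof.
have [mu _ _] := u_feas.
rewrite (density_action_slice mO_adm mG_adm)//; apply: eq_integral => t _.
by apply: (action_slice mO_adm mG_adm) => // i; exact: flow_of_density.
Qed.

End flow_of_densities.

End flows_and_densities.

Theorem theorem2p12 (R : realType) (d : nat)
    (Omega : set 'rV[R]_d) (Omega_compact : compact Omega)
    (Omega_connected : connected Omega)
    (mO mG : R -> \bar R) (aO bO aG bG : R)
    (mO_adm : admissible_mobility mO aO bO)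
    (mG_adm : admissible_mobility mG aG bG)
    (alpha1 alpha2 alpha3 : R)
    (alpha1_gt0 : 0 < alpha1) (alpha2_gt0 : 0 < alpha2) (alpha3_gt0 : 0 < alpha3)
    (gamma : R -> 'rV[R]_d) (gamma_C1 : C1_curve gamma)
    (gamma_regular : regular gamma) (gamma_inj : non_self_intersecting gamma)
    (gamma_Omega : trace gamma `<=` Omega)
    (lamO lamG lamE : {finite_measure set (Rd R d) -> \bar R})
    (lamO_on : concentrated (Omega : set (Rd R d)) lamO)
    (lamG_on : concentrated (trace gamma : set (Rd R d)) lamG)
    (lamE_on : concentrated ([set gamma 0; gamma 1] : set (Rd R d)) lamE)
    (rho0 mu0 rho1 mu1 : {charge set (Rd R d) -> \bar R})
    (data0 : Padm Omega gamma rho0 mu0) (data1 : Padm Omega gamma rho1 mu1) :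
  let A := total_action Omega gamma mO mG alpha1 alpha2 alpha3 lamO lamG lamE in
  let C := CE Omega gamma rho0 mu0 rho1 mu1 in
  ereal_inf [set A x | x in C] \is a fin_num ->
  exists x, C x /\ A x = ereal_inf [set A y | y in C].
Proof.
move=> A C Afin.
have gamma_cont := C1_curve_continuous gamma_C1.
have speed_cont := gamma_C1.2.
have d_gt0 := curve_dim_gt0 gamma_inj.
pose M i := @space_time R _ (Rd R d) (reference lamO lamG lamE i).
pose Phi := flow_tests Omega gamma rho0 mu0 rho1 mu1.
pose F : _ -> \bar R := density_action mO mG alpha1 alpha2 alpha3 lamO lamG lamE.
have to_density x : C x -> (A x < +oo)%E -> exists2 u, feasible M Phi u & (F u <= A x)%E.
  by move=> Cx Ax; exact: (flow_density mO_adm mG_adm alpha1_gt0 alpha2_gt0 alpha3_gt0 Omega_compact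
    gamma_Omega gamma_cont gamma_inj speed_cont gamma_regular lamO_on lamG_on lamE_on Cx Ax).
(* The infimum would be [+oo] if the class were empty or contained only flows of infinite action. *)
have [y Cy Ay] : exists2 y, C y & (A y < +oo)%E.
  apply: contrapT => h; move: Afin; suff -> : ereal_inf [set A x | x in C] = +oo%E by [].
  apply/ereal_inf_pinfty => _ [x Cx <-]; apply: contrapT => /eqP.
  by rewrite -ltey => Ax; apply: h; exists x.
have [u0 fu0 Fu0] := to_density y Cy Ay.
have [u fu umin] : exists2 u, feasible M Phi u & forall v, feasible M Phi v -> (F u <= F v)%E.
  apply: direct_method.
  - by move=> i; exact: space_time_lty.
  - exact: flow_tests_bounded.
  - by move=> v; exact: (density_action_ge0 mO_adm mG_adm).
  - by move=> v w mv mw; exact: (density_action_mid mO_adm mG_adm).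
  - by move=> un v mun mv cv; exact: (density_action_lsc mO_adm mG_adm).
  - exact: (density_action_coercive mO_adm mG_adm).
  - by exists u0 => //; exact: le_lt_trans Ay.
have [v [fv Fv vs gaps]] := @regular_density _ _ _ _ _ _ _ _ _ _ _ _ _
  mO_adm mG_adm alpha1_gt0 alpha2_gt0 alpha3_gt0 Omega_compact gamma_Omega gamma_cont gamma_inj speed_cont gamma_regular lamO lamG lamE rho0 mu0 rho1 mu1 u fu.
pose x := flow_of gamma lamO lamG lamE v.
have Cx : C x.
  by apply: flow_of_CE => // t j B mB; have [] := gaps t j B mB.
have Ax : A x = F v.
  apply: (total_action_flow_of mO_adm mG_adm) => //.
    exact: fv.
  by move=> t j B mB; have [] := gaps t j B mB.
have {}Fv : (F v <= F u)%E by exact: Fv.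
clearbody x A F; exists x; split => //; apply/eqP; rewrite eq_le; apply/andP; split.
  (* A competitor of finite action has feasible densities [w] with [F w] at most its action, and the
     chain [A x = F v <= F u <= F w] concludes. *)
  apply: le_ereal_inf_tmp => _ [z Cz <-].
  have [Az|] := ltP (A z) +oo%E; last by apply: le_trans; exact: leey.
  have [w fw Fw] := to_density z Cz Az.
  by rewrite Ax; exact: (le_trans (le_trans Fv (umin w fw)) Fw).
by apply: ereal_inf_lbound; exists x.
Qed.
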